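(* Let $s\in(0,1)$, $N\ge2$ and $\mu_0=-2^{2s}\frac{\Gamma^2(\frac{N+2s}{4})}{\Gamma^2(\frac{N-2s}{4})}$. Then for every $\mu\ge\mu_0$ there exist a unique $\tau_-(s,\mu)\in(-N,\frac{2s-N}{2}]$ and a unique $\tau_+(s,\mu)\in[\frac{2s-N}{2},2s)$ such that the functions $\Phi_{s,\mu},\Gamma_{s,\mu}\in L^1(\mathbb{R}^N,\frac{dx}{1+|x|^{N+2s}})\cap C^\infty(\mathbb{R}^N\setminus\{0\})$ given by $$\Phi_{s,\mu}(x)=\begin{cases}|x|^{\tau_-(s,\mu)}&\text{if }\mu>\mu_0,\\-|x|^{\tau_-(s,\mu)}\ln|x|&\text{if }\mu=\mu_0,\end{cases}\qquad \Gamma_{s,\mu}(x)=|x|^{\tau_+(s,\mu)}$$ are classical solutions of $$(-\Delta)^su+\frac{\mu}{|x|^{2s}}u=0\quad\text{in }\mathbb{R}^N\setminus\{0\}.$$ Furthermore, $\mu\mapsto\tau_-(s,\mu)$ is continuous and strictly decreasing in $[\mu_0,+\infty)$, and $\mu\mapsto\tau_+(s,\mu)$ is continuous and strictly increasing in $[\mu_0,+\infty)$. In addition, $$\tau_-(s,\mu)+\tau_+(s,\mu)=2s-N\quad\text{for all }\mu\ge\mu_0,$$ $$\tau_-(s,\mu_0)=\tau_+(s,\mu_0)=\frac{2s-N}{2},\qquad\tau_-(s,0)=2s-N,\qquad\tau_+(s,0)=0,$$ $$\lim_{\mu\to+\infty}\tau_-(s,\mu)=-N,\qquad\lim_{\m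u\to+\infty}\tau_+(s,\mu)=2s.$$
   Context: The fractional Laplacian is $(-\Delta)^su(x)=C_{N,s}\lim_{\epsilon\to0^+}\int_{\mathbb{R}^N\setminus B_\epsilon(x)}\frac{u(x)-u(z)}{|x-z|^{N+2s}}dz$ with $C_{N,s}=2^{2s}\pi^{-N/2}s\,\Gamma(\frac{N+2s}{2})/\Gamma(1-s)$, where $\Gamma(\cdot)$ (without subscripts) is the Gamma function. A classical solution satisfies the equation pointwise in $\mathbb{R}^N\setminus\{0\}$. $L^1(\mathbb{R}^N,\frac{dx}{1+|x|^{N+2s}})$ is the set of measurable $u$ with $\int_{\mathbb{R}^N}\frac{|u(x)|}{1+|x|^{N+2s}}dx<\infty$. *)

(* Defs.v *)
From HB Require Import structures.
From mathcomp Require Import all_boot all_order all_algebra.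
From mathcomp Require Import all_classical all_reals all_analysis.

Set Implicit Arguments.
Unset Strict Implicit.
Unset Printing Implicit Defensive.
Import Order.TTheory GRing.Theory Num.Theory.
Import numFieldNormedType.Exports.
Local Open Scope classical_set_scope.
Local Open Scope ring_scope.

(* R^n is 'rV[R]_n. MathComp-Analysis gives it its topology and its           *)
(* directional derivatives, but no sigma-algebra and no Lebesgue measure.     *)

Section row_measurable.
Context {R : realType} {n : nat}.

Definition row_coord (i : 'I_n) (x : 'rV[R]_n) : measurableTypeR R := x ord0 i.

(* the sigma-algebra generated by the coordinates, as the library does for    *)
(* n.-tuple; it is the Borel sigma-algebra of R^n                             *)
HB.instance Definition _ := @isMeasurable.Build default_measure_display
  'rV[R]_n (g_sigma_preimage row_coord)
  (@sigma_algebra0 _ _ _) (@sigma_algebraC _ _) (@sigma_algebra_bigcup _ _ _).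

Lemma measurable_row_coord (i : 'I_n) : measurable_fun setT (row_coord i).
Proof.
move=> _ Y mY; rewrite setTI; apply: sub_sigma_algebra => /=.
rewrite -bigcup_seq/=; exists i => /=; first by rewrite mem_index_enum.
by exists Y => //; rewrite setTI.
Qed.

Lemma measurable_fun_rowP d (T : measurableType d) (f : T -> 'rV[R]_n) :
  measurable_fun setT f <->
  forall i, measurable_fun setT (fun x => f x ord0 i).
Proof.
split=> [mf i|mf].
  exact: (measurableT_comp (measurable_row_coord i) mf).
move=> _ A mA; rewrite setTI.
suff : g_sigma_preimage row_coord `<=` [set B | measurable (f @^-1` B)].
  exact.
apply: smallest_sub => [|B /=].
  split=> [|B mB|F mF] /=.
  - by rewrite preimage_set0.
  - by rewrite setTD -preimage_setC; exact: measurableC.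
  - by rewrite preimage_bigcup; exact: bigcupT_measurable.
rewrite -bigcup_seq/= => -[i _ [C mC <-]].
rewrite setTI -comp_preimage -[X in measurable X]setTI; exact: mf.
Qed.

End row_measurable.

Section row_cons.
Context {R : realType} {n : nat}.

Definition row_cons (p : measurableTypeR R * 'rV[R]_n) : 'rV[R]_n.+1 := row_mx p.1%:M p.2.

Definition row_uncons (x : 'rV[R]_n.+1) : measurableTypeR R * 'rV[R]_n :=
  (x ord0 ord0, \row_j x ord0 (lift ord0 j)).

Lemma row_cons0 p : row_cons p ord0 ord0 = p.1.
Proof.
by rewrite /row_cons mxE; case: splitP => // j; rewrite ord1 mxE eqxx mulr1n.
Qed.

Lemma row_consS p j : row_cons p ord0 (lift ord0 j) = p.2 ord0 j.
Proof.
rewrite /row_cons mxE; case: splitP => [k|k /=].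
  by rewrite ord1.
by rewrite /bump/= => /addnI jk; have -> : j = k by exact/val_inj.
Qed.

Lemma row_consK : cancel row_cons row_uncons.
Proof.
move=> [a x]; rewrite /row_uncons row_cons0; congr (_, _).
by apply/rowP => j; rewrite mxE row_consS.
Qed.

Lemma row_unconsK : cancel row_uncons row_cons.
Proof.
move=> x; apply/rowP => j; have [i|] := unliftP ord0 j => ->; last first.
  by rewrite row_cons0.
by rewrite row_consS mxE.
Qed.

Lemma measurable_row_cons : measurable_fun setT row_cons.
Proof.
apply/measurable_fun_rowP => j; have [i|] := unliftP ord0 j => ->; last first.
  under eq_fun do rewrite row_cons0.
  exact: measurable_fst.
under eq_fun do rewrite row_consS.
exact: (measurableT_comp (measurable_row_coord i) measurable_snd).
Qed.

Lemma measurable_row_uncons : measurable_fun setT row_uncons.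
Proof.
apply/measurable_fun_pairP; split; first exact: (measurable_row_coord ord0).
apply/measurable_fun_rowP => i /=.
under eq_fun do rewrite mxE.
exact: measurable_row_coord.
Qed.

Local Open Scope ereal_scope.

Definition lebesgue_row_cons (mu : set 'rV[R]_n -> \bar R) :
  set 'rV[R]_n.+1 -> \bar R := pushforward (lebesgue_measure \x mu) row_cons.

Variable mu : {sigma_finite_measure set 'rV[R]_n -> \bar R}.

HB.instance Definition _ := Measure.copy (lebesgue_row_cons mu)
  (measure_function_pushforward__canonical__measure_function_Measure
     (lebesgue_measure \x mu) measurable_row_cons).

Let lebesgue_row_cons_sigma_finite : sigma_finite setT (lebesgue_row_cons mu).
Proof.
have /sigma_finiteP[F [TF ndF Foo]] := sigma_finiteT (@lebesgue_measure R).
have /sigma_finiteP[G [TG ndG Goo]] := sigma_finiteT mu.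
exists (fun k => row_uncons @^-1` (F k `*` G k)) => [|k].
  rewrite -preimage_bigcup -(preimage_setT row_uncons); congr (_ @^-1` _).
  rewrite -setXTT TF TG predeqE => -[x y]; split.
    move=> [/= [k _ Fkx] [l _ Gly]]; exists (maxn k l) => //; split.
    - by move: x Fkx; exact/subsetPset/ndF/leq_maxl.
    - by move: y Gly; exact/subsetPset/ndG/leq_maxr.
  by move=> [k _ []/= ? ?]; split; exists k.
have [mF Fk] := Foo k; have [mG Gk] := Goo k.
have mFG : measurable (F k `*` G k) by exact: measurableX.
split; first by rewrite -[X in measurable X]setTI; exact: measurable_row_uncons.
rewrite /lebesgue_row_cons /pushforward -comp_preimage.
rewrite (_ : row_uncons \o row_cons = id); last first.
  by apply/funext => p /=; rewrite row_consK.
by rewrite preimage_id product_measure1E// lte_mul_pinfty// ge0_fin_numE.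
Qed.

HB.instance Definition _ := Measure_isSigmaFinite.Build _ _ _
  (lebesgue_row_cons mu) lebesgue_row_cons_sigma_finite.

End row_cons.

(* Lebesgue measure on R^n: the n-fold product of the one on R *)
Fixpoint lebesgue_row (R : realType) (n : nat) :
    {sigma_finite_measure set 'rV[R]_n -> \bar R} :=
  match n with
  | 0 => \d_(0 : 'rV[R]_0)
  | n'.+1 => lebesgue_row_cons (lebesgue_row R n')
  end.
Arguments lebesgue_row {R n}.

Lemma measurable_row_box (R : realType) (n : nat) (A : 'I_n -> set R) :
  (forall i, measurable (A i)) ->
  measurable [set x : 'rV[R]_n | forall i, A i (x ord0 i)].
Proof.
move=> mA; rewrite [X in measurable X](_ : _ =
    \big[setI/setT]_(i < n) (row_coord i @^-1` A i)); last first.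
  rewrite -bigcap_seq; apply/seteqP; split=> x /= xA i => [_|].
    exact: xA.
  by apply: xA => /=; rewrite mem_index_enum.
apply: bigsetI_measurable => i _.
by rewrite -[X in measurable X]setTI; apply: measurable_row_coord => //; exact: mA.
Qed.

Lemma lebesgue_row_box (R : realType) (n : nat) (A : 'I_n -> set R) :
  (forall i, measurable (A i)) ->
  lebesgue_row [set x : 'rV[R]_n | forall i, A i (x ord0 i)] =
  (\prod_i lebesgue_measure (A i))%E.
Proof.
elim: n A => [|n IHn] A mA /=.
  by rewrite big_ord0 diracE mem_set// => i; have := ltn_ord i.
rewrite /lebesgue_row_cons /pushforward [X in product_measure1 _ _ X](_ : _ =
    A ord0 `*` [set x : 'rV[R]_n | forall i, A (lift ord0 i) (x ord0 i)]).
  rewrite product_measure1E; [|exact: mA|].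
    by rewrite big_ord_recl (IHn (fun i => A (lift ord0 i))).
  exact: (@measurable_row_box R n (fun i => A (lift ord0 i))).
apply/seteqP; split=> [p /= pA|p /= [pA0 pA] i].
  by split=> [|i]; [rewrite -row_cons0|rewrite -row_consS]; exact: pA.
have [j|] := unliftP ord0 i => ->; last by rewrite row_cons0.
by rewrite row_consS; exact: pA.
Qed.

Section fractional_laplacian.
Context {R : realType}.

(* Euler's integral: the Gamma function for a > 0 only                        *)
Definition Gamma_fun (a : R) : R :=
  \int[lebesgue_measure]_(t in `]0, +oo[) (t `^ (a - 1) * expR (- t)).

Context {n : nat}.
Implicit Types (s mu tau : R) (u : 'rV[R]_n -> R) (x z : 'rV[R]_n).

(* the norm `|x| that the library puts on matrices is the sup norm            *)
Definition enorm x : R := Num.sqrt (\sum_i x ord0 i ^+ 2).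

Definition eball x (r : R) : set 'rV[R]_n := [set z | enorm (x - z) < r].

Definition weighted_L1 s u : Prop :=
  measurable_fun setT u /\
  (\int[lebesgue_row]_x (`|u x| / (1 + enorm x `^ (n%:R + 2 * s)))%:E < +oo)%E.

Fixpoint Ck (k : nat) (D : set 'rV[R]_n) u : Prop :=
  (forall x, D x -> {for x, continuous u}) /\
  match k with
  | 0 => True
  | k'.+1 => forall i : 'I_n,
      (forall x, D x -> derivable u x (delta_mx ord0 i)) /\
      Ck k' D ('D_(delta_mx ord0 i) u)
  end.

Definition Cinfty (D : set 'rV[R]_n) u : Prop := forall k, Ck k D u.

Definition fraclap_const s : R :=
  2 `^ (2 * s) * pi `^ (- (n%:R / 2)) * s * Gamma_fun ((n%:R + 2 * s) / 2)
  / Gamma_fun (1 - s).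

Definition fraclap_integrand s u x z : R :=
  (u x - u z) / enorm (x - z) `^ (n%:R + 2 * s).

(* (-Delta)^s u (x) is defined and equal to l. Integrability is required      *)
(* because the library's integral is a total function.                        *)
Definition is_fraclap s u x (l : R) : Prop :=
  (forall eps : R, 0 < eps -> lebesgue_row.-integrable (~` eball x eps)
                                (EFin \o fraclap_integrand s u x)) /\
  (fraclap_const s *
    \int[lebesgue_row]_(z in ~` eball x eps) fraclap_integrand s u x z)
    @[eps --> 0^'+] --> l.

(* classical solution of (-Delta)^s u + mu |x|^(-2s) u = 0 off the origin     *)
Definition classical_solution s mu u : Prop :=
  forall x, x != 0 -> exists2 l : R,
    is_fraclap s u x l & l + mu / enorm x `^ (2 * s) * u x = 0.

End fractional_laplacian.

Section hardy.
Context {R : realType}.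

Definition hardy_mu0 (N : nat) (s : R) : R :=
  - (2 `^ (2 * s) * (Gamma_fun ((N%:R + 2 * s) / 4) ^+ 2
                     / Gamma_fun ((N%:R - 2 * s) / 4) ^+ 2)).

(* tau stands for tau_-(s, mu) in Phi_sol and for tau_+(s, mu) in Gamma_sol.  *)
(* The value at the origin is immaterial.                                     *)
Definition Phi_sol (N : nat) (s mu tau : R) (x : 'rV[R]_N) : R :=
  if hardy_mu0 N s < mu then enorm x `^ tau
  else - (enorm x `^ tau * ln (enorm x)).

Definition Gamma_sol (N : nat) (tau : R) (x : 'rV[R]_N) : R :=
  enorm x `^ tau.

End hardy.
Arguments Phi_sol {R N} s mu tau x.
Arguments Gamma_sol {R N} tau x.

(* Main.v *)
(* Gaussian subordination, applied to both [|z|^(-2b)] and the kernel          *)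
(* [|y|^(-N-2s)], turns [(-Delta)^s |x|^(-2b)] into one-dimensional integrals  *)
(* and gives [c(b) |x|^(-2b-2s)] with [c(b) = 2^(2s) G(b) G(N/2-s-b)] and      *)
(* [G(p) = Gamma(s+p)/Gamma(p)], for [-s < b < N/2]. So [|x|^(-2b)] is a       *)
(* solution iff [c(b) = -mu]. The symbol [c] is symmetric about [(N/2-s)/2],   *)
(* where it equals [-mu_0], and is strictly decreasing to its right since [G]  *)
(* is positive, increasing and concave; it is unbounded below at [N/2].        *)
(* For [-|x|^(-2b) ln|x|], convexity of the power in its exponent sandwiches   *)
(* the logarithm between difference quotients of powers, which makes           *)
(* [(-Delta)^s] of it a supergradient of [c]; by symmetry it vanishes at the   *)
(* center, which is the critical case.                                         *)
From HB Require Import structures.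
Require Import Defs.
From mathcomp Require Import all_boot all_order all_algebra.
From mathcomp Require Import all_classical all_reals all_analysis.
From mathcomp Require Import measurable_realfun ring lra.
Set Implicit Arguments.
Unset Strict Implicit.
Unset Printing Implicit Defensive.
Import Order.TTheory GRing.Theory Num.Theory.
Import numFieldNormedType.Exports.
Local Open Scope classical_set_scope.
Local Open Scope ring_scope.

(** * Measurability and integration on row vectors *)

(** Put [m = N/2], [M = m - s], [c = M/2] and write exponents as [tau = -2b]. Then [-N < tau < 2s]
    reads [-s < b < m], and [(2s-N)/2] is the point [b = c].

    Action on powers ([sym_powR]). The difference [2u(x) - u(x+y) - u(x-y)] of [u = |.|^(-2b)] is
    split at the comparison value [(|x|^2 + |y|^2)^(-b)]. This leaves [2/Gamma(b)] times a
    monotonicity gap minus a midpoint gap, the midpoint of [|x+y|^2] and [|x-y|^2] being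
    [|x|^2 + |y|^2]. Each gap is a nonnegative superposition of exponentials, also for [-s < b < 0],
    so Tonelli applies at once. Gaussian integration in [y] turns the two gaps into values of
    [G(p) = Gamma(s+p)/Gamma(p)] ([integral_riesz_monotone], [integral_riesz_convex]), and their
    difference gives the symbol [2^(2s) G(b) G(M-b)].

    Shape of the symbol. By [integral_gintE], [G(p)] is a positive constant times the integral of
    [v^(s-1) (1 - w^p)] with [w = v/(1+v)] in [(0,1)], so inequalities between the powers [w^p] pass
    to [G] ([Gfun_comb_le0]): it is increasing and concave, with second differences of quadratic
    order. Hence the symbol, symmetric under [b -> M - b], decreases strictly on [[c, m)] from
    [-mu_0] to [-oo], and [-mu] has exactly one preimage there, [fraclap_symbol_inv mu]. Then
    [tau_-] is [-2] times this root and [tau_+] is [-2] times its mirror image, whence their sum,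
    monotonicity, continuity and limits.

    Logarithm ([sym_powR_log]). Differences of powers that touch the normalized logarithmic function
    at [x] bound it from both sides, and comparison at the touching point makes its fractional
    Laplacian a supergradient of the symbol. At [c] symmetry and the quadratic bound force this
    supergradient to vanish ([fraclap_symbol_center_slope]), so the logarithmic function is a
    solution there. At any other exponent the equation, tested on spheres of all radii, contradicts
    the supergradient inequality ([classical_solution_log]). *)

Section measurability.
Context d (T : measurableType d) (R : realType).
Implicit Types f g : T -> R.

Lemma measurable_fun_expR f :
  measurable_fun setT f -> measurable_fun setT (fun x => expR (f x)).
Proof. by move=> mf; exact: measurableT_comp. Qed.

Lemma measurable_fun_ln f :
  measurable_fun setT f -> measurable_fun setT (fun x => ln (f x)).
Proof. by move=> mf; apply: measurableT_comp => //; exact: measurable_ln. Qed.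

Lemma measurable_fun_powR f p :
  measurable_fun setT f -> measurable_fun setT (fun x => f x `^ p).
Proof. by move=> mf; apply: (measurableT_comp (measurable_powR p)). Qed.

Lemma measurable_fun_sqrt f :
  measurable_fun setT f -> measurable_fun setT (fun x => Num.sqrt (f x)).
Proof.
move=> mf; apply: measurableT_comp => //.
by apply: continuous_measurable_fun; exact: sqrt_continuous.
Qed.

Lemma measurable_fun_opp f :
  measurable_fun setT f -> measurable_fun setT (fun x => - f x).
Proof. exact: measurable_funN. Qed.

Lemma measurable_fun_norm f :
  measurable_fun setT f -> measurable_fun setT (fun x => `|f x|).
Proof. by move=> mf; exact: measurableT_comp. Qed.

Lemma measurable_fun_fst d1 d2 (T1 : measurableType d1) (T2 : measurableType d2)
    (h : T -> T1 * T2) :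
  measurable_fun setT h -> measurable_fun setT (fun x => (h x).1).
Proof. by move=> mh; exact: (measurableT_comp measurable_fst mh). Qed.

Lemma measurable_fun_snd d1 d2 (T1 : measurableType d1) (T2 : measurableType d2)
    (h : T -> T1 * T2) :
  measurable_fun setT h -> measurable_fun setT (fun x => (h x).2).
Proof. by move=> mh; exact: (measurableT_comp measurable_snd mh). Qed.

Lemma measurable_fun_coord n (i : 'I_n) (h : T -> 'rV[R]_n) :
  measurable_fun setT h -> measurable_fun setT (fun x => h x ord0 i).
Proof. by move=> mh; exact: (measurableT_comp (measurable_row_coord i) mh). Qed.

End measurability.

Section row_measurability.
Context (R : realType) (n : nat).

Lemma measurable_enorm : measurable_fun setT (@enorm R n).
Proof.
apply: measurable_fun_sqrt; apply: measurable_sum => i.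
by apply: measurable_funX; exact: (measurable_row_coord i).
Qed.

Lemma measurable_fun_enorm d (T : measurableType d) (h : T -> 'rV[R]_n) :
  measurable_fun setT h -> measurable_fun setT (fun x => enorm (h x)).
Proof. by move=> mh; exact: (measurableT_comp measurable_enorm mh). Qed.

Lemma measurable_fun_addrow d (T : measurableType d) (g h : T -> 'rV[R]_n) :
  measurable_fun setT g -> measurable_fun setT h ->
  measurable_fun setT (fun x => g x + h x).
Proof.
move=> mg mh; apply/measurable_fun_rowP => i.
apply: (eq_measurable_fun (fun x => g x ord0 i + h x ord0 i)).
  by move=> x _; rewrite mxE.
by apply: measurable_funD; exact: measurable_fun_coord.
Qed.

Lemma measurable_fun_opprow d (T : measurableType d) (h : T -> 'rV[R]_n) :
  measurable_fun setT h -> measurable_fun setT (fun x => - h x).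
Proof.
move=> mh; apply/measurable_fun_rowP => i.
apply: (eq_measurable_fun (fun x => - h x ord0 i)).
  by move=> x _; rewrite mxE.
by apply: measurable_fun_opp; exact: measurable_fun_coord.
Qed.

End row_measurability.

Lemma measurable_addl (R : realType) (c : R) : measurable_fun setT (+%R c).
Proof.
apply: (eq_measurable_fun (fun x : R => c + x)) => //.
by apply: measurable_funD.
Qed.

Lemma measurable_addl_row (R : realType) n (x : 'rV[R]_n) : measurable_fun setT (+%R x).
Proof.
apply: (eq_measurable_fun (fun y : 'rV[R]_n => x + y)) => //.
by apply: measurable_fun_addrow.
Qed.

Lemma measurable_opp_row (R : realType) n : measurable_fun setT (-%R : 'rV[R]_n -> _).
Proof. exact: measurable_fun_opprow. Qed.

Ltac measfun :=
  lazymatch goal with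
  | |- measurable_fun _ (fun x => EFin _) => apply/measurable_EFinP; measfun
  | |- measurable_fun _ (EFin \o _) => apply/measurable_EFinP; measfun
  | |- measurable_fun setT (fun x => (_ + _)%R) =>
     first [apply: measurable_funD | apply: measurable_fun_addrow]; measfun
  | |- measurable_fun setT (fun x => (- _)%R) =>
     first [apply: measurable_fun_opp | apply: measurable_fun_opprow]; measfun
  | |- measurable_fun setT (fun x => (_ * _)%R) => apply: measurable_funM; measfun
  | |- measurable_fun setT (fun x => (_ ^+ _)%R) => apply: measurable_funX; measfun
  | |- measurable_fun setT (fun x => expR _) => apply: measurable_fun_expR; measfun
  | |- measurable_fun setT (fun x => ln _) => apply: measurable_fun_ln; measfun
  | |- measurable_fun setT (fun x => (_ `^ _)%R) => apply: measurable_fun_powR; measfun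
  | |- measurable_fun setT (fun x => enorm _) => apply: measurable_fun_enorm; measfun
  | |- measurable_fun setT (fun x => (_ ord0 _)) => apply: measurable_fun_coord; measfun
  | |- measurable_fun setT (fun x => x) => exact: measurable_id
  | |- measurable_fun setT (fun x => fst _) => apply: measurable_fun_fst; measfun
  | |- measurable_fun setT (fun x => snd _) => apply: measurable_fun_snd; measfun
  | |- measurable_fun setT (GRing.add ?c) => first [exact: measurable_addl | exact: measurable_addl_row | done]
  | |- measurable_fun setT (@enorm _ _) => exact: measurable_enorm
  | |- measurable_fun setT _ => first [exact: measurable_cst | done | exact: measurable_opp_row | apply: measurable_sum => ?; measfun | idtac]
  | |- measurable_fun _ _ => apply: measurable_funTS; measfun
  end.

Ltac pos :=
  match goal with
  | |- is_true (_ <= EFin _)%E => rewrite lee_fin; pos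
  | |- is_true (0 <= _ * _)%R => apply: mulr_ge0; pos
  | |- is_true (0 <= _ + _)%R => apply: addr_ge0; pos
  | |- is_true (0 <= _ `^ _)%R => exact: powR_ge0
  | |- is_true (0 <= expR _)%R => exact: expR_ge0
  | |- is_true (0 <= _)%R => by []
  | H : is_true (0 < ?x)%R |- is_true (0 <= ?x)%R => exact: ltW
  end.

Ltac side := solve [by measfun | pos | by move=> *; pos].

Section integral_scaling.
Context d (T : measurableType d) (R : realType) (mu : {measure set T -> \bar R}).
Local Open Scope ereal_scope.

Lemma ge0_integral_scalel (D : set T) (f : T -> R) (k : R) :
  measurable D -> measurable_fun setT f -> (forall x, D x -> (0 <= f x)%R) ->
  (0 <= k)%R ->
  \int[mu]_(x in D) (k * f x)%:E = k%:E * \int[mu]_(x in D) (f x)%:E.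
Proof.
move=> mD mf f0 k0; rewrite -ge0_integralZl_EFin//.
by measfun; exact: measurable_funTS.
Qed.

End integral_scaling.

Section tonelli.
Local Open Scope ereal_scope.
Context d1 d2 d3 (T1 : measurableType d1) (T2 : measurableType d2)
  (T3 : measurableType d3) (R : realType).
Variables (m1 : {sigma_finite_measure set T1 -> \bar R})
  (m2 : {sigma_finite_measure set T2 -> \bar R})
  (m3 : {sigma_finite_measure set T3 -> \bar R}).

Let measurable_patch2 d (T : measurableType d) (D : set T) (f : T -> \bar R) :
  measurable D -> measurable_fun setT f -> measurable_fun setT (f \_ D).
Proof.
move=> mD mf; apply/(measurable_restrictT _ mD).1.
exact: measurable_funS mf.
Qed.

Lemma measurable_integral_param (D2 : set T2) (f : T1 * T2 -> \bar R) :
  measurable D2 -> measurable_fun setT f -> (forall x y, D2 y -> 0 <= f (x, y)) ->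
  measurable_fun setT (fun x => \int[m2]_(y in D2) f (x, y)).
Proof.
move=> mD mf f0.
have mXD : measurable (setT `*` D2 : set (T1 * T2)) by exact: measurableX.
have := @measurable_fun_fubini_tonelli_F _ _ T1 T2 R m2 (f \_ (setT `*` D2)).
have -> : fubini_F m2 (f \_ (setT `*` D2)) = fun x => \int[m2]_(y in D2) f (x, y).
  apply/funext => x; rewrite /fubini_F [RHS]integral_mkcond.
  apply: eq_integral => y _; rewrite !patchE.
  by rewrite in_setX in_setT.
apply; first exact: measurable_patch2.
by case=> x y; rewrite patchE; case: ifPn => //; rewrite inE => -[_ /= Dy]; exact: f0.
Qed.

Lemma tonelli_swap (D1 : set T1) (D2 : set T2) (f : T1 -> T2 -> \bar R) :
  measurable D1 -> measurable D2 ->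
  measurable_fun setT (fun z : T1 * T2 => f z.1 z.2) ->
  (forall x y, D1 x -> D2 y -> 0 <= f x y) ->
  \int[m1]_(x in D1) \int[m2]_(y in D2) f x y =
  \int[m2]_(y in D2) \int[m1]_(x in D1) f x y.
Proof.
move=> mD1 mD2 mf f0.
have mXD : measurable (D1 `*` D2 : set (T1 * T2)) by exact: measurableX.
pose g := (fun z : T1 * T2 => f z.1 z.2) \_ (D1 `*` D2).
have := @fubini_tonelli _ _ T1 T2 R m1 m2 g (measurable_patch2 mXD mf).
have g0 z : 0 <= g z.
  by rewrite /g patchE; case: ifPn => //; rewrite inE => -[? ?]; exact: f0.
move=> /(_ g0).
have -> : \int[m1]_x \int[m2]_y g (x, y) = \int[m1]_(x in D1) \int[m2]_(y in D2) f x y.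
  rewrite [RHS]integral_mkcond; apply: eq_integral => x _; rewrite patchE.
  case: ifPn => xD.
    rewrite [RHS]integral_mkcond; apply: eq_integral => y _.
    by rewrite /g !patchE in_setX xD.
  rewrite -[RHS](@integral0 _ _ _ m2 setT); apply: eq_integral => y _.
  by rewrite /g patchE in_setX (negbTE xD).
move=> ->.
rewrite [RHS]integral_mkcond; apply: eq_integral => y _; rewrite patchE.
case: ifPn => yD.
  rewrite [RHS]integral_mkcond; apply: eq_integral => x _.
  by rewrite /g !patchE in_setX yD andbT.
rewrite -[RHS](@integral0 _ _ _ m1 setT); apply: eq_integral => x _.
by rewrite /g patchE in_setX (negbTE yD) andbF.
Qed.

End tonelli.

Section tonelli3.
Local Open Scope ereal_scope.
Context d1 d2 d3 (T1 : measurableType d1) (T2 : measurableType d2)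
  (T3 : measurableType d3) (R : realType).
Variables (m1 : {sigma_finite_measure set T1 -> \bar R})
  (m2 : {sigma_finite_measure set T2 -> \bar R})
  (m3 : {sigma_finite_measure set T3 -> \bar R}).

Lemma tonelli_swap3 (D2 : set T2) (D3 : set T3)
    (f : T1 -> T2 -> T3 -> \bar R) :
  measurable D2 -> measurable D3 ->
  measurable_fun setT (fun z : T1 * T2 * T3 => f z.1.1 z.1.2 z.2) ->
  (forall x y z, D2 y -> D3 z -> 0 <= f x y z) ->
  \int[m1]_x \int[m2]_(y in D2) \int[m3]_(z in D3) f x y z =
  \int[m3]_(z in D3) \int[m2]_(y in D2) \int[m1]_x f x y z.
Proof.
move=> mD2 mD3.
(* Truncating [f] below at [0] changes nothing over [D2] and [D3] and makes it nonnegative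
   everywhere. *)
wlog f0 : f / forall x y z, 0 <= f x y z.
  move=> wf mf f0.
  have := wf (fun x y z => maxe (f x y z) 0).
  rewrite (_ : \int[m1]_x _ = \int[m1]_x \int[m2]_(y in D2) \int[m3]_(z in D3) f x y z); last first.
    apply: eq_integral => x _; apply: eq_integral => y /[!inE] Dy.
    by apply: eq_integral => z /[!inE] Dz; apply/max_idPl; exact: f0.
  rewrite (_ : \int[m3]_(z in D3) \int[m2]_(y in D2) _ = \int[m3]_(z in D3) \int[m2]_(y in D2) \int[m1]_x f x y z); last first.
    apply: eq_integral => z /[!inE] Dz; apply: eq_integral => y /[!inE] Dy.
    by apply: eq_integral => x _; apply/max_idPl; exact: f0.
  apply.
  - by move=> x y z; rewrite le_max lexx orbT.
  - exact: measurable_maxe.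
  - by move=> x y z _ _; rewrite le_max lexx orbT.
move=> mf _.
have mf1 x : measurable_fun setT (fun w : T2 * T3 => f x w.1 w.2).
  apply: (measurableT_comp mf (g := fun w : T2 * T3 => ((x, w.1), w.2))) => /=.
  by apply: measurable_fun_pair => //; apply: measurable_fun_pair.
have mf3 z : measurable_fun setT (fun w : T1 * T2 => f w.1 w.2 z).
  apply: (measurableT_comp mf (g := fun w : T1 * T2 => (w, z))) => /=.
  by apply: measurable_fun_pair.
under eq_integral do rewrite tonelli_swap//.
rewrite (tonelli_swap m1 m3)//; last first.
- by move=> x z _ Dz; apply: integral_ge0 => y Dy; exact: f0.
- refine (@measurable_integral_param _ _ _ _ _ m2 D2
    (fun w => f w.1.1 w.2 w.1.2) mD2 _ (fun _ _ _ => f0 _ _ _)).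
  apply: (measurableT_comp mf (g := fun w : T1 * T3 * T2 => ((w.1.1, w.2), w.1.2))) => /=.
  apply: measurable_fun_pair => //=.
    apply: measurable_fun_pair => //=.
    exact: (measurableT_comp measurable_fst measurable_fst).
  exact: (measurableT_comp measurable_snd measurable_fst).
apply: eq_integral => z /[!inE] Dz.
by rewrite (tonelli_swap m1 m2).
Qed.
End tonelli3.

(** * Affine changes of variables and Gaussian integrals *)

Section affine.
Context {R : realType}.
Local Notation mu := (@lebesgue_measure R).
Local Open Scope ereal_scope.

Lemma measurable_affine (c d : R) :
  measurable_fun setT (fun x : measurableTypeR R => (c * x + d)%R : measurableTypeR R).
Proof. by apply: measurable_funD => //; exact: measurable_funM. Qed.

(** By uniqueness of Lebesgue measure: [|c|] times its image under [x -> c x + d] agrees with it on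
    half-open intervals. *)
Lemma ge0_integral_affine (c d : R) (f : R -> \bar R) : c != 0%R ->
  measurable_fun setT f -> (forall x, 0 <= f x) ->
  \int[mu]_x f x = `|c|%:E * \int[mu]_x f (c * x + d)%R.
Proof.
move=> c0 mf f0.
pose phi (x : measurableTypeR R) : measurableTypeR R := (c * x + d)%R.
have mphi : measurable_fun setT phi by exact: measurable_affine.
have cp : (0 < `|c|)%R by rewrite normr_gt0.
have := ge0_integral_pushforward mphi mu measurableT mf (fun y _ => f0 y).
rewrite preimage_setT => <-.
pose k : {nonneg R} := NngNum (normr_ge0 c).
pose m' := mscale k (measure_function_pushforward__canonical__measure_function_Measure mu mphi).
have mE A : measurable A -> mu A = m' A.
  apply: lebesgue_measure_unique => _ [[a b] _ <-].
  transitivity (`|c|%:E * mu (phi @^-1` `]a, b]%classic)); last by [].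
  rewrite /=.
  (* For [c < 0] the preimage of an interval open on the left is open on the right; its length does
     not see this. *)
  have [cn|cp'] := ltP c 0%R.
    rewrite (_ : phi @^-1` _ = `[((b - d) / c)%R, ((a - d) / c)%R[%classic); last first.
      apply/seteqP; split => x /=; rewrite !in_itv /= /phi; last first.
        by rewrite ler_ndivrMr// ltr_ndivlMr// => /andP[? ?]; apply/andP; split; lra.
      by rewrite ler_ndivrMr// ltr_ndivlMr// => /andP[? ?]; apply/andP; split; lra.
    rewrite !lebesgue_measure_itv/= !lte_fin ltr_nM2r ?invr_lt0// ltrD2r.
    case: ifPn => ab; last by rewrite mule0.
    by rewrite -EFinM ltr0_norm//; congr EFin; field; rewrite lt_eqF.
  have {}cp' : (0 < c)%R by rewrite lt_neqAle eq_sym c0.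
  rewrite (_ : phi @^-1` _ = `]((a - d) / c)%R, ((b - d) / c)%R]%classic); last first.
    apply/seteqP; split => x /=; rewrite !in_itv /= /phi; last first.
      by rewrite ltr_pdivrMr// ler_pdivlMr// => /andP[? ?]; apply/andP; split; lra.
    by rewrite ltr_pdivrMr// ler_pdivlMr// => /andP[? ?]; apply/andP; split; lra.
  rewrite !lebesgue_measure_itv/= !lte_fin ltr_pM2r ?invr_gt0// ltrD2r.
  case: ifPn => ab; last by rewrite mule0.
  by rewrite -EFinM gtr0_norm//; congr EFin; field; rewrite gt_eqF.
rewrite (eq_measure_integral m'); last by move=> A mA _; exact: mE.
have := (@ge0_integral_mscale _ _ _ (measure_function_pushforward__canonical__measure_function_Measure mu mphi) _ measurableT k _ mf (fun x _ => f0 x)); apply.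
Qed.
End affine.

Section row.
Context {R : realType}.
Local Notation mu := (@lebesgue_measure R).
Local Open Scope ereal_scope.

Lemma ge0_integral_rowS n (f : 'rV[R]_n.+1 -> \bar R) :
  measurable_fun setT f -> (forall x, 0 <= f x) ->
  \int[lebesgue_row]_x f x =
  \int[mu]_a \int[@lebesgue_row R n]_y f (row_cons (a, y)).
Proof.
move=> mf f0.
have := ge0_integral_pushforward (@measurable_row_cons R n) (mu \x @lebesgue_row R n)
  measurableT mf (fun y _ => f0 y).
rewrite preimage_setT => E; rewrite -[LHS]/(\int[pushforward (mu \x @lebesgue_row R n) row_cons]_x f x) E.
rewrite fubini_tonelli1//; last by move=> z; exact: f0.
exact: (measurableT_comp mf (@measurable_row_cons R n)).
Qed.

Lemma measurable_row_affine n (c : R) (x : 'rV[R]_n) :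
  measurable_fun setT (fun y : 'rV[R]_n => c *: y + x : 'rV[R]_n)%R.
Proof.
apply/measurable_fun_rowP => i.
apply: (eq_measurable_fun (fun y : 'rV[R]_n => c * y ord0 i + x ord0 i)%R).
  by move=> y _; rewrite !mxE.
apply: measurable_funD => //; apply: measurable_funM => //.
exact: (measurable_row_coord i).
Qed.

(** Covers translations and the reflection behind the symmetrized principal value; with [|c| = 1]
    each coordinate contributes the factor [1]. *)
Lemma ge0_integral_row_affine n (c : R) (x : 'rV[R]_n) (f : 'rV[R]_n -> \bar R) :
  `|c|%R = 1%R -> measurable_fun setT f -> (forall y, 0 <= f y) ->
  \int[lebesgue_row]_y f y = \int[lebesgue_row]_y f (c *: y + x)%R.
Proof.
move=> c1; elim: n x f => [|n IH] x f mf f0.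
  apply: eq_integral => y _; congr f; apply/rowP => j; have := ltn_ord j.
  by rewrite ltn0.
rewrite !ge0_integral_rowS//; last exact: (measurableT_comp mf (measurable_row_affine c x)).
have mfc : measurable_fun setT (f \o @row_cons R n) by exact: (measurableT_comp mf (@measurable_row_cons R n)).
rewrite (@ge0_integral_affine _ c (x ord0 ord0)); first last.
- by move=> a; apply: integral_ge0.
- by have := measurable_integral_param (@lebesgue_row R n) measurableT mfc (fun x y _ => f0 _); apply.
- by rewrite -normr_eq0 c1 oner_eq0.
rewrite c1 mul1e; apply: eq_integral => a _.
rewrite (IH (\row_j x ord0 (lift ord0 j))%R); first last.
- by [].
- exact: (measurable_fun_pair2 _ mfc).
apply: eq_integral => y _; congr f; apply/rowP => j.
have E (u v : 'rV[R]_n.+1) k : (c *: u + v)%R ord0 k = (c * u ord0 k + v ord0 k)%R by rewrite 2!mxE.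
rewrite E; have [i|] := unliftP ord0 j => ->; last by rewrite !row_cons0.
by rewrite !row_consS !mxE.
Qed.

(** Completing the square, with the substitution [y -> sqrt t * y - c / sqrt t] in the standard
    Gaussian integral. *)
Lemma integral_gauss1 (t c : R) : (0 < t)%R ->
  \int[mu]_y (expR (- t * y ^+ 2 + 2 * c * y))%:E =
  (Num.sqrt (pi / t) * expR (c ^+ 2 / t))%:E.
Proof.
move=> t0.
have st0 : (0 < Num.sqrt t)%R by rewrite sqrtr_gt0.
have sttE : (Num.sqrt t * Num.sqrt t = t)%R by rewrite -expr2 sqr_sqrtr// ltW.
have := @integralT_gauss R.
rewrite (@ge0_integral_affine _ (Num.sqrt t) (- c / Num.sqrt t)%R); first last.
- by move=> x; rewrite lee_fin gauss_fun_ge0.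
- by apply/measurable_EFinP; exact: measurable_gauss_fun.
- by rewrite gt_eqF.
rewrite (_ : \int[mu]_x _ = (expR (- (c ^+ 2 / t)))%:E *
    \int[mu]_y (expR (- t * y ^+ 2 + 2 * c * y))%:E); last first.
  rewrite -ge0_integral_scalel ?expR_ge0//; last by measfun.
  apply: eq_integral => y _; rewrite -expRD /gauss_fun; congr (expR _)%:E.
  by rewrite -{3 4}sttE; field; rewrite gt_eqF.
rewrite gtr0_norm// muleA -EFinM => E.
have k0 : (Num.sqrt t * expR (- (c ^+ 2 / t)) != 0)%R by rewrite mulf_neq0// gt_eqF// expR_gt0.
transitivity (((Num.sqrt t * expR (- (c ^+ 2 / t)))^-1)%:E * (Num.sqrt pi)%:E).
  by rewrite -E muleA -EFinM mulVf// mul1e.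
rewrite -EFinM; congr EFin.
by rewrite sqrtrM ?pi_ge0// sqrtrV ?ltW// expRN; field; rewrite !gt_eqF ?expR_gt0.
Qed.

Lemma integral_gauss_row n (t c : R) (x : 'rV[R]_n) : (0 < t)%R ->
  \int[lebesgue_row]_y
    (expR (\sum_i (- t * y ord0 i ^+ 2 + 2 * (c * x ord0 i) * y ord0 i)))%:E =
  ((pi / t) `^ (n%:R / 2) * expR (c ^+ 2 * (\sum_i x ord0 i ^+ 2) / t))%:E.
Proof.
move=> t0; elim: n x => [|n IH] x.
  rewrite /= integral_dirac//=; last by measfun.
  rewrite diracE in_setT mul1e !big_ord0 mul0r powRr0 mul1r.
  by rewrite mulr0 mul0r.
rewrite ge0_integral_rowS; first last.
- by move=> y; rewrite lee_fin expR_ge0.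
- by measfun.
pose x' : 'rV[R]_n := (\row_j x ord0 (lift ord0 j))%R.
set r : R := ((pi / t) `^ (n%:R / 2) * expR (c ^+ 2 * (\sum_i x' ord0 i ^+ 2) / t))%R.
have r0 : (0 <= r)%R by rewrite mulr_ge0 ?powR_ge0 ?expR_ge0.
transitivity (\int[mu]_a (r%:E * (expR (- t * a ^+ 2 + 2 * (c * x ord0 ord0) * a))%:E)); last first.
  under eq_integral do rewrite -EFinM.
  rewrite ge0_integral_scalel//; last by measfun.
  rewrite integral_gauss1// -EFinM /r; congr EFin.
  rewrite big_ord_recl.
  rewrite (_ : n.+1%:R / 2 = n%:R / 2 + 2^-1 :> R)%R; last by rewrite -natr1; field.
  rewrite powRD; last by apply/implyP => _; rewrite gt_eqF// divr_gt0// pi_gt0.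
  rewrite powR12_sqrt; last by rewrite divr_ge0 ?pi_ge0// ltW.
  under eq_bigr do rewrite mxE.
  rewrite mulrDr mulrDl expRD exprMn; ring.
apply: eq_integral => a _.
transitivity (\int[lebesgue_row]_y ((fun y : 'rV[R]_n => (expR (- t * a ^+ 2 + 2 * (c * x ord0 ord0) * a))%:E *
   (expR (\sum_i (- t * y ord0 i ^+ 2 + 2 * (c * x' ord0 i) * y ord0 i)))%:E) y)); last first.
  under eq_integral do rewrite -EFinM.
  rewrite ge0_integral_scalel ?expR_ge0//; last by measfun.
  by rewrite IH muleC.
apply: eq_integral => y _; rewrite -EFinM -expRD big_ord_recl row_cons0; congr (expR (_ + _))%:E.
by apply: eq_bigr => i _; rewrite row_consS mxE.
Qed.

End row.

(** * One-dimensional integrals and the Gamma function *)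

Section calculus.
Context {R : realType}.
Local Notation mu := (@lebesgue_measure R).

Lemma integral_is_derive (F f : R -> R) (a b : R) : a < b ->
  (forall x, a <= x <= b -> is_derive x 1 F (f x)) ->
  (forall x, a <= x <= b -> {for x, continuous f}) ->
  (\int[mu]_(x in `[a, b]) (f x)%:E = (F b - F a)%:E)%E.
Proof.
move=> ab dF cf; rewrite EFinB.
have cF x : a <= x <= b -> {for x, continuous F}.
  move=> /dF dFx; apply: differentiable_continuous; apply/derivable1_diffP.
  exact: ex_derive.
apply: continuous_FTC2 => //.
- by apply: continuous_in_subspaceT => x; rewrite inE/= in_itv/=; exact: cf.
- split.
  + by move=> x; rewrite in_itv/= => /andP[ax xb]; have [] := dF x; rewrite ?ltW.
  + by apply: cvg_at_right_filter; apply: cF; rewrite lexx ltW.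
  + by apply: cvg_at_left_filter; apply: cF; rewrite lexx ltW.
- move=> x; rewrite in_itv/= => /andP[ax xb]; rewrite derive1E.
  by have [] := dF x; rewrite ?ltW.
Qed.

Lemma continuous_powR_gt0 (p x : R) : 0 < x -> {for x, continuous (@powR R ^~ p)}.
Proof.
move=> x0; apply: differentiable_continuous; apply/derivable1_diffP.
by apply: ex_derive; exact: is_derive1_powR.
Qed.

Lemma integral_powR (p a b : R) : p != 0 -> 0 < a -> a <= b ->
  (\int[mu]_(x in `[a, b]) (x `^ (p - 1))%:E = ((b `^ p - a `^ p) / p)%:E)%E.
Proof.
move=> p0 a0; rewrite le_eqVlt => /predU1P[->|ab].
  by rewrite set_itv1 integral_set1 subrr mul0r.
transitivity ((p^-1 * b `^ p - p^-1 * a `^ p)%:E); last by congr EFin; field.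
apply: (@integral_is_derive (fun x => p^-1 * x `^ p)) => //.
- move=> x /andP[ax _]; have x0 := lt_le_trans a0 ax.
  have := is_derive1_powR p x0 => d.
  apply: is_derive_eq; rewrite /GRing.scale/=.
  by rewrite mulrA mulVf// mul1r.
- by move=> x /andP[ax _]; apply: continuous_powR_gt0; exact: lt_le_trans ax.
Qed.

Lemma integral_powR01 (q : R) : 0 < q ->
  (\int[mu]_(x in `]0%R, 1%R]) (x `^ (q - 1))%:E = (q^-1)%:E)%E.
Proof.
move=> q0.
pose F (n : nat) : set R := `[n.+2%:R^-1, 1]%classic.
have FU : \bigcup_n F n = `]0, 1]%classic.
  apply/seteqP; split => x /=.
    move=> [n _]; rewrite /F /= !in_itv/= => /andP[nx ->]; rewrite andbT.
    by apply: lt_le_trans nx; rewrite invr_gt0.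
  rewrite in_itv/= => /andP[x0 x1].
  exists (Num.truncn x^-1) => //; rewrite /F/= in_itv/= x1 andbT.
  rewrite invf_ple ?posrE//.
  have := truncnS_gt x^-1; move/ltW/le_trans; apply.
  by rewrite ler_nat.
have cv1 : (\int[mu]_(x in F i) (x `^ (q - 1))%:E @[i --> \oo] -->
    \int[mu]_(x in `]0%R, 1%R]) (x `^ (q - 1))%:E)%E.
  rewrite -FU; apply: ge0_nondecreasing_set_cvg_integral.
  - apply/nondecreasing_seqP => n; apply/subsetPset => x; rewrite /F/= !in_itv/=.
    move=> /andP[nx ->]; rewrite andbT (le_trans _ nx)//.
    by rewrite lef_pV2 ?posrE// ler_nat.
  - by move=> i; exact: measurable_itv.
  - by move=> i; measfun.
  - by move=> i x _; rewrite lee_fin powR_ge0.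
apply/esym; apply: (cvg_unique _ _ cv1) => //.
rewrite (_ : (fun i => _) = EFin \o (fun i : nat => (1 - i.+2%:R^-1 `^ q) / q)); last first.
  apply/funext => i /=; rewrite /F integral_powR ?gt_eqF ?invr_gt0//.
    by rewrite powR1.
  by rewrite invf_le1// ler1n.
apply: cvg_EFin; first by near=> x.
rewrite -[X in _ --> X](_ : (1 - 0) * q^-1 = _); last by rewrite subr0 mul1r.
apply: cvgM; last exact: cvg_cst.
apply: cvgB; first exact: cvg_cst.
have /cvg_at_rightP := powR_cvg0 q0; apply; split.
  by move=> n; rewrite invr_gt0.
by have := @cvg_harmonic R; rewrite -cvg_shiftS.
Unshelve. all: by end_near. Qed.


Lemma integral_expR0y (c : R) : 0 < c ->
  (\int[mu]_(x in `]0%R, +oo[) (expR (- c * x))%:E = (c^-1)%:E)%E.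
Proof.
move=> c0.
rewrite integral_itv_obnd_cbnd; last by measfun.
have := integral_exponential_pdf c0.
rewrite (_ : \int[mu]_x _ = c%:E * \int[mu]_(x in `[0%R, +oo[) (expR (- c * x))%:E)%E.
  move=> E; rewrite -[LHS]mul1e -[X in (X * _)%E](_ : (c^-1 * c)%:E = _); last first.
    by rewrite mulVf// gt_eqF.
  by rewrite EFinM -muleA E mule1.
rewrite -ge0_integral_scalel//; last 2 first.
- by measfun.
- by rewrite ltW.
rewrite [RHS]integral_mkcond; apply: eq_integral => x _.
by rewrite /exponential_pdf !patchE; case: ifP.
Qed.

Definition halfline : set R := `]0, +oo[%classic.

Lemma measurable_halfline : measurable halfline.
Proof. exact: measurable_itv. Qed.

Lemma in_halfline x : halfline x <-> 0 < x.
Proof. by rewrite /halfline/= in_itv/= andbT. Qed.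

Lemma ge0_integral_halfline_scale (k : R) (f : R -> R) : 0 < k ->
  measurable_fun setT f -> (forall x, 0 < x -> 0 <= f x) ->
  (\int[mu]_(x in halfline) (f x)%:E = \int[mu]_(x in halfline) (k * f (k * x))%:E)%E.
Proof.
move=> k0 mf f0.
rewrite (@ge0_integral_scalel _ _ _ mu halfline (fun x => f (k * x)) k); last 4 first.
- exact: measurable_halfline.
- apply: (measurableT_comp mf); exact: measurable_funM.
- by move=> x /in_halfline x0; rewrite f0// mulr_gt0.
- exact: ltW.
have mp : measurable_fun setT ((fun x => (f x)%:E) \_ halfline).
  apply: (measurable_restrictT (fun x : R => (f x)%:E) measurable_halfline).1.
  by apply: measurable_funTS; exact/measurable_EFinP.
have p0 x : (0 <= ((fun x => (f x)%:E) \_ halfline) x)%E.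
  rewrite patchE; case: ifPn => //; rewrite inE => /in_halfline x0.
  by rewrite lee_fin f0.
rewrite [LHS]integral_mkcond [LHS](@ge0_integral_affine _ k 0)//; last by rewrite gt_eqF.
rewrite gtr0_norm//; congr (_ * _)%E.
rewrite [RHS]integral_mkcond; apply: eq_integral => x _.
rewrite !patchE addr0 (_ : (k * x \in halfline) = (x \in halfline))//.
by apply/idP/idP; rewrite !inE !in_halfline pmulr_rgt0.
Qed.

End calculus.

#[local] Hint Extern 0 (measurable halfline) => solve [exact: measurable_halfline] : core.

Section gamma.
Context {R : realType}.
Local Notation mu := (@lebesgue_measure R).
Implicit Types (p q r t : R).

Lemma powR_expR t p : 0 < t -> t `^ p = expR (p * ln t).
Proof. by move=> t0; rewrite /powR gt_eqF. Qed.

Lemma powR_addr t p q : 0 < t -> t `^ (p + q) = t `^ p * t `^ q.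
Proof. by move=> t0; rewrite powRD// (gt_eqF t0) implybT. Qed.

Lemma powR_mulB1 t p : 0 < t -> t * t `^ (p - 1) = t `^ p.
Proof.
by move=> t0; rewrite -[X in X * _]powRr1 ?ltW// -powR_addr// addrC subrK.
Qed.

Lemma powR_le_expR q : exists2 C, 0 <= C &
  forall t, 1 <= t -> t `^ q <= C * expR (t / 2).
Proof.
pose m := Num.truncn q.
exists (2 ^+ m.+1 * m.+1`!%:R) => [|t t1]; first by rewrite mulr_ge0// exprn_ge0.
have t0 : 0 <= t by exact: le_trans t1.
apply: (@le_trans _ _ (t ^+ m.+1)).
  rewrite -powR_mulrn//; apply: ler_powR => //.
  by rewrite ltW// truncnS_gt.
have t20 : 0 <= t / 2 by rewrite divr_ge0.
have := expR_ge1Dxn m t20; rewrite exprMn exprVn => /(le_trans _) h.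
have /h : t ^+ m.+1 * 2 ^- m.+1 / m.+1`!%:R <= 1 + t ^+ m.+1 * 2 ^- m.+1 / m.+1`!%:R.
  by rewrite lerDr.
rewrite ler_pdivrMr ?ltr0n ?fact_gt0// ler_pdivrMr ?exprn_gt0//.
by move=> /le_trans; apply; rewrite -mulrA mulrC (mulrC (_ `!%:R)).
Qed.

Lemma gamma_integral_lty q : 0 < q ->
  (\int[mu]_(t in halfline) (t `^ (q - 1) * expR (- t))%:E < +oo)%E.
Proof.
move=> q0.
have hU : halfline = `]0, 1]%classic `|` `]1, +oo[%classic :> set R.
  apply/seteqP; split => x; rewrite /halfline/= !in_itv/= !andbT.
    by case: (leP x 1) => x1 x0; [left; rewrite x0|right].
  by case=> [/andP[]//|]; exact: lt_trans.
have pos t : 0 <= t `^ (q - 1) * expR (- t) by rewrite mulr_ge0 ?powR_ge0 ?expR_ge0.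
rewrite hU ge0_integral_setU//; last 3 first.
- by measfun.
- by move=> x _; rewrite lee_fin.
- rewrite disj_set2E; apply/eqP/seteqP; split => x //=; rewrite !in_itv/= andbT.
  by move=> -[/andP[_ x1]]; rewrite ltNge x1.
apply: lte_add_pinfty.
  apply: (@le_lt_trans _ _ (\int[mu]_(t in `]0%R, 1%R]) (t `^ (q - 1))%:E)%E).
    apply: ge0_le_integral => //.
    - by move=> x _; rewrite lee_fin.
    - by measfun.
    - by measfun.
    - move=> x /=; rewrite in_itv/= => /andP[x0 _]; rewrite lee_fin ler_piMr ?powR_ge0//.
      by rewrite expR_le1 lerNl oppr0 ltW.
  by rewrite integral_powR01// ltry.
have [C C0 CE] := powR_le_expR (q - 1).
apply: (@le_lt_trans _ _ (\int[mu]_(t in `]1%R, +oo[) (C * expR (- 2^-1 * t))%:E)%E).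
  apply: ge0_le_integral => //.
  - by move=> x _; rewrite lee_fin.
  - by measfun.
  - by measfun.
  - move=> x /=; rewrite in_itv/= andbT => x1; rewrite lee_fin.
    apply: (@le_trans _ _ (C * expR (x / 2) * expR (- x))).
      by rewrite ler_wpM2r ?expR_ge0// CE// ltW.
    rewrite -mulrA -expRD ler_wpM2l// ler_expR; lra.
apply: (@le_lt_trans _ _ (\int[mu]_(t in halfline) (C * expR (- 2^-1 * t))%:E)%E).
  apply: ge0_subset_integral => //.
  - by measfun.
  - by move=> x _; rewrite lee_fin mulr_ge0// expR_ge0.
  - by move=> x; rewrite /halfline/= !in_itv/= !andbT; exact: lt_trans.
rewrite ge0_integral_scalel//; try side.
by rewrite integral_expR0y// -EFinM ltry.
Qed.

Lemma gammaE q : 0 < q ->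
  (\int[mu]_(t in halfline) (t `^ (q - 1) * expR (- t))%:E = (Gamma_fun q)%:E)%E.
Proof.
move=> q0; rewrite /Gamma_fun /Rintegral fineK// ge0_fin_numE.
  exact: gamma_integral_lty.
by apply: integral_ge0 => t _; rewrite lee_fin mulr_ge0 ?powR_ge0 ?expR_ge0.
Qed.

Lemma Gamma_fun_ge q : 0 < q -> expR (- 1) / q <= Gamma_fun q.
Proof.
move=> q0; rewrite -lee_fin -gammaE//.
rewrite EFinM -integral_powR01// -ge0_integral_scalel ?expR_ge0//; try side.
apply: (@le_trans _ _ (\int[mu]_(t in `]0%R, 1%R]) (t `^ (q - 1) * expR (- t))%:E)%E).
  apply: ge0_le_integral => //.
  - by move=> x _; rewrite lee_fin mulr_ge0 ?powR_ge0 ?expR_ge0.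
  - by measfun.
  - by measfun.
  - move=> x /=; rewrite in_itv/= => /andP[x0 x1]; rewrite lee_fin mulrC.
    by rewrite ler_wpM2l ?powR_ge0// ler_expR lerN2.
apply: ge0_subset_integral => //.
- by measfun.
- by move=> x _; rewrite lee_fin mulr_ge0 ?powR_ge0 ?expR_ge0.
- by move=> x; rewrite /halfline/= !in_itv/= andbT => /andP[].
Qed.

Lemma Gamma_fun_gt0 q : 0 < q -> 0 < Gamma_fun q.
Proof. by move=> q0; apply: lt_le_trans (Gamma_fun_ge q0); rewrite divr_gt0 ?expR_gt0. Qed.

Lemma gamma_integral_scale q r : 0 < q -> 0 < r ->
  (\int[mu]_(t in halfline) (t `^ (q - 1) * expR (- (r * t)))%:E
   = (Gamma_fun q * r `^ (- q))%:E)%E.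
Proof.
move=> q0 r0.
rewrite mulrC EFinM -gammaE// [in RHS](@ge0_integral_halfline_scale _ r)//; try side.
rewrite -ge0_integral_scalel ?powR_ge0//; try side.
apply: eq_integral => t; rewrite inE => /in_halfline t0; congr EFin.
have E : r `^ (- q) * (r * r `^ (q - 1)) = 1.
  by rewrite powR_mulB1// -powR_addr// addNr powRr0.
transitivity (r `^ (- q) * (r * r `^ (q - 1)) * (t `^ (q - 1) * expR (- (r * t)))).
  by rewrite E mul1r.
by rewrite powRM ?ltW//; ring.
Qed.

(* [p / Gamma_fun (p + 1)] is [1 / Gamma(p)], also for [-1 < p < 0]. *)
Definition rgamma p := p / Gamma_fun (p + 1).

Lemma expRB_integral (a al be : R) : al <= be ->
  (\int[mu]_(u in `[al, be]) (a * expR (- (u * a)))%:E =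
   (expR (- (al * a)) - expR (- (be * a)))%:E)%E.
Proof.
rewrite le_eqVlt => /predU1P[->|ab].
  by rewrite set_itv1 integral_set1 subrr.
transitivity ((- expR (- (be * a)) - - expR (- (al * a)))%:E); last first.
  by congr EFin; ring.
apply: (@integral_is_derive _ (fun u => - expR (- (u * a)))) => //.
- move=> x _; apply: is_derive_eq.
  by rewrite /GRing.scale/=; ring.
- move=> x _; apply: differentiable_continuous; apply/derivable1_diffP.
  exact: ex_derive.
Qed.

(** The integral of [a^p exp(-u a)] over [a > 0] and [al <= u <= be], computed in both orders.
    Taking a difference of exponentials tames the singularity at [a = 0], which is what admits
    [-1 < p < 0]. *)
Lemma integral_expRB p al be : -1 < p -> p != 0 -> 0 < al -> al <= be ->
  ((rgamma p)%:E * \int[mu]_(a in halfline)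
     (a `^ (p - 1) * (expR (- (al * a)) - expR (- (be * a))))%:E =
   (al `^ (- p) - be `^ (- p))%:E)%E.
Proof.
move=> p1 p0 al0 ab.
have p10 : 0 < p + 1 by lra.
have G0 := Gamma_fun_gt0 p10.
have : (\int[mu]_(a in halfline) \int[mu]_(u in `[al, be])
   (a `^ p * expR (- (u * a)))%:E = (Gamma_fun (p + 1) * ((be `^ (- p) - al `^ (- p)) / - p))%:E)%E.
  rewrite tonelli_swap//; try side.
  rewrite EFinM -(integral_powR _ al0 ab) ?oppr_eq0// -ge0_integral_scalel//; try side.
  apply: eq_integral => u; rewrite inE/= in_itv/= => /andP[alu _].
  have u0 : 0 < u by exact: lt_le_trans alu.
  rewrite -opprD -(gamma_integral_scale p10 u0).
  by apply: eq_integral => a _; rewrite addrK.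
rewrite (_ : \int[mu]_(a in halfline) _ = \int[mu]_(a in halfline)
     (a `^ (p - 1) * (expR (- (al * a)) - expR (- (be * a))))%:E)%E.
  move=> ->; rewrite -EFinM /rgamma; congr EFin; field.
  by rewrite p0 gt_eqF.
apply: eq_integral => a; rewrite inE => /in_halfline a0.
rewrite EFinM -expRB_integral// -ge0_integral_scalel//; try side.
by apply: eq_integral => u _; rewrite -(powR_mulB1 p a0); congr EFin; ring.
Qed.

End gamma.

(** * The quotient of Gamma functions *)

#[local] Opaque Gamma_fun powR expR ln.

Section Gamma_functional_equation.
Context {R : realType}.
Local Notation mu := (@lebesgue_measure R).

(** For [al = 1] and [be = 2] the integral in [integral_expRB] is also a difference of two Gamma
    integrals, [Gamma(p) (1 - 2^(-p))]. Comparing the two values gives [p Gamma(p) / Gamma(p+1) = 1]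
    without integrating by parts. *)
Lemma Gamma_funS (p : R) : 0 < p -> Gamma_fun (p + 1) = p * Gamma_fun p.
Proof.
move=> p0.
have p1 : -1 < p by lra.
have l12 : (1 : R) <= 2 by lra.
have := integral_expRB p1 (lt0r_neq0 p0) ltr01 l12.
set I := (\int[mu]_(a in _) _)%E => E.
have I0 : (0 <= I)%E.
  apply: integral_ge0 => a /in_halfline a0; rewrite lee_fin mulr_ge0 ?powR_ge0//.
  by rewrite subr_ge0 ler_expR lerN2 ler_pM2r.
have D : (I + (Gamma_fun p * 2 `^ (- p))%:E = (Gamma_fun p * 1 `^ (- p))%:E)%E.
  rewrite -!gamma_integral_scale// -ge0_integralD//; try side.
    by apply: eq_integral => a _; rewrite -EFinD; congr EFin; ring.
  move=> a /in_halfline a0; rewrite lee_fin mulr_ge0 ?powR_ge0//.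
  by rewrite subr_ge0 ler_expR lerN2 ler_pM2r.
have G1 : 0 < Gamma_fun (p + 1) by apply: Gamma_fun_gt0; lra.
have lt1 : (2 : R) `^ (- p) < 1.
  by rewrite powR_expR ?ltr0n// expR_lt1 mulNr oppr_lt0 mulr_gt0// ln_gt0//; lra.
case: I I0 E D => [r| |]//= _.
rewrite -EFinM -EFinD /rgamma => -[E] [D]; apply/eqP.
rewrite powR1/= in E; rewrite powR1/= in D.
have rE : r = Gamma_fun p * (1 - 2 `^ (- p)) by lra.
rewrite rE in E.
have n0 : 1 - (2 : R) `^ (- p) != 0 by rewrite subr_eq0 gt_eqF.
have {}E : p / Gamma_fun (p + 1) * Gamma_fun p = 1 by apply: (mulIf n0); rewrite mul1r -[RHS]E mulrA.
apply/eqP; have -> : p * Gamma_fun p = Gamma_fun (p + 1) * (p / Gamma_fun (p + 1) * Gamma_fun p).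
  by field; rewrite gt_eqF.
by rewrite E mulr1.
Qed.

Lemma rgammaE (p : R) : 0 < p -> rgamma p = (Gamma_fun p)^-1.
Proof.
move=> p0; rewrite /rgamma Gamma_funS//; field.
by rewrite !gt_eqF// Gamma_fun_gt0.
Qed.

End Gamma_functional_equation.

(* [Gamma(s + p) / Gamma(p)], extended to [-s < p]. *)
HB.lock Definition Gfun (R : realType) (s p : R) : R := rgamma p * Gamma_fun (s + p).

Section Gfun.
Context {R : realType}.
Variable s : R.
Hypotheses (s0 : 0 < s) (s1 : s < 1).
Local Notation mu := (@lebesgue_measure R).
Implicit Types (p q r v : R).

Let mh : measurable (halfline : set (measurableTypeR R)).
Proof. exact: measurable_itv. Qed.

Let J : R := Gamma_fun (1 - s) / s.

Let J0 : 0 < J.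
Proof. by rewrite divr_gt0// Gamma_fun_gt0// subr_gt0. Qed.

(** Write [1 - exp(-a)] as the integral of [a exp(-u a)] over [0 < u <= 1] and swap: the inner
    integral is [Gamma(1-s) u^(s-1)]. *)
Lemma integral_one_sub_expR :
  (\int[mu]_(a in halfline) (a `^ (- s - 1) * (1 - expR (- a)))%:E = J%:E)%E.
Proof.
have s10 : 0 < 1 - s by rewrite subr_gt0.
transitivity (\int[mu]_(a in halfline) \int[mu]_(u in `]0%R, 1%R])
   (a `^ (- s) * expR (- (u * a)))%:E)%E.
  apply: eq_integral => a; rewrite inE => /in_halfline a0.
  have := expRB_integral a ler01; rewrite mul0r oppr0 expR0 mul1r => E.
  rewrite EFinM -E -integral_itv_obnd_cbnd; last by measfun.
  rewrite -ge0_integral_scalel//; try side.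
  by apply: eq_integral => u _; rewrite -(powR_mulB1 (- s) a0); congr EFin; ring.
rewrite tonelli_swap//; try side.
transitivity (\int[mu]_(u in `]0%R, 1%R]) (Gamma_fun (1 - s) * u `^ (s - 1))%:E)%E.
  apply: eq_integral => u; rewrite inE/= in_itv/= => /andP[u0 _].
  rewrite (_ : s - 1 = - (1 - s)); last by ring.
  rewrite -(gamma_integral_scale s10 u0); apply: eq_integral => a _.
  by rewrite addrAC subrr add0r.
rewrite ge0_integral_scalel ?integral_powR01//; try side.
by rewrite ltW// Gamma_fun_gt0.
Qed.

(* [v / (1 + v)], written with [powR] because measurability of [powR] is available. *)
Definition wfun v := v * (1 + v) `^ (- 1).

Lemma powR_wfun p v : 0 < v -> 1 - wfun v `^ p = v `^ p * (v `^ (- p) - (1 + v) `^ (- p)).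
Proof.
move=> v0; have v1 : 0 < 1 + v by lra.
rewrite mulrBr -powR_addr// subrr powRr0; congr (_ - _).
by rewrite /wfun powRM ?powR_ge0 ?ltW// -powRrM mulN1r.
Qed.

Lemma wfun_gt0 v : 0 < v -> 0 < wfun v.
Proof. by move=> v0; rewrite mulr_gt0// powR_gt0//; lra. Qed.

Lemma wfun_lt1 v : 0 < v -> wfun v < 1.
Proof.
move=> v0; have v1 : 0 < 1 + v by lra.
by rewrite /wfun powR_inv1 ?ltW// ltr_pdivrMr// mul1r; lra.
Qed.

Lemma measurable_gint p : measurable_fun setT (fun v => v `^ (s - 1) * (1 - wfun v `^ p)).
Proof. by rewrite /wfun; measfun. Qed.

(** Numerator and denominator both have the sign of [p]; the quotient is therefore the form in which
    nonnegative integration is available for negative [p] too. *)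
Lemma rgamma_sgn p v : - 1 < p -> 0 < v -> p != 0 -> 0 <= (1 - wfun v `^ p) / rgamma p.
Proof.
move=> p1 v0 p0; have G0 : 0 < Gamma_fun (p + 1) by apply: Gamma_fun_gt0; lra.
have wv := ltW (wfun_lt1 v0); have w0 := wfun_gt0 v0.
case: (ltgtP p 0) p0 => // pp _.
  apply: mulr_le0; last by rewrite invr_le0 /rgamma pmulr_lle0 ?invr_gt0// ltW.
  rewrite subr_le0 -[leLHS](powRr0 (wfun v)); apply: ger_powR; first by rewrite w0 wv.
  exact: ltW.
apply: mulr_ge0; last by rewrite invr_ge0 /rgamma divr_ge0 ?ltW.
rewrite subr_ge0 -[leRHS](powRr0 (wfun v)); apply: ger_powR; first by rewrite w0 wv.
exact: ltW.
Qed.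

(** By subordination the quotient is [v^p] times the integral of [a^(p-1) exp(-v a) (1 - exp(-a))].
    Integrating in [v] first yields [Gamma(s+p) a^(-(s+p))], and what remains in [a] no longer
    depends on [p]. *)
Lemma integral_gint p : - s < p -> p != 0 ->
  (\int[mu]_(v in halfline) (v `^ (s - 1) * ((1 - wfun v `^ p) / rgamma p))%:E =
   (Gamma_fun (s + p) * J)%:E)%E.
Proof.
move=> sp p0.
have p1 : -1 < p by apply: lt_trans sp; rewrite ltrN2.
have sp0 : 0 < s + p by rewrite -ltrBlDl sub0r.
have Gsp0 := ltW (Gamma_fun_gt0 sp0).
have G0 : 0 < Gamma_fun (p + 1) by apply: Gamma_fun_gt0; lra.
have rg0 : rgamma p != 0 by rewrite /rgamma mulf_neq0// invr_neq0// gt_eqF.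
transitivity (\int[mu]_(v in halfline) \int[mu]_(a in halfline)
  (v `^ (s + p - 1) * (a `^ (p - 1) * (expR (- (v * a)) * (1 - expR (- a)))))%:E)%E.
  apply: eq_integral => v; rewrite inE => /in_halfline v0.
  have vv : v <= 1 + v by lra.
  have := integral_expRB p1 p0 v0 vv.
  set I := (\int[mu]_(a in _) _)%E => E.
  have {}E : (I = ((v `^ (- p) - (1 + v) `^ (- p)) / rgamma p)%:E)%E.
    by rewrite mulrC EFinM -E muleA -EFinM mulVf// mul1e.
  rewrite powR_wfun// mulrA mulrA -powR_addr// -mulrA EFinM -E /I.
  rewrite -ge0_integral_scalel//; try side.
    apply: eq_integral => a _; rewrite addrAC; congr (_ * (_ * _))%:E.
    by rewrite mulrBr mulr1 -expRD; congr (_ - expR _); ring.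
  move=> a /in_halfline a0; rewrite mulr_ge0 ?powR_ge0//.
  by rewrite subr_ge0 ler_expR lerN2 ler_pM2r.
have e1 a : 0 < a -> 0 <= 1 - expR (- a) by move=> a0; rewrite subr_ge0 expR_le1 oppr_le0 ltW.
rewrite tonelli_swap//; last 2 first.
- by measfun.
- move=> x y _ /in_halfline y0; rewrite lee_fin !mulr_ge0 ?powR_ge0 ?expR_ge0//.
  exact: e1.
transitivity (\int[mu]_(a in halfline) (Gamma_fun (s + p) * (a `^ (- s - 1) * (1 - expR (- a))))%:E)%E.
  apply: eq_integral => a; rewrite inE => /in_halfline a0.
  transitivity (\int[mu]_(v in halfline) ((a `^ (p - 1) * (1 - expR (- a))) *
     (v `^ (s + p - 1) * expR (- (a * v))))%:E)%E.
    by apply: eq_integral => v _; rewrite (mulrC v a); congr EFin; ring.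
  rewrite ge0_integral_scalel//; try side; last by rewrite mulr_ge0 ?powR_ge0 ?e1.
  rewrite gamma_integral_scale// -EFinM; congr EFin.
  rewrite (_ : - s - 1 = p - 1 + - (s + p)); last by ring.
  by rewrite (powR_addr (p - 1) (- (s + p)) a0); ring.
rewrite ge0_integral_scalel//; try side.
- by rewrite integral_one_sub_expR EFinM.
by move=> a /in_halfline a0; rewrite mulr_ge0 ?powR_ge0 ?e1.
Qed.

Lemma Gfun0 : Gfun s 0 = 0.
Proof. by rewrite Gfun.unlock /rgamma !mul0r. Qed.

Lemma integrable_gint p : - s < p ->
  mu.-integrable halfline (fun v => (v `^ (s - 1) * (1 - wfun v `^ p))%:E).
Proof.
move=> sp.
have [->|p0] := eqVneq p 0.
  apply: (eq_integrable _ (cst 0%E)) => //; last exact: integrable0.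
  by move=> v _; rewrite powRr0 subrr mulr0.
have p1 : -1 < p by apply: lt_trans sp; rewrite ltrN2.
have G0 : 0 < Gamma_fun (p + 1) by apply: Gamma_fun_gt0; lra.
have rg0 : rgamma p != 0 by rewrite /rgamma mulf_neq0// invr_neq0// gt_eqF.
have I : mu.-integrable halfline
    (fun v => (v `^ (s - 1) * ((1 - wfun v `^ p) / rgamma p))%:E).
  apply/integrableP; split; first by rewrite /wfun; measfun.
  rewrite (_ : \int[mu]_(v in halfline) _ = (Gamma_fun (s + p) * J)%:E)%E ?ltry//.
  rewrite -integral_gint//; apply: eq_integral => v; rewrite inE => /in_halfline v0.
  by rewrite gee0_abs// lee_fin mulr_ge0 ?powR_ge0// rgamma_sgn.
have := integrableZl mh (rgamma p) I.
apply: eq_integrable => // v _; rewrite -EFinM; congr EFin; field.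
exact: rg0.
Qed.

Lemma Rintegral_gint p : - s < p ->
  (\int[mu]_(v in halfline) (v `^ (s - 1) * (1 - wfun v `^ p)) = Gfun s p * J)%R.
Proof.
move=> sp.
have [->|p0] := eqVneq p 0.
  rewrite Gfun0 mul0r; under eq_Rintegral do rewrite powRr0 subrr mulr0.
  by rewrite Rintegral_cst// mul0r.
have p1 : -1 < p by apply: lt_trans sp; rewrite ltrN2.
have G0 : 0 < Gamma_fun (p + 1) by apply: Gamma_fun_gt0; lra.
have rg0 : rgamma p != 0 by rewrite /rgamma mulf_neq0// invr_neq0// gt_eqF.
rewrite /Rintegral (_ : (\int[mu]_(v in halfline) _ = (Gfun s p * J)%:E)%E)//.
rewrite Gfun.unlock -mulrA EFinM -integral_gint// -integralZl//; last first.
  have := integrableZl mh (rgamma p)^-1 (integrable_gint sp).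
  by apply: eq_integrable => // v _; rewrite -EFinM; congr EFin; ring.
by apply: eq_integral => v _; rewrite -EFinM; congr EFin; field.
Qed.

Lemma integral_gintE p : - s < p ->
  (\int[mu]_(v in halfline) (v `^ (s - 1) * (1 - wfun v `^ p))%:E = (Gfun s p * J)%:E)%E.
Proof.
move=> sp; rewrite -Rintegral_gint// /Rintegral fineK//.
exact: integrable_fin_num (integrable_gint sp).
Qed.

(* A pointwise inequality between powers of [w] in (0, 1) integrates to one between values of [Gfun]. *)
Lemma Gfun_comb_le0 (l : seq (R * R)) :
  (forall cp, cp \in l -> - s < cp.2) ->
  (forall w, 0 < w < 1 -> \sum_(cp <- l) cp.1 * (1 - w `^ cp.2) <= 0) ->
  \sum_(cp <- l) cp.1 * Gfun s cp.2 <= 0.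
Proof.
move=> ls le0.
have [I E] : mu.-integrable halfline (fun v => (\sum_(cp <- l) cp.1 * (v `^ (s - 1) * (1 - wfun v `^ cp.2)))%:E)
  /\ (\int[mu]_(v in halfline) (\sum_(cp <- l) cp.1 * (v `^ (s - 1) * (1 - wfun v `^ cp.2))) =
      (\sum_(cp <- l) cp.1 * Gfun s cp.2) * J)%R.
  elim: l ls {le0} => [|[c p] l IH] ls.
    split.
      by have := integrable0 mu halfline; apply: eq_integrable => // v _; rewrite big_nil.
    under eq_Rintegral do rewrite big_nil.
    by rewrite Rintegral_cst// mul0r big_nil mul0r.
  have [|I E] := IH; first by move=> cp cpl; apply: ls; rewrite in_cons cpl orbT.
  have sp : - s < p by apply: (ls (c, p)); rewrite in_cons eqxx.
  have I1 : mu.-integrable halfline (fun v => (c * (v `^ (s - 1) * (1 - wfun v `^ p)))%:E).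
    exact: (integrableZl mh c (integrable_gint sp)).
  split.
    by have := integrableD mh I1 I; apply: eq_integrable => // v _; rewrite /= big_cons.
  under eq_Rintegral do rewrite big_cons.
  rewrite RintegralD// E big_cons RintegralZl//; last exact: integrable_gint.
  by rewrite Rintegral_gint//=; ring.
rewrite -(pmulr_lle0 _ J0) -E.
apply: (@le_trans _ _ (\int[mu]_(v in halfline) 0)%R); last by rewrite Rintegral_cst// mul0r.
apply: le_Rintegral => // [|v /in_halfline v0].
  by have := integrable0 mu halfline; apply: eq_integrable.
under eq_bigr do rewrite mulrCA.
rewrite -mulr_sumr; apply: mulr_ge0_le0; first exact: powR_ge0.
by apply: le0; rewrite wfun_gt0// wfun_lt1.
Qed.

Lemma Gfun_S p : - s < p -> Gfun s (p + 1) - Gfun s p = s * Gamma_fun (s + p) / Gamma_fun (p + 1).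
Proof.
move=> sp.
have p1 : 0 < p + 1 by rewrite -ltrBlDr sub0r; apply: lt_trans sp; rewrite ltrN2.
have sp0 : 0 < s + p by rewrite -ltrBlDl sub0r.
rewrite Gfun.unlock (rgammaE p1) (addrA s) (Gamma_funS sp0) /rgamma.
by field; rewrite gt_eqF// Gamma_fun_gt0.
Qed.

Lemma Gfun_nondecreasing p q : - s < p -> p <= q -> Gfun s p <= Gfun s q.
Proof.
move=> sp pq; have := @Gfun_comb_le0 [:: (1, p); (-1, q)].
rewrite !big_cons big_nil/= => H; rewrite -subr_le0.
rewrite (_ : Gfun s p - Gfun s q = 1 * Gfun s p + (-1 * Gfun s q + 0)); last by ring.
apply: H => [cp|w /andP[w0 w1]].
  by rewrite !inE => /orP[] /eqP -> //=; exact: lt_le_trans pq.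
rewrite big_cons big_cons big_nil/= (_ : _ + _ = w `^ q - w `^ p); last by ring.
by rewrite subr_le0; apply: ger_powR => //; rewrite w0 ltW.
Qed.

(** Strictness comes from the unit increment [Gfun_S], which is explicit and positive: concavity
    keeps [G(p+h)] above the chord from [p] to [p+1]. *)
Lemma Gfun_increasing p q : - s < p -> p < q -> Gfun s p < Gfun s q.
Proof.
move=> sp pq.
pose h := Num.min (q - p) 1.
have h0 : 0 < h by rewrite lt_min subr_gt0 pq ltr01.
have h1 : h <= 1 by rewrite ge_min lexx orbT.
have hq : p + h <= q by rewrite -lerBrDl ge_min lexx.
have sp0 : 0 < s + p by rewrite -ltrBlDl sub0r.
have p1 : 0 < p + 1 by rewrite -ltrBlDr sub0r; apply: lt_trans sp; rewrite ltrN2.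
apply: (@lt_le_trans _ _ (Gfun s (p + h))); last by apply: Gfun_nondecreasing => //; lra.
have := @Gfun_comb_le0 [:: (h, p + 1); (1 - h, p); (-1, p + h)].
rewrite !big_cons big_nil/= => H.
have {}H : h * Gfun s (p + 1) + ((1 - h) * Gfun s p + (-1 * Gfun s (p + h) + 0)) <= 0.
  apply: H => [cp|w /andP[w0 w1]].
    by rewrite !inE => /or3P[] /eqP -> //=; lra.
  rewrite 3!big_cons big_nil/=.
  (* Weighted arithmetic-geometric mean of [w] and [1]: the tangent bounds [A] and [B] are added
     with weights [h] and [1 - h], and the logarithms cancel. *)
  have : w `^ h <= h * w + (1 - h).
    have wh := powR_gt0 h w0.
    have A : w `^ h * (1 + (1 - h) * ln w) <= w.
      have E : w = w `^ h * w `^ (1 - h) by rewrite -powR_addr// addrC subrK powRr1 ?ltW.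
      by rewrite [leRHS]E ler_pM2l// [leRHS]powR_expR// expR_ge1Dx.
    have B : w `^ h * (1 - h * ln w) <= 1.
      have E : 1 = w `^ h * w `^ (- h) by rewrite -powR_addr// subrr powRr0.
      by rewrite [leRHS]E ler_pM2l// [leRHS]powR_expR// -mulNr expR_ge1Dx.
    have := ler_wpM2l (ltW h0) A; have : 0 <= 1 - h by rewrite subr_ge0.
    by move=> /ler_wpM2l /(_ _ _ B); lra.
  rewrite !powR_addr// (powRr1 (ltW w0)) => wh.
  have wp := powR_gt0 p w0.
  nra.
have D : 0 < Gfun s (p + 1) - Gfun s p.
  by rewrite Gfun_S// divr_gt0 ?mulr_gt0 ?Gamma_fun_gt0.
have := mulr_gt0 h0 D; lra.
Qed.

(* Concavity, through decreasing increments. *)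
Lemma Gfun_increment p q h : - s < p - h -> p <= q -> 0 <= h ->
  Gfun s (q + h) - Gfun s q <= Gfun s p - Gfun s (p - h).
Proof.
move=> sp pq h0.
have := @Gfun_comb_le0 [:: (1, q + h); (-1, q); (-1, p); (1, p - h)].
rewrite !big_cons big_nil/= => H; rewrite -subr_le0.
rewrite (_ : _ - _ = 1 * Gfun s (q + h) + (-1 * Gfun s q + (-1 * Gfun s p + (1 * Gfun s (p - h) + 0)))); last by ring.
apply: H => [cp|w /andP[w0 w1]].
  by rewrite !inE => /or4P[] /eqP -> //=; lra.
rewrite 4!big_cons big_nil/=.
have E1 : w `^ q = w `^ (p - h) * w `^ (q - p + h).
  by rewrite -powR_addr//; congr (_ `^ _); ring.
have E2 : w `^ p = w `^ (p - h) * w `^ h by rewrite -powR_addr//; congr (_ `^ _); ring.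
have E3 : w `^ (q + h) = w `^ (p - h) * w `^ (q - p + h) * w `^ h.
  by rewrite -!powR_addr//; congr (_ `^ _); ring.
rewrite E1 E2 E3.
have a0 := powR_gt0 (p - h) w0.
have le1 r : 0 <= r -> w `^ r <= 1.
  by move=> r0; rewrite -[leRHS](powRr0 w); apply: ger_powR => //; rewrite w0 ltW.
have b1 : w `^ h <= 1 by exact: le1.
have c1 : w `^ (q - p + h) <= 1 by apply: le1; lra.
(* Expanding this product gives exactly the required combination of the four powers. *)
have : 0 <= w `^ (p - h) * ((1 - w `^ h) * (1 - w `^ (q - p + h))).
  by rewrite !mulr_ge0 ?subr_ge0// ltW.
lra.
Qed.

(** Slope form of concavity: the chord over [[q, r]] is no steeper than the earlier one over
    [[p-h, p]]. It gives continuity of [G] and linear bounds on its increments. *)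
Lemma Gfun_lipschitz p q r h : - s < p - h -> 0 < h -> p <= q -> q <= r ->
  Gfun s r - Gfun s q <= (r - q) / h * (Gfun s p - Gfun s (p - h)).
Proof.
move=> sp h0 pq; rewrite le_eqVlt => /predU1P[->|qr].
  by rewrite !subrr mul0r mul0r.
pose k := (r - q) / h.
have k0 : 0 < k by rewrite divr_gt0// subr_gt0.
have := @Gfun_comb_le0 [:: (1, r); (-1, q); (- k, p); (k, p - h)].
rewrite !big_cons big_nil/= => H; rewrite -subr_le0 -/k.
rewrite (_ : _ - _ = 1 * Gfun s r + (-1 * Gfun s q + (- k * Gfun s p + (k * Gfun s (p - h) + 0)))); last by ring.
apply: H => [cp|w /andP[w0 w1]].
  by rewrite !inE => /or4P[] /eqP -> //=; lra.
rewrite 4!big_cons big_nil/=.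
have E1 : w `^ r = w `^ q * w `^ (r - q) by rewrite -powR_addr//; congr (_ `^ _); ring.
have E2 : w `^ (p - h) = w `^ p * w `^ (- h) by rewrite -powR_addr//; congr (_ `^ _); ring.
have a0 := powR_gt0 p w0; have b0 := powR_gt0 q w0.
have qp : w `^ q <= w `^ p by apply: ger_powR => //; rewrite w0 ltW.
pose L := - ln w.
have e1 : 1 - (r - q) * L <= w `^ (r - q).
  by rewrite powR_expR// -mulrN opprK; exact: le_trans (expR_ge1Dx _).
have e2 : 1 + h * L <= w `^ (- h).
  by rewrite powR_expR// mulNr -mulrN; exact: expR_ge1Dx.
have e3 : w `^ (r - q) <= 1.
  by rewrite -[leRHS](powRr0 w); apply: ger_powR; rewrite ?w0 ?ltW//= subr_gt0.
rewrite E1 E2.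
have kh : k * h = r - q by rewrite /k; field; rewrite gt_eqF.
have : 1 - w `^ (r - q) <= k * (w `^ (- h) - 1).
  have : k * (h * L) <= k * (w `^ (- h) - 1) by rewrite ler_pM2l//; lra.
  by rewrite mulrA kh; lra.
move=> K.
have : w `^ q * (1 - w `^ (r - q)) <= w `^ p * (1 - w `^ (r - q)) by rewrite ler_wpM2r// subr_ge0.
have : w `^ p * (1 - w `^ (r - q)) <= w `^ p * (k * (w `^ (- h) - 1)) by rewrite ler_wpM2l// ltW.
lra.
Qed.

Definition Gfun_diff2 p h := Gfun s p *+ 2 - Gfun s (p + h) - Gfun s (p - h).

(** Pointwise this is [(X + Y - 2)^2 >= 0] for [X = w^(h/2)] and [Y = w^(-h/2)], whose product is
    [1]. Iterated, it bounds the second difference at step [h/2^k] by a multiple of [4^(-k)],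
    standing in for two derivatives. *)
Lemma Gfun_diff2_half p h : - s < p - h -> 0 <= h ->
  Gfun_diff2 p (h / 2) <= Gfun_diff2 p h / 4.
Proof.
move=> sp h0; rewrite -subr_le0 /Gfun_diff2.
have := @Gfun_comb_le0 [:: (3 / 2, p); (-1, p + h / 2); (-1, p - h / 2); (1 / 4, p + h); (1 / 4, p - h)].
rewrite !big_cons big_nil/= => H.
rewrite (_ : _ - _ / 4 = 3 / 2 * Gfun s p + (-1 * Gfun s (p + h / 2) +
  (-1 * Gfun s (p - h / 2) + (1 / 4 * Gfun s (p + h) + (1 / 4 * Gfun s (p - h) + 0))))); last by field.
apply: H => [cp|w /andP[w0 w1]].
  by rewrite !inE => /or4P[/eqP->|/eqP->|/eqP->|/orP[]/eqP->] //=; lra.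
rewrite 5!big_cons big_nil/=.
pose X := w `^ (h / 2); pose Y := w `^ (- (h / 2)).
have XY : X * Y = 1 by rewrite -powR_addr// subrr powRr0.
have X0 : 0 < X by exact: powR_gt0.
have Y0 : 0 < Y by exact: powR_gt0.
have a0 := powR_gt0 p w0.
have E1 : w `^ (p + h / 2) = w `^ p * X by rewrite -powR_addr.
have E2 : w `^ (p - h / 2) = w `^ p * Y by rewrite -powR_addr.
have E3 : w `^ (p + h) = w `^ p * (X * X).
  by rewrite -!powR_addr//; congr (_ `^ _); field.
have E4 : w `^ (p - h) = w `^ p * (Y * Y).
  by rewrite -!powR_addr//; congr (_ `^ _); field.
rewrite E1 E2 E3 E4.
have : 0 <= w `^ p * (X + Y - 2) ^+ 2 by rewrite mulr_ge0 ?sqr_ge0 ?(ltW a0).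
rewrite expr2 (_ : (X + Y - 2) * (X + Y - 2) = X * X + Y * Y + 2 * (X * Y) - 4 * X - 4 * Y + 4); last by ring.
rewrite XY; lra.
Qed.

Lemma Gfun_gt0 p : 0 < p -> 0 < Gfun s p.
Proof. by move=> p0; rewrite -Gfun0 Gfun_increasing// oppr_lt0. Qed.

End Gfun.

(** * Gaussian subordination *)

Section enorm.
Context {R : realType} {n : nat}.
Implicit Types x y : 'rV[R]_n.

Lemma sqr_enorm x : enorm x ^+ 2 = \sum_i x ord0 i ^+ 2.
Proof. by rewrite sqr_sqrtr// sumr_ge0// => i _; rewrite sqr_ge0. Qed.

Lemma enorm_ge0 x : 0 <= enorm x.
Proof. exact: sqrtr_ge0. Qed.

Lemma enorm_eq0 x : (enorm x == 0) = (x == 0).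
Proof.
apply/idP/eqP => [|->]; last first.
  by rewrite /enorm big1 ?sqrtr0// => i _; rewrite mxE expr0n.
rewrite -(sqrf_eq0 (enorm x)) sqr_enorm psumr_eq0; last by move=> i _; rewrite sqr_ge0.
move=> /allP h; apply/rowP => i; rewrite mxE; apply/eqP.
by rewrite -sqrf_eq0; apply: h; rewrite mem_index_enum.
Qed.

Lemma enorm_gt0 x : (0 < enorm x) = (x != 0).
Proof. by rewrite lt_neqAle enorm_ge0 andbT eq_sym enorm_eq0. Qed.

Lemma enormN x : enorm (- x) = enorm x.
Proof. by rewrite /enorm; congr Num.sqrt; apply: eq_bigr => i _; rewrite mxE sqrrN. Qed.

Lemma enorm_powR x c : enorm x `^ (2 * c) = (enorm x ^+ 2) `^ c.
Proof. by rewrite powRrM -powR_mulrn ?enorm_ge0. Qed.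

Definition dot x y : R := \sum_i x ord0 i * y ord0 i.

Lemma sqr_enormD x y : enorm (x + y) ^+ 2 = enorm x ^+ 2 + enorm y ^+ 2 + 2 * dot x y.
Proof.
rewrite !sqr_enorm /dot mulr_sumr -!big_split/=.
by apply: eq_bigr => i _; rewrite mxE; ring.
Qed.

Lemma sqr_enormB x y : enorm (x - y) ^+ 2 = enorm x ^+ 2 + enorm y ^+ 2 - 2 * dot x y.
Proof.
rewrite !sqr_enorm /dot mulr_sumr -big_split/= -sumrB.
by apply: eq_bigr => i _; rewrite !mxE; ring.
Qed.

Lemma measurable_set1_row x : measurable [set x].
Proof.
rewrite (_ : [set x] = [set y : 'rV[R]_n | forall i, [set x ord0 i] (y ord0 i)]).
  by apply: (@measurable_row_box _ _ (fun i => [set x ord0 i])) => i; exact: measurable_set1.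
by apply/seteqP; split => y /= => [-> //|h]; apply/rowP => i; exact: h.
Qed.

Lemma lebesgue_row_set1 x : (0 < n)%N -> lebesgue_row [set x] = 0%E.
Proof.
move=> n0; rewrite (_ : [set x] = [set y : 'rV[R]_n | forall i, [set x ord0 i] (y ord0 i)]).
  rewrite (@lebesgue_row_box _ _ (fun i => [set x ord0 i])); last by move=> i; exact: measurable_set1.
  rewrite (bigD1 (Ordinal n0))//= lebesgue_measure_set1 mul0e//.
by apply/seteqP; split => y /= => [-> //|h]; apply/rowP => i; exact: h.
Qed.

Lemma gauss_integral_enorm (t c : R) x : 0 < t ->
  (\int[lebesgue_row]_y (expR (- (t * enorm y ^+ 2) + 2 * (c * dot x y)))%:E =
  ((pi / t) `^ (n%:R / 2) * expR (c ^+ 2 * enorm x ^+ 2 / t))%:E)%E.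
Proof.
move=> t0; rewrite sqr_enorm -integral_gauss_row//; apply: eq_integral => y _.
rewrite sqr_enorm /dot !mulr_sumr -sumrN -big_split/=; congr (expR _)%:E.
by apply: eq_bigr => i _; ring.
Qed.

End enorm.

(** Serves to discard the points [x] and [-x], where [|x-y|] or [|x+y|] vanishes and [powR] at [0]
    only has a conventional value. *)
Lemma eq_integral_off2 (R : realType) n (x y : 'rV[R]_n) (f g : 'rV[R]_n -> R) : (0 < n)%N ->
  measurable_fun setT f -> measurable_fun setT g ->
  (forall z, z != x -> z != y -> f z = g z) ->
  (\int[lebesgue_row]_z (f z)%:E = \int[lebesgue_row]_z (g z)%:E)%E.
Proof.
move=> n0 mf mg fg; apply: ae_eq_integral => //.
- by measfun.
- by measfun.
have N : (@lebesgue_row R n).-negligible ([set x] `|` [set y]).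
  by apply: negligibleU; apply/negligibleP;
    [exact: measurable_set1_row|exact: lebesgue_row_set1|
     exact: measurable_set1_row|exact: lebesgue_row_set1].
apply: negligibleS N => z /= h; apply: contrapT => /not_orP[zx zy]; apply: h => _.
by congr EFin; apply: fg; exact/eqP.
Qed.

Section subordination.
Context {R : realType}.
Local Notation mu := (@lebesgue_measure R).
Implicit Types (b al be : R).

Lemma rgamma_neq0 b : -1 < b -> b != 0 -> rgamma b != 0.
Proof.
move=> b1 b0; rewrite /rgamma mulf_neq0// invr_neq0// gt_eqF// Gamma_fun_gt0//.
by rewrite -ltrBlDr sub0r.
Qed.

Lemma subordination_monotone b al be : -1 < b -> b != 0 -> 0 < al -> al <= be ->
  (\int[mu]_(a in halfline) (a `^ (b - 1) * (expR (- (al * a)) - expR (- (be * a))))%:E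
  = ((al `^ (- b) - be `^ (- b)) / rgamma b)%:E)%E.
Proof.
move=> b1 b0 al0 ab.
have rg0 := rgamma_neq0 b1 b0.
by rewrite mulrC EFinM -integral_expRB// muleA -EFinM mulVf// mul1e.
Qed.

Lemma expR_midpoint (a1 a2 : R) : expR ((a1 + a2) / 2) <= (expR a1 + expR a2) / 2.
Proof.
have E (z : R) : expR z = expR (z / 2) ^+ 2 by rewrite expr2 -expRD; congr expR; field.
have -> : expR ((a1 + a2) / 2) = expR (a1 / 2) * expR (a2 / 2) by rewrite -expRD mulrDl.
rewrite (E a1) (E a2) -subr_ge0.
have := sqr_ge0 (expR (a1 / 2) - expR (a2 / 2)).
by move: (expR (a1 / 2)) (expR (a2 / 2)) => X Y; rewrite !expr2; lra.
Qed.

(** For [b < 0] the single exponentials are not integrable near [0], so each one is first compared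
    with the faster exponential of rate [a1 + a2]; this reduces the claim to three instances of
    [subordination_monotone]. *)
Lemma subordination_convex b a1 a2 : -1 < b -> b != 0 -> 0 < a1 -> 0 < a2 ->
  (\int[mu]_(a in halfline) (a `^ (b - 1) * ((expR (- (a1 * a)) + expR (- (a2 * a))) / 2
     - expR (- ((a1 + a2) / 2 * a))))%:E
  = (((a1 `^ (- b) + a2 `^ (- b)) / 2 - ((a1 + a2) / 2) `^ (- b)) / rgamma b)%:E)%E.
Proof.
move=> b1 b0 a10 a20.
have rg0 := rgamma_neq0 b1 b0.
have l1 : a1 <= a1 + a2 by lra.
have l2 : a2 <= a1 + a2 by lra.
have l3 : (a1 + a2) / 2 <= a1 + a2 by lra.
have p3 : 0 < (a1 + a2) / 2 by lra.
set I := (LHS).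
have h0 (z y a : R) : z <= y -> 0 < a -> 0 <= a `^ (b - 1) * (expR (- (z * a)) - expR (- (y * a))).
  move=> zy a0; rewrite mulr_ge0 ?powR_ge0// subr_ge0 ler_expR lerN2 ler_pM2r//.
have I0 a : 0 < a -> 0 <= a `^ (b - 1) * ((expR (- (a1 * a)) + expR (- (a2 * a))) / 2
     - expR (- ((a1 + a2) / 2 * a))).
  move=> a0; rewrite mulr_ge0 ?powR_ge0// subr_ge0.
  apply: le_trans (expR_midpoint _ _); rewrite ler_expR; lra.
have : (I + \int[mu]_(a in halfline)
     (a `^ (b - 1) * (expR (- ((a1 + a2) / 2 * a)) - expR (- ((a1 + a2) * a))))%:E
   = 2^-1%:E * (\int[mu]_(a in halfline) (a `^ (b - 1) * (expR (- (a1 * a)) - expR (- ((a1 + a2) * a))))%:E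
     + \int[mu]_(a in halfline) (a `^ (b - 1) * (expR (- (a2 * a)) - expR (- ((a1 + a2) * a))))%:E))%E.
  rewrite /I -!ge0_integralD//; try by (measfun || (move=> a /in_halfline a0; rewrite lee_fin ?h0 ?I0)).
  under [in RHS]eq_integral do rewrite -EFinD.
  rewrite -ge0_integral_scalel//; try side.
    by apply: eq_integral => a _; rewrite -EFinD; congr EFin; field.
  by move=> a /in_halfline a0; rewrite addr_ge0 ?h0.
rewrite !subordination_monotone//.
case: I => [r| |]//=; rewrite -!EFinD -EFinM => -[E]; congr EFin.
move: E; move: (rgamma b) rg0 => k k0 E.
apply: (addIr ((((a1 + a2) / 2) `^ (- b) - (a1 + a2) `^ (- b)) / k)); rewrite E; field.
exact: k0.
Qed.

End subordination.

Section kernel.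
Context {R : realType} {n : nat}.
Variable s : R.
Hypotheses (n0 : (0 < n)%N) (s0 : 0 < s) (s1 : s < 1).
Local Notation mu := (@lebesgue_measure R).
Implicit Types (b : R) (x y : 'rV[R]_n).

Let q : R := n%:R / 2 + s.

Definition riesz_kernel y : R := enorm y `^ (- (n%:R + 2 * s)).
Local Notation W := riesz_kernel.

Lemma riesz_kernel_ge0 y : 0 <= W y.
Proof. exact: powR_ge0. Qed.

Lemma riesz_kernelE y : W y = (enorm y ^+ 2) `^ (- q).
Proof. by rewrite -enorm_powR /riesz_kernel; congr (_ `^ _); rewrite /q; field. Qed.

Let q0 : 0 < q.
Proof. by rewrite addr_gt0// divr_gt0// ltr0n. Qed.

Lemma measurable_riesz_kernel : measurable_fun setT W.
Proof. by rewrite /riesz_kernel; measfun. Qed.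

Let G0 : 0 < Gamma_fun q. Proof. exact: Gamma_fun_gt0. Qed.

(** The kernel is written as a Gamma integral in [v] of rate [a |y|^2], not [|y|^2]. With this
    scaling the Gaussians that occur have rates [a v] and [a (1+v)], so that after integration in
    [y] the variables [a] and [v] separate. *)
Lemma integral_mul_riesz b (F : R -> 'rV[R]_n -> R) (f : 'rV[R]_n -> R) :
  measurable_fun setT (fun z : R * 'rV[R]_n => F z.1 z.2) ->
  (forall a y, 0 < a -> 0 <= F a y) ->
  (forall a, F a 0 = 0) ->
  (forall y, y != 0 -> (\int[mu]_(a in halfline) (a `^ (b - 1) * F a y)%:E = (f y)%:E)%E) ->
  (\int[lebesgue_row]_y (f y * W y)%:E =
   \int[mu]_(v in halfline) \int[mu]_(a in halfline)
     (((Gamma_fun q)^-1 * a `^ (b + q - 1) * v `^ (q - 1))%:E *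
      \int[lebesgue_row]_y (expR (- (a * v * enorm y ^+ 2)) * F a y)%:E))%E.
Proof.
move=> mF F0 Fz fE.
have mFa a : measurable_fun setT (F a).
  by apply: (measurableT_comp mF (g := fun y => (a, y))); apply: measurable_fun_pair.
have mFy y : measurable_fun setT (F ^~ y).
  by apply: (measurableT_comp mF (g := fun a => (a, y))); apply: measurable_fun_pair.
pose K (y : 'rV[R]_n) (a v : R) := (Gamma_fun q)^-1 * a `^ (b + q - 1) * v `^ (q - 1) *
  (expR (- (a * v * enorm y ^+ 2)) * F a y).
have K0 y a v : 0 < a -> 0 <= K y a v.
  move=> a0; rewrite /K !mulr_ge0 ?powR_ge0 ?expR_ge0 ?invr_ge0 ?(ltW G0)//.
  exact: F0.
(* The conventional value of [powR] at [0]; on the other side the origin is matched by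
   [F a 0 = 0]. *)
have W0 : W 0 = 0.
  have -> : W 0 = 0 `^ (- (n%:R + 2 * s)) by rewrite /riesz_kernel (eqP (_ : enorm 0 == 0)) ?enorm_eq0.
  by rewrite powR0// oppr_eq0 gt_eqF// addr_gt0 ?ltr0n// mulr_gt0.
transitivity (\int[lebesgue_row]_y \int[mu]_(a in halfline) \int[mu]_(v in halfline) (K y a v)%:E)%E.
  apply: eq_integral => y _.
  have [->|y0] := eqVneq y 0.
    rewrite W0 mulr0; apply/esym; rewrite integral0_eq// => a _.
    by rewrite integral0_eq// => v _; rewrite /K Fz !mulr0.
  have ry : 0 < enorm y ^+ 2 by rewrite exprn_gt0// enorm_gt0.
  rewrite EFinM -fE// muleC -ge0_integral_scalel ?riesz_kernel_ge0//; first last.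
  - by move=> a /in_halfline a0; rewrite mulr_ge0 ?powR_ge0 ?F0.
  - by measfun; exact: mFy.
  apply: eq_integral => a; rewrite inE => /in_halfline a0.
  transitivity (\int[mu]_(v in halfline) ((Gamma_fun q)^-1 * a `^ (b + q - 1) * F a y *
     (v `^ (q - 1) * expR (- ((a * enorm y ^+ 2) * v))))%:E)%E; last first.
    by apply: eq_integral => v _; rewrite /K (mulrAC a v); congr EFin; ring.
  rewrite ge0_integral_scalel//; try side; last first.
    by rewrite !mulr_ge0 ?invr_ge0 ?(ltW G0) ?powR_ge0 ?F0.
  rewrite (gamma_integral_scale q0 (mulr_gt0 a0 ry)) -EFinM riesz_kernelE; congr EFin.
  rewrite (powRM _ (ltW a0) (ltW ry)).
  rewrite (_ : b + q - 1 = b - 1 + q); last by ring.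
  rewrite (powR_addr (b - 1) q a0).
  have E : a `^ q * a `^ (- q) = 1 by rewrite -powR_addr// subrr powRr0.
  transitivity ((enorm y ^+ 2) `^ (- q) * (a `^ (b - 1) * F a y) *
    ((Gamma_fun q)^-1 * Gamma_fun q) * (a `^ q * a `^ (- q))).
    by rewrite E mulVf ?(gt_eqF G0)// !mulr1.
  by move: (Gamma_fun q) (a `^ q) (a `^ (- q)) => z1 z2 z3; ring.
rewrite tonelli_swap3//; last 2 first.
- rewrite /K; apply/measurable_EFinP.
  apply: measurable_funM; first by measfun.
  apply: measurable_funM; first by measfun.
  apply: (measurableT_comp mF (g := fun z : 'rV[R]_n * R * R => (z.1.2, z.1.1))).
  by apply: measurable_fun_pair; measfun.
- by move=> y a v /in_halfline a0 _; rewrite lee_fin K0.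
apply: eq_integral => v _; apply: eq_integral => a; rewrite inE => /in_halfline a0.
rewrite -ge0_integral_scalel//; first last.
- by rewrite !mulr_ge0 ?invr_ge0 ?(ltW G0) ?powR_ge0.
- by move=> y _; rewrite mulr_ge0 ?expR_ge0 ?F0.
- by apply: measurable_funM; [measfun|exact: mFa].
Qed.

End kernel.

Section riesz_integrals.
Context {R : realType} {n : nat}.
Variable s : R.
Hypotheses (n0 : (0 < n)%N) (s0 : 0 < s) (s1 : s < 1).
Local Notation mu := (@lebesgue_measure R).
Implicit Types (b : R) (x y : 'rV[R]_n).
Local Notation W := (riesz_kernel s).

Let m : R := n%:R / 2.
Let q : R := m + s.

Let m0 : 0 < m. Proof. by rewrite divr_gt0// ltr0n. Qed.
Let q0 : 0 < q. Proof. exact: addr_gt0. Qed.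
Let G0 : 0 < Gamma_fun q. Proof. exact: Gamma_fun_gt0. Qed.

Definition riesz_const : R :=
  pi `^ (n%:R / 2) / Gamma_fun (n%:R / 2 + s) * (Gamma_fun (1 - s) / s).

Lemma powR_gauss (a v : R) : 0 < a -> 0 < v ->
  (pi / (a * v)) `^ m = pi `^ m * (a `^ (- m) * v `^ (- m)) :> R.
Proof.
move=> a0 v0; have av0 : 0 < a * v by exact: mulr_gt0.
rewrite powRM ?pi_ge0 ?invr_ge0 ?ltW//; congr (_ * _).
rewrite -powRM ?ltW// powRN; apply: (mulfI (lt0r_neq0 (powR_gt0 m av0))).
rewrite -powRM ?invr_ge0 ?ltW// !mulfV ?powR1//; apply: lt0r_neq0 => //.
exact: powR_gt0.
Qed.

Lemma gauss_integral0 (t : R) : 0 < t ->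
  (\int[@lebesgue_row R n]_y (expR (- (t * enorm y ^+ 2)))%:E = ((pi / t) `^ m)%:E)%E.
Proof.
move=> t0; have := gauss_integral_enorm 0 (0 : 'rV[R]_n) t0.
rewrite expr0n/= !mul0r expR0 mulr1 => <-.
by apply: eq_integral => y _; rewrite mul0r mulr0 addr0.
Qed.

Lemma ereal_addK (X : \bar R) (a c : R) : (0 <= X)%E -> (X + a%:E = c%:E)%E -> X = (c - a)%:E.
Proof. by case: X => [r| |]//= _; rewrite -EFinD => -[<-]; rewrite addrK. Qed.

Let P b rho y : R := (rho `^ (- b) - (rho + enorm y ^+ 2) `^ (- b)) / rgamma b.

(** The [a]-integral is a Gamma integral carrying all dependence on [b] and [rho]; the [v]-integral
    is the integral representation of [G] at [m]. *)
Lemma integral_riesz_monotone b (rho : R) : 0 < rho -> - s < b -> b != 0 ->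
  (\int[lebesgue_row]_y (P b rho y * W y)%:E =
   (riesz_const * Gamma_fun (b + s) * rho `^ (- (b + s)) * Gfun s m)%:E)%E.
Proof.
move=> rho0 sb b0.
have b1 : -1 < b by apply: lt_trans sb; rewrite ltrN2.
have bs0 : 0 < b + s by rewrite -ltrBlDr sub0r.
pose F (a : R) (y : 'rV[R]_n) := expR (- (rho * a)) - expR (- ((rho + enorm y ^+ 2) * a)).
rewrite (@integral_mul_riesz _ _ s n0 s0 b F); first last.
- move=> y y0; rewrite /F subordination_monotone//.
  by rewrite lerDl sqr_ge0.
- move=> a; rewrite /F (eqP (_ : enorm 0 == 0)) ?enorm_eq0// expr0n/= addr0 subrr//.
- move=> a y a0; rewrite subr_ge0 ler_expR lerN2 ler_pM2r// lerDl sqr_ge0//.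
- by rewrite /F; measfun.
transitivity (\int[mu]_(v in halfline) ((pi `^ m / Gamma_fun q * (Gamma_fun (b + s) * rho `^ (- (b + s)))) *
   (v `^ (s - 1) * (1 - wfun v `^ m)))%:E)%E; last first.
  have gw v : 0 < v -> 0 <= 1 - wfun v `^ m.
    move=> v0; rewrite subr_ge0 -[leRHS](powRr0 (wfun v)); apply: ger_powR (ltW m0).
    by rewrite wfun_gt0 ?(ltW (wfun_lt1 _)).
  rewrite ge0_integral_scalel//; first last.
  - by rewrite !mulr_ge0 ?invr_ge0 ?powR_ge0 ?(ltW (Gamma_fun_gt0 _)).
  - by move=> v /in_halfline v0; rewrite mulr_ge0 ?powR_ge0 ?gw.
  - exact: measurable_gint.
  rewrite integral_gintE//; last by apply: lt_trans m0; rewrite oppr_lt0.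
  rewrite -EFinM /riesz_const -/m -/q; congr EFin.
  by move: (Gamma_fun q) (Gamma_fun (b + s)) (Gamma_fun (1 - s)) => z1 z2 z3; ring.
apply: eq_integral => v; rewrite inE => /in_halfline v0.
have v10 : 0 < 1 + v by rewrite addr_gt0.
have gw : 0 <= 1 - wfun v `^ m.
  rewrite subr_ge0 -[leRHS](powRr0 (wfun v)); apply: ger_powR (ltW m0).
  by rewrite wfun_gt0 ?(ltW (wfun_lt1 _)).
transitivity (\int[mu]_(a in halfline) ((pi `^ m / Gamma_fun q * (v `^ (s - 1) * (1 - wfun v `^ m))) *
   (a `^ (b + s - 1) * expR (- (rho * a))))%:E)%E; last first.
  rewrite ge0_integral_scalel//; try side; last first.
    by rewrite !mulr_ge0 ?invr_ge0 ?powR_ge0 ?(ltW G0).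
  rewrite (gamma_integral_scale bs0 rho0) -EFinM; congr EFin.
  by move: (Gamma_fun q) (Gamma_fun (b + s)) => z1 z2; ring.
apply: eq_integral => a; rewrite inE => /in_halfline a0.
have av0 := mulr_gt0 a0 v0; have av10 := mulr_gt0 a0 v10.
set X := (X in (_ * X)%E).
have X0 : (0 <= X)%E.
  apply: integral_ge0 => y _; rewrite lee_fin mulr_ge0 ?expR_ge0//.
  by rewrite subr_ge0 ler_expR lerN2 ler_pM2r// lerDl sqr_ge0.
(* A difference of two Gaussian integrals, obtained by adding the subtracted one back so that only
   nonnegative integrands occur. *)
have -> : X = (expR (- (rho * a)) * (pi / (a * v)) `^ m - expR (- (rho * a)) * (pi / (a * (1 + v))) `^ m)%:E.
  apply: ereal_addK => //.
  rewrite !EFinM -!gauss_integral0// -!ge0_integral_scalel ?expR_ge0//; try by measfun.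
  rewrite -ge0_integralD//; try by ((rewrite ?/F; measfun) || (move=> y _; rewrite lee_fin mulr_ge0 ?expR_ge0// subr_ge0 ler_expR lerN2 ler_pM2r// lerDl sqr_ge0)).
  apply: eq_integral => y _; rewrite -EFinD mulrBr -!expRD; congr EFin.
  rewrite (_ : - (a * v * enorm y ^+ 2) - (rho + enorm y ^+ 2) * a = - (rho * a) - a * (1 + v) * enorm y ^+ 2); last by ring.
  by rewrite subrK addrC.
rewrite -EFinM; congr EFin.
rewrite !powR_gauss//.
rewrite (_ : b + (n%:R / 2 + s) - 1 = b + s - 1 + m); last by rewrite /m; ring.
rewrite (_ : n%:R / 2 + s - 1 = s - 1 + m); last by rewrite /m; ring.
rewrite (powR_addr (b + s - 1) m a0) (powR_addr (s - 1) m v0) powR_wfun//.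
have E : a `^ m * a `^ (- m) = 1 by rewrite -powR_addr// subrr powRr0.
transitivity ((a `^ m * a `^ (- m)) * (pi `^ m / Gamma_fun q * (v `^ (s - 1) * (v `^ m * (v `^ (- m) - (1 + v) `^ (- m)))) *
   (a `^ (b + s - 1) * expR (- (rho * a))))); last by rewrite E mul1r.
by rewrite -/m -/q; move: (Gamma_fun q)^-1 (a `^ m) (a `^ (- m)) => z1 z2 z3; ring.
Qed.

Let Qf b x y : R := (((enorm (x + y) ^+ 2) `^ (- b) + (enorm (x - y) ^+ 2) `^ (- b)) / 2
   - (enorm x ^+ 2 + enorm y ^+ 2) `^ (- b)) / rgamma b.

Let midE x y : (enorm (x + y) ^+ 2 + enorm (x - y) ^+ 2) / 2 = enorm x ^+ 2 + enorm y ^+ 2.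
Proof. by rewrite sqr_enormD sqr_enormB; field. Qed.

Let F x (a : R) y := (expR (- (enorm (x + y) ^+ 2 * a)) + expR (- (enorm (x - y) ^+ 2 * a))) / 2
  - expR (- ((enorm x ^+ 2 + enorm y ^+ 2) * a)).

Let F_ge0 x a y : 0 <= F x a y.
Proof.
rewrite subr_ge0 -midE; apply: le_trans (expR_midpoint _ _).
by rewrite ler_expR; lra.
Qed.

Let F0 x a : F x a 0 = 0.
Proof.
rewrite /F (eqP (_ : enorm 0 == 0)) ?enorm_eq0// expr0n/= !addr0 subr0.
by move: (expR _) => z; field.
Qed.

Let mF x : measurable_fun setT (fun z : R * 'rV[R]_n => F x z.1 z.2).
Proof. by rewrite /F; measfun. Qed.

Let mFa x a : measurable_fun setT (F x a).
Proof. by rewrite /F; measfun. Qed.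

(** The linear terms of the Gaussians centered at [x] and [-x] enter only squared, so both have the
    same integral; completing the square multiplies the rate [|x|^2 a] by [1 - 1/(1+v)], which is
    [wfun v]. *)
Let integral_F_gauss x (a v : R) : 0 < a -> 0 < v ->
  (\int[lebesgue_row]_y (expR (- (a * v * enorm y ^+ 2)) * F x a y)%:E =
   ((pi / (a * (1 + v))) `^ m * (expR (- (enorm x ^+ 2 * wfun v * a)) - expR (- (enorm x ^+ 2 * a))))%:E)%E.
Proof.
move=> a0 v0; have v10 : 0 < 1 + v by rewrite addr_gt0.
have av10 := mulr_gt0 a0 v10.
set rho := enorm x ^+ 2; set X := LHS.
pose c := (pi / (a * (1 + v))) `^ m.
have S k : k ^+ 2 = a ^+ 2 ->
   (\int[lebesgue_row]_y (expR (- (rho * a)) * expR (- (a * (1 + v) * enorm y ^+ 2) + 2 * (k * dot x y)))%:E =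
    (c * expR (- (rho * wfun v * a)))%:E)%E.
  move=> ka; rewrite ge0_integral_scalel ?expR_ge0//; last by rewrite /dot; measfun.
  rewrite gauss_integral_enorm// -EFinM -/c ka mulrCA -expRD; congr (_ * expR _)%:E.
  rewrite /wfun powR_inv1 ?ltW// -/rho; field.
  by rewrite !gt_eqF.
have X0 : (0 <= X)%E.
  by apply: integral_ge0 => y _; rewrite lee_fin mulr_ge0 ?expR_ge0.
rewrite mulrBr -/c; apply: ereal_addK => //.
have -> : (c * expR (- (rho * wfun v * a)))%:E = (2^-1%:E * (
  (\int[lebesgue_row]_y (expR (- (rho * a)) * expR (- (a * (1 + v) * enorm y ^+ 2) + 2 * (- a * dot x y)))%:E)
  + (\int[lebesgue_row]_y (expR (- (rho * a)) * expR (- (a * (1 + v) * enorm y ^+ 2) + 2 * (a * dot x y)))%:E)))%E.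
  by rewrite !S ?sqrrN// -EFinD -EFinM; congr EFin; field.
rewrite mulrC EFinM /c -gauss_integral0// -ge0_integral_scalel ?expR_ge0//; try by measfun.
rewrite -!ge0_integralD//; try by ((rewrite /F /dot; measfun) || (move=> y _; rewrite lee_fin mulr_ge0 ?expR_ge0)).
under [in RHS]eq_integral do rewrite -EFinD.
rewrite -ge0_integral_scalel//; try by ((rewrite /dot; measfun) || (move=> y _; rewrite addr_ge0 ?mulr_ge0 ?expR_ge0)).
apply: eq_integral => y _; rewrite -EFinD; congr EFin.
rewrite /F sqr_enormD sqr_enormB -/rho.
set eA := expR (- (a * v * _)); set u := enorm y ^+ 2; set d := dot x y.
have e1 : eA * expR (- ((rho + u + 2 * d) * a)) =
    expR (- (rho * a)) * expR (- (a * (1 + v) * u) + 2 * (- a * d)).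
  by rewrite -!expRD; congr expR; rewrite -/u; ring.
have e2 : eA * expR (- ((rho + u - 2 * d) * a)) =
    expR (- (rho * a)) * expR (- (a * (1 + v) * u) + 2 * (a * d)).
  by rewrite -!expRD; congr expR; rewrite -/u; ring.
have e3 : eA * expR (- ((rho + u) * a)) = expR (- (rho * a)) * expR (- (a * (1 + v) * u)).
  by rewrite -!expRD; congr expR; rewrite -/u; ring.
by rewrite -e1 -e2 -e3; field.
Qed.

(** After the Gaussian step the [a]-integral is again a subordination, of order [b + s], between
    [|x|^2 w] and [|x|^2]. Its value times [w^m] contains [w^(m-s-b) - w^m], hence a difference of
    two values of [G]; [b < m] is what keeps [m-s-b] above [-s]. *)
Lemma integral_riesz_convex b x : x != 0 -> - s < b -> b < m -> b != 0 ->
  (\int[lebesgue_row]_y (Qf b x y * W y)%:E =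
   (riesz_const * Gamma_fun (b + s) * (enorm x ^+ 2) `^ (- (b + s)) *
     (Gfun s m - Gfun s (m - s - b)))%:E)%E.
Proof.
move=> x0 sb bm b0.
have rho0 : 0 < enorm x ^+ 2 by rewrite exprn_gt0// enorm_gt0.
have b1 : -1 < b by apply: lt_trans sb; rewrite ltrN2.
have bs0 : 0 < b + s by rewrite -ltrBlDr sub0r.
pose D : set 'rV[R]_n := ~` [set x; - x].
have mD : measurable D.
  by apply: measurableC; apply: measurableU; exact: measurable_set1_row.
have mI : measurable_fun setT (\1_D : 'rV[R]_n -> R) by exact: measurable_indic.
have I1 y : y != x -> y != - x -> \1_D y = 1 :> R.
  by move=> yx yx'; rewrite indicE mem_set//= => -[] /eqP; [rewrite (negbTE yx)|rewrite (negbTE yx')].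
pose F' a y := \1_D y * F x a y.
have mF' : measurable_fun setT (fun z : R * 'rV[R]_n => F' z.1 z.2).
  apply: measurable_funM; last exact: mF.
  exact: (measurableT_comp mI measurable_snd).
transitivity (\int[lebesgue_row]_y ((\1_D y * Qf b x y) * W y)%:E)%E.
  apply: (@eq_integral_off2 _ _ x (- x)) => //.
  - by rewrite /Qf; measfun; exact: measurable_riesz_kernel.
  - apply: measurable_funM; last exact: measurable_riesz_kernel.
    by apply: measurable_funM => //; rewrite /Qf; measfun.
  - by move=> z zx zx'; rewrite I1// mul1r.
rewrite (@integral_mul_riesz _ _ s n0 s0 b F'); first last.
- move=> y y0; rewrite /F' indicE; case: (boolP (y \in D)) => yD /=; last first.
    rewrite !mul0r; under eq_integral do rewrite mul0r mulr0.
    by rewrite integral0.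
  have [yx yx'] : y != x /\ y != - x.
    move: yD; rewrite inE => /not_orP[/eqP ? /eqP ?]//.
  under eq_integral do rewrite mul1r /F -midE.
  rewrite mul1r subordination_convex// ?midE//.
  - by rewrite exprn_gt0// enorm_gt0 addrC addr_eq0.
  - by rewrite exprn_gt0// enorm_gt0 subr_eq0 eq_sym.
- by move=> a; rewrite /F' F0 mulr0.
- by move=> a y a0; rewrite mulr_ge0// indicE.
- exact: mF'.
transitivity (\int[mu]_(v in halfline) ((pi `^ m / Gamma_fun q * (Gamma_fun (b + s) * (enorm x ^+ 2) `^ (- (b + s)))) *
   (v `^ (s - 1) * (wfun v `^ (m - s - b) - wfun v `^ m)))%:E)%E; last first.
  have sm : - s < m by apply: lt_trans m0; rewrite oppr_lt0.
  have smb : - s < m - s - b by rewrite -subr_gt0 (_ : _ - _ = m - b) ?subr_gt0//; ring.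
  have gw v : 0 < v -> 0 <= wfun v `^ (m - s - b) - wfun v `^ m.
    move=> v0; rewrite subr_ge0; apply: ger_powR; last by rewrite -subr_ge0 (_ : _ - _ = b + s) ?(ltW bs0)//; ring.
    by rewrite wfun_gt0 ?(ltW (wfun_lt1 _)).
  rewrite ge0_integral_scalel//; first last.
  - by rewrite !mulr_ge0 ?invr_ge0 ?powR_ge0 ?(ltW (Gamma_fun_gt0 _)).
  - by move=> v /in_halfline v0; rewrite mulr_ge0 ?powR_ge0 ?gw.
  - by rewrite /wfun; measfun.
  transitivity ((pi `^ m / Gamma_fun q * (Gamma_fun (b + s) * (enorm x ^+ 2) `^ (- (b + s))))%:E *
     (((Gfun s m - Gfun s (m - s - b)) * (Gamma_fun (1 - s) / s))%:E))%E; last first.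
    rewrite -EFinM /riesz_const -/m -/q; congr EFin.
    by move: (Gamma_fun q) (Gamma_fun (b + s)) (Gamma_fun (1 - s)) => z1 z2 z3; ring.
  congr (_ * _)%E.
  rewrite mulrBl EFinB -!integral_gintE//.
  rewrite -integralB_EFin//; try exact: integrable_gint.
  by apply: eq_integral => v _; rewrite -EFinB; congr EFin; ring.
apply: eq_integral => v; rewrite inE => /in_halfline v0.
have v10 : 0 < 1 + v by rewrite addr_gt0.
have w0 := wfun_gt0 v0; have w1 := wfun_lt1 v0.
have bsn0 : b + s != 0 by rewrite gt_eqF.
have bs1 : -1 < b + s by apply: lt_trans bs0; rewrite oppr_lt0.
have rw0 : 0 < enorm x ^+ 2 * wfun v by exact: mulr_gt0.
have rw1 : enorm x ^+ 2 * wfun v <= enorm x ^+ 2 by rewrite ler_piMr ?ltW.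
transitivity (\int[mu]_(a in halfline) ((pi `^ m / Gamma_fun q * (v `^ (s - 1) * wfun v `^ m)) *
   (a `^ (b + s - 1) * (expR (- (enorm x ^+ 2 * wfun v * a)) - expR (- (enorm x ^+ 2 * a)))))%:E)%E; last first.
  rewrite ge0_integral_scalel//; first last.
  - by rewrite !mulr_ge0 ?invr_ge0 ?powR_ge0 ?(ltW G0).
  - move=> a /in_halfline a0; rewrite mulr_ge0 ?powR_ge0// subr_ge0 ler_expR lerN2 ler_pM2r//.
  - by measfun.
  rewrite subordination_monotone// (rgammaE bs0) -EFinM; congr EFin.
  rewrite (powRM _ (ltW rho0) (ltW w0)).
  have E : wfun v `^ (m - s - b) = wfun v `^ m * wfun v `^ (- (b + s)).
    by rewrite -powR_addr//; congr (_ `^ _); ring.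
  by rewrite E invrK; move: (Gamma_fun q) (Gamma_fun (b + s)) => z1 z2; ring.
apply: eq_integral => a; rewrite inE => /in_halfline a0.
rewrite (_ : (\int[lebesgue_row]_y _)%E =
  \int[lebesgue_row]_y (expR (- (a * v * enorm y ^+ 2)) * F x a y)%:E)%E; last first.
  apply: (@eq_integral_off2 _ _ x (- x)) => //.
  - apply: measurable_funM; first by measfun.
    by apply: measurable_funM => //; exact: mFa.
  - by apply: measurable_funM; [measfun|exact: mFa].
  - by move=> z zx zx'; rewrite /F' I1// mul1r.
rewrite integral_F_gauss// -EFinM; congr EFin.
rewrite powR_gauss//.
rewrite (_ : b + (n%:R / 2 + s) - 1 = b + s - 1 + m); last by rewrite /m; ring.
rewrite (_ : n%:R / 2 + s - 1 = s - 1 + m); last by rewrite /m; ring.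
rewrite (powR_addr (b + s - 1) m a0) (powR_addr (s - 1) m v0).
have E : a `^ m * a `^ (- m) = 1 by rewrite -powR_addr// subrr powRr0.
have -> : wfun v `^ m = v `^ m * (1 + v) `^ (- m).
  by rewrite /wfun (powRM _ (ltW v0)) ?powR_ge0// -powRrM mulN1r.
set K := expR _ - expR _.
transitivity ((a `^ m * a `^ (- m)) * (pi `^ m / Gamma_fun q * (v `^ (s - 1) * (v `^ m * (1 + v) `^ (- m))) *
   (a `^ (b + s - 1) * K))); last by rewrite E mul1r.
by rewrite -/m -/q; move: (Gamma_fun q)^-1 (a `^ m) (a `^ (- m)) K => z1 z2 z3 z4; ring.
Qed.

End riesz_integrals.

(** * Symmetrized principal values *)

Section row_affine.
Context {R : realType} {n : nat}.
Local Open Scope ereal_scope.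
Implicit Types (x y : 'rV[R]_n) (f : 'rV[R]_n -> \bar R).

Lemma integral_row_affine (c : R) x f : `|c|%R = 1%R -> measurable_fun setT f ->
  \int[lebesgue_row]_y f y = \int[lebesgue_row]_y f (c *: y + x)%R.
Proof.
move=> c1 mf; rewrite integralE [RHS]integralE.
congr (_ - _).
  rewrite [LHS](ge0_integral_row_affine x c1 (measurable_funepos mf) (fun y => funepos_ge0 f y)).
  by apply: eq_integral => y _; rewrite !funeposE.
rewrite [LHS](ge0_integral_row_affine x c1 (measurable_funeneg mf) (fun y => funeneg_ge0 f y)).
by apply: eq_integral => y _; rewrite !funenegE.
Qed.

Lemma integrable_row_affine (c : R) x f : `|c|%R = 1%R ->
  (@lebesgue_row R n).-integrable setT f ->
  (@lebesgue_row R n).-integrable setT (fun y => f (c *: y + x)%R).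
Proof.
move=> c1 /integrableP[mf foo]; apply/integrableP; split.
  exact: (measurableT_comp mf (measurable_row_affine c x)).
rewrite -(@integral_row_affine c x (fun y => `|f y|))//.
exact: measurableT_comp.
Qed.

End row_affine.

Section principal_value.
Context {R : realType} {n : nat}.
Variable s : R.
Hypotheses (n0 : (0 < n)%N) (s0 : 0 < s).
Implicit Types (u : 'rV[R]_n -> R) (x y : 'rV[R]_n) (eps : R).
Local Notation W := (riesz_kernel s).
Local Notation lam := (@lebesgue_row R n).

Definition sym_diff u x y : R := (u x - u (x + y)) + (u x - u (x - y)).

(** Conditions under which the principal value becomes a genuine Lebesgue integral once [y] and [-y]
    are paired; [sym_fraclap] is then its value. *)
Definition sym_integrable u x : Prop :=
  [/\ measurable_fun setT u,
      forall eps, 0 < eps -> lam.-integrable (~` eball x eps) (EFin \o fraclap_integrand s u x)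
    & lam.-integrable setT (fun y => (sym_diff u x y * W y)%:E)].

Definition sym_fraclap u x : R :=
  fraclap_const (n := n) s * (2^-1 * \int[lam]_y (sym_diff u x y * W y)).

Definition outball eps : set 'rV[R]_n := [set y | eps <= enorm y].

Lemma measurable_outball eps : measurable (outball eps).
Proof.
have := @measurable_enorm R n measurableT _ (measurable_itv `[eps, +oo[).
rewrite setTI; congr (measurable _).
by apply/seteqP; split => y; rewrite /outball/= in_itv/= andbT.
Qed.

Lemma setC_eball x eps : ~` eball x eps = [set z | eps <= enorm (x - z)].
Proof. by apply/seteqP; split => z /=; rewrite /eball/= leNgt => /negP. Qed.

Lemma measurable_setC_eball x eps : measurable (~` eball x eps).
Proof.
have mf : measurable_fun setT (fun z : 'rV[R]_n => enorm (x - z)) by measfun.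
have := mf measurableT _ (measurable_itv `[eps, +oo[).
rewrite setTI setC_eball; congr (measurable _).
by apply/seteqP; split => y /=; rewrite in_itv/= andbT.
Qed.

Lemma riesz_kernelV y : (enorm y `^ (n%:R + 2 * s))^-1 = W y.
Proof. by rewrite /riesz_kernel powRN. Qed.

Lemma measurable_fraclap_integrand u x : measurable_fun setT u ->
  measurable_fun setT (fraclap_integrand s u x).
Proof.
move=> mu; apply: (eq_measurable_fun (fun z => (u x - u z) * W (x - z))).
  by move=> z _; rewrite /fraclap_integrand -riesz_kernelV.
by rewrite /riesz_kernel; measfun.
Qed.

(* [c = 1] and [c = -1] give the two halves of the symmetrized integral. *)
Lemma patch_affine u x eps (c : R) y : `|c| = 1 ->
  ((EFin \o fraclap_integrand s u x) \_ (~` eball x eps)) (c *: y + x) =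
  ((fun y => ((u x - u (x + c *: y)) * W y)%:E) \_ (outball eps)) y.
Proof.
move=> c1.
have E : enorm (x - (c *: y + x)) = enorm y.
  rewrite opprD addrCA subrr addr0 enormN.
  rewrite /enorm; congr Num.sqrt; apply: eq_bigr => i _; rewrite mxE exprMn.
  by rewrite -(@real_normK _ c) ?num_real// c1 expr1n mul1r.
rewrite !patchE (_ : (c *: y + x \in ~` eball x eps) = (y \in outball eps)).
  by case: ifP => // _ /=; rewrite /fraclap_integrand E riesz_kernelV (addrC (c *: y)).
by apply/idP/idP; rewrite !inE setC_eball /outball/= E.
Qed.

Lemma integrable_shift u x eps (c : R) : `|c| = 1 ->
  lam.-integrable (~` eball x eps) (EFin \o fraclap_integrand s u x) ->
  lam.-integrable (outball eps) (fun y => ((u x - u (x + c *: y)) * W y)%:E).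
Proof.
move=> c1 /(integrable_mkcond _ (measurable_setC_eball x eps)) /(integrable_row_affine x c1) I.
apply/(integrable_mkcond _ (measurable_outball eps)).
by apply: eq_integrable I => // y _; rewrite patch_affine.
Qed.

Lemma integral_shift u x eps (c : R) : `|c| = 1 -> measurable_fun setT u ->
  (\int[lam]_(z in ~` eball x eps) (fraclap_integrand s u x z)%:E =
   \int[lam]_(y in outball eps) ((u x - u (x + c *: y)) * W y)%:E)%E.
Proof.
move=> c1 mu; rewrite integral_mkcond (@integral_row_affine _ _ c x)//.
  rewrite [RHS]integral_mkcond; apply: eq_integral => y _.
  exact: patch_affine.
apply: (measurable_restrictT (EFin \o fraclap_integrand s u x) (measurable_setC_eball x eps)).1.
by apply: measurable_funTS; apply/measurable_EFinP; exact: measurable_fraclap_integrand.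
Qed.

Lemma sym_diffE u x y : sym_diff u x y * W y =
  (u x - u (x + 1 *: y)) * W y + (u x - u (x + (- 1) *: y)) * W y.
Proof. by rewrite /sym_diff scale1r scaleN1r mulrDl. Qed.

Lemma integral_fraclap_sym u x eps : measurable_fun setT u ->
  lam.-integrable (~` eball x eps) (EFin \o fraclap_integrand s u x) ->
  (\int[lam]_(z in ~` eball x eps) (fraclap_integrand s u x z) =
   2^-1 * \int[lam]_(y in outball eps) (sym_diff u x y * W y))%R.
Proof.
move=> mu I.
have c1 : `|1| = 1 :> R by rewrite normr1.
have cN1 : `|-1| = 1 :> R by rewrite normrN1.
under [in RHS]eq_Rintegral do rewrite sym_diffE.
rewrite (RintegralD (measurable_outball eps) (integrable_shift c1 I) (integrable_shift cN1 I)).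
by rewrite /Rintegral -!integral_shift//; field.
Qed.

(** Averaging the substitutions [z = x + y] and [z = x - y] makes the truncated integral half of a
    symmetrized one, whose integrand is integrable on the whole space; dominated convergence removes
    the truncation. *)
Lemma sym_is_fraclap u x : sym_integrable u x -> is_fraclap s u x (sym_fraclap u x).
Proof.
move=> [mu I1 I2]; split => //.
apply: cvgM; first exact: cvg_cst.
apply/cvg_at_rightP => e [e0 ecv].
under eq_fun do rewrite integral_fraclap_sym ?I1//.
apply: cvgM; first exact: cvg_cst.
pose h y := (sym_diff u x y * W y)%:E.
have hfin : (\int[lam]_y h y)%E \is a fin_num by exact: integrable_fin_num.
have Ek k : lam.-integrable (outball (e k)) h.
  by apply: integrableS I2 => //; exact: measurable_outball.
have mh : measurable_fun setT h by case/integrableP : I2.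
have mhk k : measurable_fun setT (h \_ (outball (e k))).
  apply: (measurable_restrictT h (measurable_outball (e k))).1.
  exact: measurable_funTS.
(* The origin lies outside every [outball (e k)], so pointwise convergence there needs this
   value. *)
have h0 : h 0 = 0%E by rewrite /h /sym_diff addr0 subr0 subrr addr0 mul0r.
have ptw : {ae lam, forall y, setT y -> (h \_ (outball (e k))) y @[k --> \oo] --> h y}.
  apply: aeW => y _; have [->|y0] := eqVneq y 0.
    apply: cvg_near_cst; near=> k; rewrite patchE h0.
    by case: ifP.
  have en0 : 0 < enorm y by rewrite enorm_gt0.
  apply: cvg_near_cst; near=> k; rewrite patchE mem_set// /outball/=.
  near: k.
  by move/cvgr0_norm_lt : ecv => /(_ _ en0); apply: filterS => k; rewrite gtr0_norm// => /ltW.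
have dom : {ae lam, forall y k, setT y -> (`|(h \_ (outball (e k))) y| <= `|h y|)%E}.
  by apply: aeW => y k _; rewrite patchE; case: ifP => // _; rewrite abse0 abse_ge0.
have [_ _ cv] := dominated_convergence measurableT mhk mh ptw (integrable_abse I2) dom.
rewrite /Rintegral.
have -> : (fun k => fine (\int[lam]_(y in outball (e k)) (sym_diff u x y * W y)%:E)%E) =
    (fun k => fine (\int[lam]_y (h \_ (outball (e k))) y)%E).
  by apply/funext => k; rewrite integral_mkcond.
by apply: fine_cvg; rewrite fineK.
Unshelve. all: by end_near. Qed.

End principal_value.

(** * The fractional Laplacian of powers of the norm *)

Section power.
Context {R : realType} {n : nat}.
Variable s : R.
Hypotheses (n0 : (0 < n)%N) (s0 : 0 < s) (s1 : s < 1).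
Implicit Types (u v : 'rV[R]_n -> R) (x y : 'rV[R]_n) (eps b : R).
Local Notation W := (riesz_kernel s).
Local Notation lam := (@lebesgue_row R n).

Let m : R := n%:R / 2.
Let m0 : 0 < m. Proof. by rewrite divr_gt0// ltr0n. Qed.

Lemma integrable_ge0_fin (f : 'rV[R]_n -> R) (c : R) : measurable_fun setT f ->
  (forall y, 0 <= f y) -> (\int[lam]_y (f y)%:E = c%:E)%E ->
  lam.-integrable setT (EFin \o f).
Proof.
move=> mf f0 E; apply/integrableP; split; first exact/measurable_EFinP.
rewrite (_ : \int[lam]_y _ = c%:E)%E ?ltry// -E; apply: eq_integral => y _ /=.
by rewrite ger0_norm.
Qed.

(** No polar coordinates: [integral_riesz_monotone] at [b = rho = 1] integrates [W] against
    [1 - 1/(1+|y|^2)] up to a constant, and this weight is bounded below off the ball. *)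
Lemma integrable_riesz_outball eps : 0 < eps ->
  lam.-integrable (outball eps) (fun y => (W y)%:E).
Proof.
move=> e0.
have s1' : - s < 1 by rewrite ltrNl (lt_trans _ s0)// oppr_lt0.
have rg0 : 0 < rgamma (1 : R).
  by rewrite rgammaE// invr_gt0 Gamma_fun_gt0.
pose f y := (1 `^ (- 1) - (1 + enorm y ^+ 2) `^ (- 1)) / rgamma 1 * W y.
have fE y : f y = (1 - (1 + enorm y ^+ 2)^-1) / rgamma 1 * W y.
  by rewrite /f powR1 powR_inv1// addr_ge0// sqr_ge0.
have h t : 0 <= t -> 0 <= 1 - (1 + t ^+ 2)^-1 :> R.
  by move=> t0; rewrite subr_ge0 invf_le1 ?ltr_pwDl ?lerDl ?sqr_ge0.
have f0 y : 0 <= f y.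
  by rewrite fE !mulr_ge0 ?riesz_kernel_ge0 ?invr_ge0 ?(ltW rg0) ?h ?enorm_ge0.
have If : lam.-integrable setT (EFin \o f).
  apply: integrable_ge0_fin f0 (integral_riesz_monotone n0 s0 s1 ltr01 s1' (oner_neq0 R)).
  by rewrite /f /riesz_kernel; measfun.
pose k := (1 - (1 + eps ^+ 2)^-1) / rgamma 1.
have k0 : 0 < k.
  by rewrite divr_gt0// subr_gt0 invf_lt1 ?ltrDl ?ltr_wpDr ?exprn_gt0 ?sqr_ge0.
have := integrableZl (measurable_outball eps) k^-1
  (integrableS measurableT (measurable_outball eps) (@subsetT _ _) If).
apply: le_integrable => //.
- exact: measurable_outball.
- by rewrite /riesz_kernel; measfun.
move=> y ey; rewrite /= lee_fin ger0_norm ?riesz_kernel_ge0//.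
rewrite ger0_norm; last by rewrite mulr_ge0 ?invr_ge0 ?(ltW k0).
rewrite mulrC ler_pdivlMr// mulrC fE ler_wpM2r ?riesz_kernel_ge0//.
rewrite /k ler_pM2r ?invr_gt0// lerD2l lerN2 lef_pV2 ?posrE ?ltr_wpDr ?sqr_ge0//.
by rewrite lerD2l ler_sqr ?nnegrE ?enorm_ge0 ?(ltW e0).
Qed.

Lemma integrable_unshift u x eps : measurable_fun setT u ->
  lam.-integrable (outball eps) (fun y => ((u x - u (x + y)) * W y)%:E) ->
  lam.-integrable (~` eball x eps) (EFin \o fraclap_integrand s u x).
Proof.
move=> mu /(integrable_mkcond _ (measurable_outball eps)) I.
apply/(integrable_mkcond _ (measurable_setC_eball x eps)).
have c1 : `|1| = 1 :> R by rewrite normr1.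
have := integrable_row_affine (- x) c1 I.
apply: eq_integrable => // z _.
have zE : z = 1 *: (z - x) + x by rewrite scale1r subrK.
by rewrite [in RHS]zE (@patch_affine _ _ s u x eps 1 (z - x) c1) !patchE !scale1r.
Qed.

(** Positivity of [u] gives [u(x+y) <= 2u(x) - sym_diff u x y], and both terms on the right are
    integrable against the kernel away from the origin. *)
Lemma sym_integrable_outball u x : measurable_fun setT u ->
  (forall y, 0 <= u y) ->
  lam.-integrable setT (fun y => (sym_diff u x y * W y)%:E) ->
  sym_integrable s u x.
Proof.
move=> mu u0 I; split => // eps e0.
apply: integrable_unshift => //.
have IW := integrable_riesz_outball e0.
have mo := @measurable_outball R n eps.
have I1 : lam.-integrable (outball eps) (fun y => (u (x + y) * W y)%:E).
  have := integrableB mo (integrableZl mo (u x *+ 2) IW) (integrableS measurableT mo (@subsetT _ _) I).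
  apply: le_integrable => //.
    by rewrite /riesz_kernel; measfun; apply: (measurableT_comp mu); measfun.
  move=> y _ /=; rewrite lee_fin ger0_norm ?mulr_ge0 ?riesz_kernel_ge0//.
  apply: le_trans (ler_norm _); rewrite /sym_diff -mulrBl ler_wpM2r ?riesz_kernel_ge0//.
  by have := u0 (x - y); move: (u x) (u (x + y)) (u (x - y)) => a c d; lra.
have := integrableB mo (integrableZl mo (u x) IW) I1.
by apply: eq_integrable => // y _ /=; rewrite -EFinB mulrBl.
Qed.

Lemma fraclap_const_riesz : fraclap_const (n := n) s * riesz_const (n := n) s = 2 `^ (2 * s).
Proof.
rewrite /fraclap_const /riesz_const.
rewrite (_ : (n%:R + 2 * s) / 2 = n%:R / 2 + s); last by field.
have g1 : Gamma_fun (n%:R / 2 + s) != 0 by rewrite gt_eqF// Gamma_fun_gt0// addr_gt0.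
have g2 : Gamma_fun (1 - s) != 0 by rewrite gt_eqF// Gamma_fun_gt0// subr_gt0.
have E : pi `^ (- (n%:R / 2)) * pi `^ (n%:R / 2) = 1 :> R.
  by rewrite -powR_addr ?pi_gt0// addNr powRr0.
transitivity (2 `^ (2 * s) * (pi `^ (- (n%:R / 2)) * pi `^ (n%:R / 2)) : R); last by rewrite E mulr1.
move: (Gamma_fun _) (Gamma_fun _) g1 g2 => z1 z2 g1 g2; field.
by rewrite g1 g2 gt_eqF.
Qed.

Definition fraclap_symbol b : R := 2 `^ (2 * s) * (Gfun s b * Gfun s (m - s - b)).

Lemma measurable_powR_enorm (tau : R) : measurable_fun setT (fun z : 'rV[R]_n => enorm z `^ tau).
Proof. by measfun. Qed.

(** Here [P] is the monotonicity gap and [Q] the midpoint gap: the symmetrized integrand is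
    [2 rgamma(b) (P - Q)]. The terms in [G(m)] cancel and [rgamma(b) Gamma(b+s)] is [G(b)]. *)
Lemma sym_powR b x : x != 0 -> - s < b -> b < m ->
  sym_integrable s (fun z => enorm z `^ (- 2 * b)) x /\
  sym_fraclap s (fun z => enorm z `^ (- 2 * b)) x =
    fraclap_symbol b * enorm x `^ (- 2 * b - 2 * s).
Proof.
move=> x0 sb bm.
set u := fun z : 'rV[R]_n => enorm z `^ (- 2 * b).
have mu : measurable_fun setT u by exact: measurable_powR_enorm.
have u0 z : 0 <= u z by exact: powR_ge0.
(* Since [rgamma 0 = 0], division by [rgamma b] fails at [b = 0]; there [u] is constant and the
   symbol contains [G(0) = 0]. *)
have [b0|b0] := eqVneq b 0.
  have D y : sym_diff u x y * W y = 0.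
    by rewrite /sym_diff /u b0 mulr0 !powRr0 subrr addr0 mul0r.
  split.
    apply: sym_integrable_outball => //.
    by apply: (eq_integrable _ (cst 0%E)) => // [y _|]; [rewrite D|exact: integrable0].
  rewrite /sym_fraclap; under eq_Rintegral do rewrite D.
  by rewrite Rintegral_cst// mul0r !mulr0 /fraclap_symbol b0 Gfun0 !mul0r mulr0 mul0r.
set rho := enorm x ^+ 2.
have rho0 : 0 < rho by rewrite exprn_gt0// enorm_gt0.
have b1 : -1 < b by apply: lt_trans sb; rewrite ltrN2.
have rg0 : rgamma b != 0 by exact: rgamma_neq0.
have bs0 : 0 < b + s by rewrite -ltrBlDr sub0r.
have uE z : u z = (enorm z ^+ 2) `^ (- b) by rewrite /u -enorm_powR; congr (_ `^ _); ring.
pose P y := (rho `^ (- b) - (rho + enorm y ^+ 2) `^ (- b)) / rgamma b * W y.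
pose Q y := (((enorm (x + y) ^+ 2) `^ (- b) + (enorm (x - y) ^+ 2) `^ (- b)) / 2
   - (rho + enorm y ^+ 2) `^ (- b)) / rgamma b * W y.
have EP := integral_riesz_monotone n0 s0 s1 rho0 sb b0.
have EQ := integral_riesz_convex n0 s0 s1 x0 sb bm b0.
have mP : measurable_fun setT P by rewrite /P /riesz_kernel; measfun.
have mQ : measurable_fun setT Q by rewrite /Q /riesz_kernel; measfun.
have P0 y : 0 <= P y.
  rewrite mulr_ge0 ?riesz_kernel_ge0// -lee_fin -subordination_monotone ?lerDl ?sqr_ge0//.
  apply: integral_ge0 => a /in_halfline a0; rewrite lee_fin mulr_ge0 ?powR_ge0//.
  by rewrite subr_ge0 ler_expR lerN2 ler_pM2r// lerDl sqr_ge0.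
have Q0 y : y != x -> y != - x -> 0 <= Q y.
  move=> yx yx'; rewrite mulr_ge0 ?riesz_kernel_ge0//.
  have mid : (enorm (x + y) ^+ 2 + enorm (x - y) ^+ 2) / 2 = rho + enorm y ^+ 2.
    by rewrite sqr_enormD sqr_enormB -/rho; field.
  rewrite -lee_fin -mid -subordination_convex//.
  - apply: integral_ge0 => a _; rewrite lee_fin mulr_ge0 ?powR_ge0// subr_ge0.
    apply: le_trans (expR_midpoint _ _); rewrite ler_expR mid -mid; lra.
  - by rewrite exprn_gt0// enorm_gt0 addrC addr_eq0.
  - by rewrite exprn_gt0// enorm_gt0 subr_eq0 eq_sym.
have IP : lam.-integrable setT (EFin \o P) by exact: integrable_ge0_fin EP.
have IQ : lam.-integrable setT (EFin \o Q).
  apply/integrableP; split; first exact/measurable_EFinP.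
  rewrite (_ : (\int[lam]_y _)%E = (\int[lam]_y (Q y)%:E)%E); first by rewrite EQ ltry.
  apply: (@eq_integral_off2 _ _ x (- x) (fun y => `|Q y|)) => //.
    exact: measurable_fun_norm.
  by move=> y yx yx'; rewrite ger0_norm ?Q0.
have DE y : sym_diff u x y * W y = (2 * rgamma b) * (P y - Q y).
  rewrite /sym_diff !uE /P /Q -/rho.
  move: (rho `^ (- b)) ((enorm (x + y) ^+ 2) `^ (- b)) ((enorm (x - y) ^+ 2) `^ (- b))
    ((rho + enorm y ^+ 2) `^ (- b)) (W y) (rgamma b) rg0 => a1 a2 a3 a4 w k k0.
  by field.
have ID : lam.-integrable setT (fun y => (sym_diff u x y * W y)%:E).
  have := integrableZl measurableT (2 * rgamma b) (integrableB measurableT IP IQ).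
  by apply: eq_integrable => // y _; rewrite DE.
split; first exact: sym_integrable_outball.
rewrite /sym_fraclap; under eq_Rintegral do rewrite DE.
rewrite RintegralZl//; last by have := integrableB measurableT IP IQ; apply: eq_integrable.
rewrite RintegralB// /Rintegral EP EQ /= -/m -/rho /fraclap_symbol -fraclap_const_riesz.
rewrite (_ : - 2 * b - 2 * s = 2 * - (b + s)); last by ring.
rewrite enorm_powR -/rho.
rewrite (_ : Gfun s b = rgamma b * Gamma_fun (b + s)); last by rewrite Gfun.unlock addrC.
rewrite (_ : m - s - b = m - (s + b)); last by ring.
move: (fraclap_const s) (riesz_const s) (Gamma_fun (b + s)) (rho `^ _) (rgamma b) => z1 z2 z3 z4 z5.
by field.
Qed.

End power.

Section sym_linear.
Context {R : realType} {n : nat}.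
Variable s : R.
Hypotheses (n0 : (0 < n)%N) (s0 : 0 < s) (s1 : s < 1).
Implicit Types (u v w : 'rV[R]_n -> R) (x y : 'rV[R]_n) (eps : R).
Local Notation W := (riesz_kernel s).
Local Notation lam := (@lebesgue_row R n).

Let sym_diff_lin u w (a c : R) x y :
  sym_diff (fun z => a * u z + c * w z) x y * W y =
  a * (sym_diff u x y * W y) + c * (sym_diff w x y * W y).
Proof. by rewrite /sym_diff; ring. Qed.

Lemma sym_integrable_lin u w (a c : R) x :
  sym_integrable s u x -> sym_integrable s w x ->
  sym_integrable s (fun z => a * u z + c * w z) x.
Proof.
move=> [mu Iu Du] [mw Iw Dw]; split.
- by apply: measurable_funD; exact: measurable_funM.
- move=> eps e0; have mb := measurable_setC_eball x eps.
  have := integrableD mb (integrableZl mb a (Iu _ e0)) (integrableZl mb c (Iw _ e0)).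
  apply: eq_integrable => // z _ /=; rewrite -EFinM -EFinM -EFinD; congr EFin.
  by rewrite /fraclap_integrand; ring.
- have := integrableD measurableT (integrableZl measurableT a Du) (integrableZl measurableT c Dw).
  by apply: eq_integrable => // z _ /=; rewrite sym_diff_lin.
Qed.

Lemma sym_fraclap_lin u w (a c : R) x :
  sym_integrable s u x -> sym_integrable s w x ->
  sym_fraclap s (fun z => a * u z + c * w z) x = a * sym_fraclap s u x + c * sym_fraclap s w x.
Proof.
move=> [mu Iu Du] [mw Iw Dw]; rewrite /sym_fraclap.
under eq_Rintegral do rewrite sym_diff_lin.
have I1 := integrableZl measurableT a Du; have I2 := integrableZl measurableT c Dw.
rewrite RintegralD// !RintegralZl//; ring.
Qed.

Lemma fraclap_const_gt0 : 0 < fraclap_const (n := n) s.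
Proof.
rewrite /fraclap_const divr_gt0 ?Gamma_fun_gt0 ?subr_gt0// mulr_gt0//; last first.
  by rewrite Gamma_fun_gt0// divr_gt0// addr_gt0 ?ltr0n ?mulr_gt0.
by rewrite !mulr_gt0 ?powR_gt0 ?pi_gt0.
Qed.

(** Comparison at a touching point: only the values at [x + y] and [x - y] differ, and they enter
    with a minus sign. *)
Lemma le_sym_fraclap u w x :
  sym_integrable s u x -> sym_integrable s w x ->
  u x = w x -> (forall z, u z <= w z) -> sym_fraclap s w x <= sym_fraclap s u x.
Proof.
move=> [mu Iu Du] [mw Iw Dw] xE le; rewrite /sym_fraclap.
rewrite ler_wpM2l ?(ltW fraclap_const_gt0)// ler_wpM2l//.
apply: le_Rintegral => // y _; rewrite ler_wpM2r ?riesz_kernel_ge0// /sym_diff xE.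
by have := le (x + y); have := le (x - y); lra.
Qed.

Lemma norm_le_add (a c d : R) : a <= c -> c <= d -> `|c| <= `|d| + `|a|.
Proof.
move=> ac cd; rewrite ler_norml; apply/andP; split.
  by have := ler_norm (- a); rewrite normrN; have := normr_ge0 d; lra.
by have := ler_norm d; have := normr_ge0 a; lra.
Qed.

Lemma sym_integrable_sandwich u v w x :
  sym_integrable s u x -> sym_integrable s w x -> measurable_fun setT v ->
  u x = v x -> w x = v x -> (forall z, u z <= v z <= w z) -> sym_integrable s v x.
Proof.
move=> [mu Iu Du] [mw Iw Dw] mv uE wE le; split => //.
- move=> eps e0; have mb := measurable_setC_eball x eps.
  have := integrableD mb (integrable_abse (Iu _ e0)) (integrable_abse (Iw _ e0)).
  apply: le_integrable => //.
    by apply: measurable_funTS; apply/measurable_EFinP; exact: measurable_fraclap_integrand.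
  move=> z _ /=; rewrite lee_fin [leRHS]ger0_norm ?addr_ge0//.
  rewrite /fraclap_integrand !riesz_kernelV uE wE !normrM -mulrDl ler_wpM2r//.
  have /andP[l1 l2] := le z.
  by apply: norm_le_add; rewrite lerD2l lerN2.
- have := integrableD measurableT (integrable_abse Du) (integrable_abse Dw).
  apply: le_integrable => //.
    apply/measurable_EFinP; rewrite /sym_diff /riesz_kernel.
    by measfun; apply: (measurableT_comp mv); measfun.
  move=> y _ /=; rewrite lee_fin [leRHS]ger0_norm ?addr_ge0//.
  rewrite !normrM -mulrDl ler_wpM2r// /sym_diff uE wE.
  have /andP[l1 l2] := le (x + y); have /andP[l3 l4] := le (x - y).
  by apply: norm_le_add; lra.
Qed.

End sym_linear.

(** * Power times logarithm *)

Section log.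
Context {R : realType} {n : nat}.
Variable s : R.
Hypotheses (n0 : (0 < n)%N) (s0 : 0 < s) (s1 : s < 1).
Local Notation m := (n%:R / 2 : R).
Local Notation symb := (fraclap_symbol (n := n) s).

(** With [r = |x|], the function [v] is [-(|z|/r)^(-2b) ln(|z|/r)], half the derivative in [b] of
    [psi b z = (|z|/r)^(-2b)]. Convexity in the exponent gives [2 h v <= psi (b+h) - psi b], with
    equality at [x]. Opposite signs of [h] enclose [v], hence integrability, and comparison at [x]
    gives the inequality for [l], the fractional Laplacian of [v]. *)
Lemma sym_powR_log b (x : 'rV[R]_n) : x != 0 -> 0 < b -> b < m ->
  sym_integrable s (fun z => - (enorm z `^ (- 2 * b) * ln (enorm z))) x /\
  exists2 l : R,
    sym_fraclap s (fun z => - (enorm z `^ (- 2 * b) * ln (enorm z))) x =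
    enorm x `^ (- 2 * b) * l - ln (enorm x) * (symb b * enorm x `^ (- 2 * b - 2 * s)) &
    forall h, - b < h -> h < m - b ->
      (symb (b + h) - symb b) * enorm x `^ (- 2 * s) <= 2 * h * l.
Proof.
move=> x0 b0 bm; set r := enorm x.
have r0 : 0 < r by rewrite enorm_gt0.
have sb : - s < b by apply: lt_trans b0; rewrite oppr_lt0.
pose psi c z := r `^ (2 * c) * enorm (z : 'rV[R]_n) `^ (- 2 * c).
pose v z := r `^ (2 * b) * - (enorm (z : 'rV[R]_n) `^ (- 2 * b) * ln (enorm z))
   + (r `^ (2 * b) * ln r) * enorm z `^ (- 2 * b).
have psix c : psi c x = 1 by rewrite /psi -powR_addr// mulNr subrr powRr0.
have vx : v x = 0 by rewrite /v -/r; ring.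
have mv : measurable_fun setT v by rewrite /v; measfun.
have Ipsi c : - s < c -> c < m -> sym_integrable s (psi c) x /\
    sym_fraclap s (psi c) x = symb c * r `^ (- 2 * s).
  move=> sc cm; have [I E] := sym_powR n0 s0 s1 x0 sc cm.
  have -> : psi c = fun z => r `^ (2 * c) * enorm z `^ (- 2 * c) + 0 * enorm z `^ (- 2 * c).
    by apply/funext => z; rewrite mul0r addr0.
  split; first exact: sym_integrable_lin.
  rewrite sym_fraclap_lin// E mul0r addr0 mulrCA -powR_addr//; congr (_ * _ `^ _); ring.
have conv h z : - b < h -> 2 * h * v z <= psi (b + h) z - psi b z.
  move=> bh.
  (* At the origin everything is [0], because [powR] vanishes there for the nonzero exponents [-2b]
     and [-2(b+h)]. *)
  have [->|z0] := eqVneq z 0.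
    have e0 : enorm (0 : 'rV[R]_n) = 0 by apply/eqP; rewrite enorm_eq0.
    have N2 c : 0 < c -> - 2 * c != 0 by move=> c0; rewrite mulNr oppr_eq0 mulf_neq0 ?gt_eqF.
    rewrite /v /psi e0 !powR0 ?N2//; last by rewrite -ltrBlDl sub0r.
    by rewrite !mul0r oppr0 !mulr0 subrr addr0 mulr0.
  have ez : 0 < enorm z by rewrite enorm_gt0.
  pose L := ln (enorm z) - ln r.
  have psiE c : psi c z = expR (- 2 * c * L).
    by rewrite /psi !powR_expR// -expRD; congr expR; rewrite /L; ring.
  have vE : v z = - (psi b z * L) by rewrite /v /psi /L; ring.
  rewrite vE !psiE (_ : - 2 * (b + h) * L = - 2 * b * L + - 2 * h * L); last by ring.
  rewrite expRD; have := expR_ge1Dx (- 2 * h * L); have := expR_gt0 (- 2 * b * L).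
  set X := expR (- 2 * b * L); set Y := expR (- 2 * h * L); move: X Y => X Y X0 Y1.
  have : X * (1 + - 2 * h * L) <= X * Y by rewrite ler_pM2l.
  lra.
(* A step for which both [b - h0] and [b + h0] stay in [(0, m)]. *)
pose h0 := Num.min (b / 2) ((m - b) / 2).
have h00 : 0 < h0 by rewrite lt_min !divr_gt0// subr_gt0.
have h0b : h0 < b.
  have : h0 <= b / 2 by rewrite ge_min lexx.
  lra.
have h0m : b + h0 < m.
  have : h0 <= (m - b) / 2 by rewrite ge_min lexx orbT.
  move: (m) bm => mm bm; lra.
have [I0 E0] := Ipsi _ sb bm.
have [Ip Ep] : sym_integrable s (psi (b + h0)) x /\
    sym_fraclap s (psi (b + h0)) x = symb (b + h0) * r `^ (- 2 * s).
  by apply: Ipsi => //; apply: lt_trans sb _; rewrite ltrDl.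
have [Im Em] : sym_integrable s (psi (b - h0)) x /\
    sym_fraclap s (psi (b - h0)) x = symb (b - h0) * r `^ (- 2 * s).
  apply: Ipsi; last by apply: lt_trans bm; rewrite ltrBlDr ltrDl.
  by apply: (@lt_trans _ _ 0); rewrite ?oppr_lt0 ?subr_gt0.
pose k := (2 * h0)^-1.
have k0 : 0 < k by rewrite invr_gt0 mulr_gt0.
have kh : k * (2 * h0) = 1 by rewrite mulVf// mulf_neq0// gt_eqF.
clearbody psi k.
have Iv : sym_integrable s v x.
  apply: (@sym_integrable_sandwich _ _ s (fun z => k * psi b z + (- k) * psi (b - h0) z) v
    (fun z => k * psi (b + h0) z + (- k) * psi b z)) => //.
  - exact: sym_integrable_lin.
  - exact: sym_integrable_lin.
  - by rewrite !psix vx; ring.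
  - by rewrite !psix vx; ring.
  - move=> z; apply/andP; split.
      have hb : - b < - h0 by rewrite ltrN2.
      have := conv _ z hb; rewrite -(ler_pM2l k0).
      have -> : k * (2 * - h0 * v z) = - ((k * (2 * h0)) * v z) by ring.
      rewrite kh mul1r; move: (psi _ z) (psi _ z) (v z) => p1 p2 p3; clear; lra.
    have hb : - b < h0 by apply: lt_trans h00; rewrite oppr_lt0.
    have := conv _ z hb; rewrite -(ler_pM2l k0) mulrA kh mul1r.
    by move: (psi _ z) (psi _ z) (v z) => p1 p2 p3; clear; lra.
set u := fun z : 'rV[R]_n => - (enorm z `^ (- 2 * b) * ln (enorm z)).
have uE : u = fun z => r `^ (- 2 * b) * v z + (- ln r) * enorm z `^ (- 2 * b).
  apply/funext => z; rewrite /u /v.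
  have E : r `^ (- 2 * b) * r `^ (2 * b) = 1 by rewrite -powR_addr// mulNr addNr powRr0.
  set p := enorm z `^ _; set p1 := r `^ (2 * b) in E *; set p2 := r `^ (- 2 * b) in E *.
  transitivity ((p2 * p1) * (- (p * ln (enorm z)) + ln r * p) + - ln r * p).
    by rewrite E; ring.
  by move: p1 p2 p (ln _) (ln _) {E}; clear => p1 p2 p l1 l2; ring.
have [Ib Eb] := sym_powR n0 s0 s1 x0 sb bm.
split; first by rewrite uE; exact: sym_integrable_lin.
exists (sym_fraclap s v x).
  by rewrite uE sym_fraclap_lin// Eb -/r; ring.
clearbody v; clear u uE.
move=> h hb hm.
have [Ih Eh] : sym_integrable s (psi (b + h)) x /\
    sym_fraclap s (psi (b + h)) x = symb (b + h) * r `^ (- 2 * s).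
  apply: Ipsi; last by rewrite -ltrBrDl.
  by apply: (@lt_trans _ _ 0); rewrite ?oppr_lt0// -ltrBlDl sub0r.
rewrite mulrBl -Eh -E0.
have := @le_sym_fraclap _ _ s n0 s0 s1 (fun z => (2 * h) * v z + 0 * v z)
  (fun z => 1 * psi (b + h) z + (-1) * psi b z) x.
rewrite !sym_fraclap_lin// => H.
apply: (@le_trans _ _ (1 * sym_fraclap s (psi (b + h)) x + -1 * sym_fraclap s (psi b) x)); first by rewrite mul1r mulN1r.
rewrite -[leRHS]addr0 -[X in _ <= _ + X](mul0r (sym_fraclap s v x)).
apply: H.
- exact: sym_integrable_lin.
- exact: sym_integrable_lin.
- by rewrite vx !psix; ring.
- by move=> z; rewrite mul0r addr0 mul1r mulN1r; exact: conv.
Qed.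

End log.

(** * The symbol *)

(** For [y > 0], [xy - x'y'] is [x(y-y') - (x'-x)y], which is nonnegative, plus [(x'-x)(y-y')]. The
    factor [y] stands for [G(M-b)], negative for [b > M], whence the separate case. *)
Lemma mul_lt_of_increments (R : realDomainType) (x x' y y' : R) :
  x' - x <= y - y' -> y' < y -> x <= x' -> 0 < x -> y <= x -> x' * y' < x * y.
Proof.
move=> al be al0 x0 yx.
have [y0|y0] := leP y 0.
  have h1 : x' * y' <= x * y' by rewrite ler_wnM2r// (le_trans (ltW be)).
  by apply: (le_lt_trans h1); rewrite ltr_pM2l.
have h : (x' - x) * y <= (y - y') * x by apply: ler_pM => //; rewrite ?subr_ge0 ?(ltW y0).
have [e|ne] := eqVneq x' x; first by rewrite e ltr_pM2l.
have : 0 < (x' - x) * (y - y') by rewrite mulr_gt0 ?subr_gt0// lt_neqAle eq_sym ne.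
lra.
Qed.

Section symbol.
Context {R : realType}.
Variables (n : nat) (s : R).
Hypotheses (n2 : (2 <= n)%N) (s0 : 0 < s) (s1 : s < 1).
Local Notation mu := (@lebesgue_measure R).
Implicit Types (b p h : R).
Local Notation symb := (fraclap_symbol (n := n) s).
Local Notation G := (Gfun s).

Let m : R := n%:R / 2.
Let M : R := m - s.
Let c : R := M / 2.

Let M0 : 0 < M.
Proof.
rewrite subr_gt0 (lt_le_trans s1)// /m ler_pdivlMr// mul1r.
by rewrite ler_nat.
Qed.

Let c0 : 0 < c. Proof. by rewrite divr_gt0. Qed.
Let cM : M - c = c. Proof. by rewrite /c; field. Qed.
Let Mm : m = M + s. Proof. by rewrite /M; ring. Qed.
Let cm : c < m.
Proof. by rewrite Mm (lt_trans (_ : _ < M)) ?ltrDl// /c ltr_pdivrMr// ltr_pMr// ltr1n. Qed.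

Lemma fraclap_symbol_sym b : symb (M - b) = symb b.
Proof.
rewrite /fraclap_symbol -/m mulrC [RHS]mulrC; congr (_ * _).
by rewrite mulrC; congr (Gfun s _ * _); rewrite /M; ring.
Qed.

(** To the right of the center [M - b <= b], so by concavity [G(M-b)] loses at least as much as
    [G(b)] gains. *)
Lemma fraclap_symbol_decreasing b b' : c <= b -> b < b' -> b' < m -> symb b' < symb b.
Proof.
move=> cb bb' b'm.
have b0 : 0 < b by exact: lt_le_trans cb.
have sb : - s < b by apply: lt_trans b0; rewrite oppr_lt0.
pose d := b' - b.
have d0 : 0 < d by rewrite subr_gt0.
have pd : - s < M - b - d by rewrite /d -subr_gt0 (_ : _ - _ = m - b') ?subr_gt0// Mm; ring.
have sp : - s < M - b by apply: lt_trans pd _; rewrite ltrBlDr ltrDl.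
have pb : M - b <= b by rewrite lerBlDr (_ : M = c + c) ?lerD// /c; field.
have al := Gfun_increment s0 s1 pd pb (ltW d0).
have be : G (M - b - d) < G (M - b) by apply: Gfun_increasing => //; rewrite ltrBlDr ltrDl.
have al0 : G b <= G (b + d) by apply: Gfun_nondecreasing => //; rewrite lerDl ltW.
have x0 := Gfun_gt0 s0 s1 b0.
have yx : G (M - b) <= G b by exact: Gfun_nondecreasing.
rewrite /fraclap_symbol -/m -/M ltr_pM2l//.
have -> : b' = b + d by rewrite /d; ring.
rewrite (_ : m - s - (b + d) = M - b - d); last by rewrite /M; ring.
move: (G b) (G (b + d)) (G (M - b)) (G (M - b - d)) al be al0 x0 yx.
move=> x x' y y' al be al0 x0 yx; exact: mul_lt_of_increments.
Qed.

Lemma fraclap_symbol_center : symb c = - hardy_mu0 n s.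
Proof.
rewrite /fraclap_symbol /hardy_mu0 opprK -/m -/M cM; congr (_ * _).
rewrite Gfun.unlock (rgammaE c0).
have -> : c = (n%:R - 2 * s) / 4 by rewrite /c /M /m; field.
have -> : s + (n%:R - 2 * s) / 4 = (n%:R + 2 * s) / 4 by field.
by rewrite -expr2 exprMn exprVn mulrC.
Qed.

Lemma fraclap_symbol_zero : symb M = 0.
Proof. by rewrite /fraclap_symbol -/m -/M subrr Gfun0 !mulr0. Qed.

Lemma Gfun_continuous p : - s < p -> {for p, continuous G}.
Proof.
move=> sp.
(* Leaves room for a chord over [[q-h, q]] inside the domain and to the left of a neighborhood of
   [p]; its slope is the Lipschitz constant. *)
pose h := (p + s) / 4.
have h0 : 0 < h by rewrite divr_gt0// -ltrBlDr sub0r.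
pose q := p - h.
have sq : - s < q - h by rewrite /q /h; lra.
have s' : - s < q by apply: lt_trans sq _; rewrite ltrBlDr ltrDl.
pose K := (G q - G (q - h)) / h.
have K0 : 0 <= K.
  by rewrite divr_ge0 ?(ltW h0)// subr_ge0 Gfun_nondecreasing// lerBlDr lerDl ltW.
have lip a d : q <= a -> a <= d -> `|G a - G d| <= K * `|a - d|.
  move=> qa ad; rewrite distrC [X in _ <= _ * X]distrC !ger0_norm ?subr_ge0//; last first.
    by apply: Gfun_nondecreasing => //; exact: lt_le_trans qa.
  apply: le_trans (Gfun_lipschitz s0 s1 sq h0 qa ad) _.
  by rewrite /K (_ : _ / h * _ = (G q - G (q - h)) / h * (d - a))//; ring.
apply/cvgrPdist_le => e e0; near=> z.
have zq : q <= z.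
  apply: ltW; near: z; apply: lt_nbhsr.
  by rewrite /q ltrBlDr ltrDl.
have : `|G p - G z| <= K * `|p - z|.
  have qp : q <= p by rewrite /q lerBlDr lerDl ltW.
  have [pz|zp] := leP p z; first exact: lip.
  by rewrite distrC [X in _ <= _ * X]distrC; apply: lip => //; exact: ltW.
move=> /le_trans; apply.
have : `|p - z| <= e / (K + 1).
  near: z; apply: cvgr_dist_le; first exact: cvg_id.
  by rewrite divr_gt0// ltr_wpDl.
move=> /(ler_wpM2l K0) /le_trans; apply.
rewrite mulrA ler_pdivrMr ?ltr_wpDl// mulrC ler_pM2l// lerDl//.
Unshelve. all: by end_near. Qed.

Lemma fraclap_symbol_continuous b : - s < b -> b < m -> {for b, continuous symb}.
Proof.
move=> sb bm; rewrite /fraclap_symbol -/m.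
apply: cvgM; first exact: cvg_cst.
apply: cvgM; first exact: Gfun_continuous.
have sp : - s < m - s - b by rewrite -subr_gt0 (_ : _ - _ = m - b) ?subr_gt0//; ring.
have cf : {for b, continuous (fun z => m - s - z)}.
  by apply: cvgB; [exact: cvg_cst|exact: cvg_id].
exact: (@continuous_comp _ _ _ (fun z => m - s - z) G b cf (Gfun_continuous sp)).
Qed.

(** Because [t^(q-1) <= t^(-s) + 1]: the first term dominates for [t <= 1], the second for
    [t > 1]. *)
Lemma Gamma_fun_le (q : R) : 1 - s <= q -> q <= 1 -> Gamma_fun q <= Gamma_fun (1 - s) + 1.
Proof.
move=> sq q1.
have s10 : 0 < 1 - s by rewrite subr_gt0.
have q0 : 0 < q by exact: lt_le_trans sq.
rewrite -lee_fin EFinD -!gammaE//.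
have E1 : (1%:E = \int[mu]_(t in halfline) (1 * expR (- 1 * t))%:E)%E.
  by rewrite ge0_integral_scalel// ?integral_expR0y//; [rewrite invr1 mule1|measfun].
rewrite E1 -ge0_integralD//; try side.
apply: ge0_le_integral => //; try side.
  by apply: emeasurable_funD; measfun.
move=> t /in_halfline t0; rewrite -EFinD lee_fin mulN1r -mulrDl.
rewrite ler_wpM2r ?expR_ge0//.
have [t1|t1] := leP t 1.
  apply: (@le_trans _ _ (t `^ (1 - s - 1))); last by rewrite lerDl.
  by apply: ger_powR; [rewrite t0|rewrite lerD2r].
apply: (@le_trans _ _ 1); last by rewrite lerDr powR_ge0.
rewrite -[leRHS](powRr0 t); apply: ler_powR; first exact: ltW.
by rewrite subr_le0.
Qed.

(** As [b] tends to [m], [p = M - b] tends to [-s]: [rgamma p] stays below a negative constant while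
    [Gamma(s+p)] grows like [1/(s+p)]. *)
Lemma fraclap_symbol_unbounded (A : R) : exists2 b, c <= b & b < m /\ symb b <= A.
Proof.
pose K := Gamma_fun (1 - s) + 1.
have K0 : 0 < K by rewrite addr_gt0// Gamma_fun_gt0// subr_gt0.
have Gc : 0 < G c by exact: Gfun_gt0.
pose k := 2 `^ (2 * s) * G c * (s / 2 / K * expR (- 1)).
have k0 : 0 < k by rewrite !mulr_gt0 ?invr_gt0 ?expR_gt0.
(* The first bound keeps [p = e - s] below [-s/2]; the second gives [k / e >= |A| + 1]. *)
pose e := Num.min (s / 2) (k / (`|A| + 1)).
have A1 : 0 < `|A| + 1 by rewrite ltr_wpDl.
have e0 : 0 < e by rewrite lt_min !divr_gt0.
have es : e <= s / 2 by rewrite ge_min lexx.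
have eA : e <= k / (`|A| + 1) by rewrite ge_min lexx orbT.
pose p := e - s.
have pn : p <= - (s / 2) by rewrite /p; lra.
have sp : s + p = e by rewrite /p; ring.
have mp : M - (m - e) = p by rewrite /M /p; ring.
have cb : c <= m - e.
  rewrite -subr_ge0 (_ : m - e - c = c + (s - e)); last by rewrite /c /M; field.
  by rewrite addr_ge0 ?(ltW c0)// subr_ge0 (le_trans es)// ler_pdivrMr// ler_pMr// ler1n.
exists (m - e) => //; split; first by rewrite ltrBlDr ltrDl.
rewrite /fraclap_symbol -/m -/M mp.
have Gp : G p <= - (s / 2 / K * expR (- 1) / e).
  rewrite Gfun.unlock sp /rgamma.
  have p1 : 0 < p + 1 by rewrite /p; move: (s1) e0; lra.
  have Gp1 := Gamma_fun_gt0 p1.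
  have GK : Gamma_fun (p + 1) <= K by apply: Gamma_fun_le; rewrite /p; move: (s0) (s1) e0 es; lra.
  have Ge := Gamma_fun_ge e0.
  have h1 : p / Gamma_fun (p + 1) <= - (s / 2 / K).
    rewrite -mulNr; apply: (@le_trans _ _ (- (s / 2) / Gamma_fun (p + 1))).
      by rewrite ler_pM2r ?invr_gt0.
    by rewrite !mulNr lerN2 ler_pM2l ?divr_gt0// lef_pV2.
  apply: (@le_trans _ _ (- (s / 2 / K) * Gamma_fun e)).
    exact: (ler_wpM2r (ltW (Gamma_fun_gt0 e0)) h1).
  rewrite (_ : s / 2 / K * expR (- 1) / e = (s / 2 / K) * (expR (- 1) / e)); last by rewrite !mulrA.
  by rewrite -[leRHS]mulNr ler_nM2l ?oppr_lt0 ?divr_gt0.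
have Gpn : G p <= 0.
  by apply: le_trans Gp _; rewrite oppr_le0 !mulr_ge0 ?invr_ge0 ?expR_ge0 ?ltW.
have Gmc : G c <= G (m - e).
  by apply: Gfun_nondecreasing => //; apply: lt_trans c0; rewrite oppr_lt0.
apply: (@le_trans _ _ (2 `^ (2 * s) * (G c * G p))).
  by rewrite ler_pM2l// ler_wnM2r.
apply: (@le_trans _ _ (- (k / e))).
  rewrite (_ : - (k / e) = 2 `^ (2 * s) * (G c * - (s / 2 / K * expR (- 1) / e))).
    by rewrite ler_pM2l// ler_pM2l.
  by rewrite /k; move: (2 `^ _) (G c) (expR _) (s / 2 / K) => z1 z2 z3 z4; ring.
rewrite lerNl; apply: (@le_trans _ _ (`|A| + 1)).
  by apply: le_trans (ler_norm _) _; rewrite normrN lerDl.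
by rewrite ler_pdivlMr// mulrC -ler_pdivlMr.
Qed.

(** Symmetry lets the inequality be used at [h] and [-h], so [2 h |l| <= (symb c - symb (c+h)) B].
    Along [h = h0/2^k] the right side is at most of order [4^(-k)], so [2^k |l|] stays bounded. *)
Lemma fraclap_symbol_center_slope (l B : R) : 0 < B ->
  (forall h, - c < h -> h < m - c -> (symb (c + h) - symb c) * B <= 2 * h * l) -> l = 0.
Proof.
move=> B0 H.
pose h0 := c / 2.
have h00 : 0 < h0 by rewrite divr_gt0.
pose hk k : R := h0 / 2 ^+ k.
pose K := (G h0 - G 0) / h0.
pose S0 := Gfun_diff2 s c h0.
pose C := 2 `^ (2 * s) * (G c * S0 + (K * h0) ^+ 2).
have p2 k : 0 < 2 ^+ k :> R by rewrite exprn_gt0.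
have hk0 k : 0 < hk k by rewrite divr_gt0.
have hkh k : hk k <= h0 by rewrite ler_pdivrMr// ler_pMr// exprn_ege1// ler1n.
have hc : h0 < c by rewrite ltr_pdivrMr// ltr_pMr// ltr1n.
have S k : Gfun_diff2 s c (hk k) <= S0 / 4 ^+ k.
  elim: k => [|k IH]; first by rewrite /hk expr0 !divr1.
  have -> : hk k.+1 = hk k / 2 by rewrite /hk exprSr invfM mulrA.
  apply: (@le_trans _ _ (Gfun_diff2 s c (hk k) / 4)).
    apply: Gfun_diff2_half => //; last exact: ltW.
    rewrite (lt_trans (_ : _ < 0)) ?oppr_lt0// subr_gt0.
    exact: le_lt_trans hc.
  by rewrite exprSr invfM mulrA ler_pM2r.
(* With [g = G(c)] and [g'], [g''] the values at [c + hk k] and [c - hk k], one has [g^2 - g' g'' =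
   g (2g - g' - g'') + (g' - g)(g - g'')]: a second difference, bounded by [S], and a product of two
   increments, each at most [K h0 / 2^k]. *)
have D k : symb c - symb (c + hk k) <= C / 4 ^+ k.
  have ck : 0 <= c - hk k - h0.
    by have := hkh k; rewrite /h0; lra.
  rewrite /fraclap_symbol -/m -/M cM (_ : m - s - (c + hk k) = c - hk k); last first.
    by rewrite -[X in _ = X - _]cM /M; ring.
  have x0 := Gfun_gt0 s0 s1 c0.
  have sc : - s < c - hk k by rewrite (lt_le_trans (_ : _ < 0)) ?oppr_lt0// subr_ge0 (le_trans (hkh k))// ltW.
  have al := Gfun_increment s0 s1 sc (lexx c) (ltW (hk0 k)).
  have al0 : G c <= G (c + hk k).
    by apply: Gfun_nondecreasing => //; rewrite ?lerDl ?(ltW (hk0 k))// (lt_trans (_ : _ < 0)) ?oppr_lt0.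
  have be : G c - G (c - hk k) <= K * h0 / 2 ^+ k.
    have e1 : - s < h0 - h0 by rewrite subrr oppr_lt0.
    have e2 : h0 <= c - hk k by rewrite -subr_ge0.
    have e3 : c - hk k <= c by rewrite lerBlDr lerDl ltW.
    have := Gfun_lipschitz s0 s1 e1 h00 e2 e3; rewrite subrr subKr.
    by rewrite /K /hk; move=> /le_trans; apply; rewrite le_eqVlt; apply/orP; left; apply/eqP; field; rewrite gt_eqF//= gt_eqF.
  rewrite -mulrBr /C -mulrA ler_pM2l//.
  have Sk : G c * Gfun_diff2 s c (hk k) <= G c * (S0 / 4 ^+ k) by rewrite ler_pM2l.
  have E4 : (K * h0) ^+ 2 / 4 ^+ k = (K * h0 / 2 ^+ k) * (K * h0 / 2 ^+ k).
    have -> : (4 : R) ^+ k = 2 ^+ k * 2 ^+ k by rewrite -exprMn -natrM.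
    by move: (2 ^+ k) (p2 k) => z z0; field; rewrite gt_eqF.
  have bb : (G (c + hk k) - G c) * (G c - G (c - hk k)) <= (K * h0) ^+ 2 / 4 ^+ k.
    rewrite E4; apply: ler_pM => //; rewrite ?subr_ge0//.
      by apply: Gfun_nondecreasing => //; rewrite lerBlDr lerDl ltW.
    exact: le_trans be.
  have -> : (G c * S0 + (K * h0) ^+ 2) / 4 ^+ k = G c * (S0 / 4 ^+ k) + (K * h0) ^+ 2 / 4 ^+ k.
    by rewrite mulrDl mulrA.
  apply: le_trans (lerD Sk bb).
  rewrite /Gfun_diff2; move: (G c) (G (c + hk k)) (G (c - hk k)) => g1 g2 g3.
  by rewrite le_eqVlt; apply/orP; left; apply/eqP; ring.
apply/eqP; apply: contraT => l0.
have l0' : 0 < `|l| by rewrite normr_gt0.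
have Hk k : 2 * hk k * `|l| <= C / 4 ^+ k * B.
  have hm : hk k < m - c.
    apply: (le_lt_trans (hkh k)); apply: (lt_trans hc).
    by rewrite -[X in X < _]cM ltrD2r Mm ltrDl.
  have hc' : - c < hk k by apply: lt_trans (hk0 k); rewrite oppr_lt0.
  have hm' : - hk k < m - c by apply: lt_trans hm; rewrite gtrN.
  have hc'' : - c < - hk k by rewrite ltrN2 (le_lt_trans (hkh k)).
  have H1 := H _ hc' hm; have := H _ hc'' hm'.
  have -> : symb (c + - hk k) = symb (c + hk k).
    by rewrite -[LHS]fraclap_symbol_sym; congr fraclap_symbol; rewrite opprD opprK addrA cM.
  move=> H2; have DB := ler_wpM2r (ltW B0) (D k).
  rewrite -[hk k]gtr0_norm// -{1}(@gtr0_norm _ (2 : R))// -!normrM.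
  rewrite ler_norml; apply/andP; split.
    move: H1 H2 DB; move: (hk k) (symb c) (symb (c + hk k)) => z1 z2 z3; lra.
  move: H1 H2 DB; move: (hk k) (symb c) (symb (c + hk k)) => z1 z2 z3; lra.
have Bk k : h0 * `|l| * 2 * 2 ^+ k <= C * B.
  have := Hk k; rewrite /hk.
  have -> : (4 : R) ^+ k = 2 ^+ k * 2 ^+ k by rewrite -exprMn -natrM.
  rewrite -(ler_pM2r (mulr_gt0 (p2 k) (p2 k))).
  move: (2 ^+ k) (p2 k) (`|l|) => z z0 al; have zn : z != 0 by rewrite gt_eqF.
  rewrite (_ : 2 * (h0 / z) * al * (z * z) = h0 * al * 2 * z); last by field.
  by rewrite (_ : C / (z * z) * B * (z * z) = C * B); last by field.
have q0 : 0 < h0 * `|l| * 2 by rewrite !mulr_gt0.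
pose k := Num.truncn (C * B / (h0 * `|l| * 2)).
have kk : C * B / (h0 * `|l| * 2) < k.+1%:R by exact: truncnS_gt.
have : k.+1%:R <= 2 ^+ k.+1 :> R by rewrite -natrX ler_nat ltnW// ltn_expl.
have := Bk k.+1; rewrite mulrC -ler_pdivlMr// => h1 h2.
by have := lt_le_trans kk (le_trans h2 h1); rewrite ltxx.
Qed.

End symbol.

(** * Smoothness *)

Section smooth.
Context {R : realType} {n : nat}.
Variable D : set 'rV[R]_n.
Hypothesis oD : open D.
Implicit Types (f g : 'rV[R]_n -> R) (x v : 'rV[R]_n).

Lemma near_open_eq f g x : D x -> (forall z, D z -> f z = g z) -> \near x, f x = g x.
Proof.
move=> Dx fg; have := open_nbhs_nbhs (conj oD Dx).
by apply: filterS => z /fg.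
Qed.

Lemma continuous_open_eq f g x : D x -> (forall z, D z -> f z = g z) ->
  {for x, continuous f} -> {for x, continuous g}.
Proof.
move=> Dx fg cf; rewrite /prop_for /continuous_at -(fg x Dx).
have E : \forall z \near nbhs x, f z = g z by exact: near_open_eq.
exact: cvg_trans (@near_eq_cvg _ _ (nbhs x) _ f g E) cf.
Qed.

(** Openness of [D] makes derivatives at its points blind to values elsewhere, so formulas for
    derivatives need only hold on [D]. *)
Lemma Ck_ext k f g : (forall z, D z -> f z = g z) -> Ck k D f -> Ck k D g.
Proof.
elim: k f g => [|k IH] f g fg [cf df]; split => //;
  try by move=> x Dx; exact: continuous_open_eq (cf _ Dx).
move=> i; have [d C] := df i; split.
  move=> x Dx; have nfg := near_open_eq Dx fg.
  by apply: near_eq_derivable (d _ Dx).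
apply: IH C => x Dx; apply: near_eq_derive.
exact: near_open_eq.
Qed.

Lemma Ck_pred k f : Ck k.+1 D f -> Ck k D f.
Proof.
elim: k f => [|k IH] f [cf df]; split => //.
by move=> i; have [d C] := df i; split => //; exact: IH.
Qed.

Lemma Ck_cst k (c : R) : Ck k D (fun=> c).
Proof.
elim: k c => [|k IH] c; split => //; try by move=> x _; exact: cst_continuous.
move=> i; split; first by move=> x _; exact: derivable_cst.
rewrite (_ : 'D_(delta_mx ord0 i) (fun=> c) = fun=> 0); first exact: IH.
by apply/funext => x; rewrite derive_cst.
Qed.

Lemma Ck_add k f g : Ck k D f -> Ck k D g -> Ck k D (fun z => f z + g z).
Proof.
elim: k f g => [|k IH] f g [cf df] [cg dg]; split => //;
  try by move=> x Dx; exact: (continuousD (cf _ Dx) (cg _ Dx)).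
move=> i; have [df1 Cf] := df i; have [dg1 Cg] := dg i; split.
  by move=> x Dx; apply: derivableD; [exact: df1|exact: dg1].
apply: Ck_ext (IH _ _ Cf Cg) => x Dx.
by rewrite -deriveD//; [exact: df1|exact: dg1].
Qed.

Lemma Ck_mul k f g : Ck k D f -> Ck k D g -> Ck k D (fun z => f z * g z).
Proof.
elim: k f g => [|k IH] f g Hf Hg; have [cf df] := Hf; have [cg dg] := Hg; split => //;
  try by move=> x Dx; exact: (continuousM (cf _ Dx) (cg _ Dx)).
move=> i; have [df1 Cf] := df i; have [dg1 Cg] := dg i; split.
  by move=> x Dx; apply: derivableM; [exact: df1|exact: dg1].
apply: Ck_ext (Ck_add (IH _ _ (Ck_pred Hf) Cg) (IH _ _ (Ck_pred Hg) Cf)) => x Dx.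
exact/esym/(deriveM (df1 _ Dx) (dg1 _ Dx)).
Qed.

Lemma Ck_opp k f : Ck k D f -> Ck k D (fun z => - f z).
Proof.
move=> Cf; apply: Ck_ext (Ck_mul (Ck_cst k (-1)) Cf) => z _.
by rewrite mulN1r.
Qed.

Lemma is_derive_coord (i j : 'I_n) x :
  is_derive x (delta_mx ord0 i) (fun z : 'rV[R]_n => z ord0 j) ((i == j)%:R).
Proof.
have C : (fun h : R => h^-1 *: (((fun z : 'rV[R]_n => z ord0 j) \o shift x) (h *: delta_mx ord0 i) - x ord0 j))
    @ 0^' --> ((i == j)%:R : R).
  apply: cvg_near_cst; near=> h.
  have h0 : h != 0 by near: h; exact: nbhs_dnbhs_neq.
  by rewrite /= !mxE eqxx/= addrK eq_sym /GRing.scale/= mulrA mulVf// mul1r.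
split; last by apply: cvg_lim.
by apply/cvg_ex; exists (i == j)%:R.
Unshelve. all: by end_near. Qed.

Lemma Ck_coord k (j : 'I_n) : Ck k D (fun z => z ord0 j).
Proof.
case: k => [|k]; split => //; try by move=> x _; exact: coord_continuous.
move=> i; split; first by move=> x _; exact: (@ex_derive _ _ _ _ _ _ _ (is_derive_coord i j x)).
apply: Ck_ext (Ck_cst k ((i == j)%:R)) => x _.
by rewrite (@derive_val _ _ _ _ _ _ _ (is_derive_coord i j x)).
Qed.

(** Restricting to the line [r -> r v + x] reduces a directional derivative to the one-variable
    chain rule. *)
Lemma is_derive_comp1 f (h : R -> R) x v (df dh : R) :
  is_derive x v f df -> is_derive (f x) 1 h dh -> is_derive x v (h \o f) (dh * df).
Proof.
move=> Hf Hh.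
have lineE (u : 'rV[R]_n -> R) : (fun t : R => t^-1 *: ((u \o shift x) (t *: v) - u x)) =
    (fun t : R => t^-1 *: (((fun r : R => u (r *: v + x)) \o shift 0) (t *: 1) - u (0 *: v + x))).
  by apply/funext => t; rewrite /= scale0r add0r addr0 /GRing.scale/= mulr1.
have [df1 df2] := Hf; have [dh1 dh2] := Hh.
pose phi := fun r : R => f (r *: v + x).
have phi0 : phi 0 = f x by rewrite /phi scale0r add0r.
have dphi : derivable phi 0 1 by rewrite /derivable -lineE.
have dphiE : 'D_1 phi 0 = df by rewrite /derive -lineE.
rewrite -phi0 in dh1 dh2.
have dc : derivable (h \o phi) 0 1.
  apply/derivable1_diffP; apply: differentiable_comp; exact/derivable1_diffP.
split; first by rewrite /derivable lineE.
have E : 'D_v (h \o f) x = 'D_1 (h \o phi) 0 by rewrite [LHS]/derive lineE.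
rewrite E; transitivity (h^`()%classic (phi 0) * phi^`()%classic 0).
  by rewrite -(derive1_comp dphi dh1) derive1E.
by rewrite !derive1E dh2 dphiE.
Qed.

(** The induction runs over all exponents at once, since differentiation lowers [a] to [a - 1]. *)
Lemma Ck_powR k f (a : R) : (forall z, D z -> 0 < f z) -> Ck k D f ->
  Ck k D (fun z => f z `^ a).
Proof.
move=> f0; elim: k a f f0 => [|k IH] a f f0 Hf; have [cf df] := Hf; split => //;
  try by move=> x Dx; apply: (@continuous_comp _ _ _ f (@powR R ^~ a)); [exact: cf|exact/continuous_powR_gt0/f0].
move=> i; have [df1 Cf] := df i.
have I x : D x -> is_derive x (delta_mx ord0 i) (fun z => f z `^ a) (a * f x `^ (a - 1) * 'D_(delta_mx ord0 i) f x).
  move=> Dx; apply: (@is_derive_comp1 f (@powR R ^~ a)).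
    exact/derivableP/df1.
  exact: is_derive1_powR (f0 _ Dx).
split; first by move=> x Dx; have [] := I x Dx.
apply: Ck_ext (Ck_mul (Ck_mul (Ck_cst k a) (IH (a - 1) f f0 (Ck_pred Hf))) Cf) => x Dx.
by have [_ ->] := I x Dx.
Qed.

Lemma Ck_ln k f : (forall z, D z -> 0 < f z) -> Ck k D f -> Ck k D (fun z => ln (f z)).
Proof.
move=> f0; case: k => [|k] Hf; have [cf df] := Hf; split => //;
  try by move=> x Dx; apply: (@continuous_comp _ _ _ f (@ln R)); [exact: cf|exact/continuous_ln/f0].
move=> i; have [df1 Cf] := df i.
have I x : D x -> is_derive x (delta_mx ord0 i) (fun z => ln (f z)) ((f x)^-1 * 'D_(delta_mx ord0 i) f x).
  move=> Dx; apply: (@is_derive_comp1 f (@ln R)).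
    exact/derivableP/df1.
  exact: is_derive1_ln (f0 _ Dx).
split; first by move=> x Dx; have [] := I x Dx.
apply: Ck_ext (Ck_mul (Ck_powR (- 1) f0 (Ck_pred Hf)) Cf) => x Dx.
by have [_ ->] := I x Dx; rewrite powR_inv1// ltW// f0.
Qed.

End smooth.

Section smooth_enorm.
Context {R : realType} {n : nat}.
Local Notation D := ([set~ 0] : set 'rV[R]_n).

Lemma open_neq0 : open D.
Proof.
rewrite openC; apply: accessible_closed_set1; apply: hausdorff_accessible.
exact: norm_hausdorff.
Qed.

(** The squared norm is a polynomial in the coordinates; powers and logarithms of the norm are
    expressed through it. *)
Let sq : 'rV[R]_n -> R := fun z => \sum_i z ord0 i * z ord0 i.

Let sqE z : sq z = enorm z ^+ 2.
Proof. by rewrite sqr_enorm; apply: eq_bigr => i _; rewrite expr2. Qed.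

Let sq_gt0 z : D z -> 0 < sq z.
Proof. by move=> /eqP z0; rewrite sqE exprn_gt0// enorm_gt0. Qed.

Let Ck_sq k : Ck k D sq.
Proof.
rewrite /sq; elim: (index_enum _) => [|i l IH].
  by have := Ck_cst D k 0; apply: (Ck_ext open_neq0) => z _; rewrite big_nil.
have := Ck_add open_neq0 (Ck_mul open_neq0 (Ck_coord open_neq0 k i) (Ck_coord open_neq0 k i)) IH.
by apply: (Ck_ext open_neq0) => z _; rewrite big_cons.
Qed.

Let powE z (tau : R) : sq z `^ (tau / 2) = enorm z `^ tau.
Proof. by rewrite sqE -enorm_powR; congr (_ `^ _); field. Qed.

Lemma Cinfty_enorm_powR (tau : R) : Cinfty D (fun z => enorm z `^ tau).
Proof.
move=> k; have := Ck_powR open_neq0 (tau / 2) sq_gt0 (Ck_sq k).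
by apply: (Ck_ext open_neq0) => z _; rewrite powE.
Qed.

Lemma Cinfty_enorm_powR_ln (tau : R) :
  Cinfty D (fun z => - (enorm z `^ tau * ln (enorm z))).
Proof.
move=> k; have := Ck_opp open_neq0 (Ck_mul open_neq0 (Cinfty_enorm_powR tau k)
  (Ck_mul open_neq0 (Ck_cst D k 2^-1) (Ck_ln open_neq0 sq_gt0 (Ck_sq k)))).
apply: (Ck_ext open_neq0) => z z0.
have e0 : 0 < enorm z by rewrite enorm_gt0; exact/eqP.
have -> : ln (sq z) = 2 * ln (enorm z) by rewrite sqE lnXn// mulr_natl.
by move: (ln (enorm z)) (_ `^ _) => a p; field.
Qed.

End smooth_enorm.

(** * Membership in the weighted space *)

Section weighted.
Context {R : realType} {n : nat}.
Variable s : R.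
Hypotheses (n0 : (0 < n)%N) (s0 : 0 < s) (s1 : s < 1).
Implicit Types (u : 'rV[R]_n -> R) (x z : 'rV[R]_n).
Local Notation lam := (@lebesgue_row R n).
Local Notation W := (riesz_kernel s).

Lemma enorm_scale_delta (i : 'I_n) (r : R) : 0 <= r -> enorm (r *: delta_mx ord0 i : 'rV[R]_n) = r.
Proof.
move=> r0; rewrite /enorm (bigD1 i)//= big1 ?addr0.
  by rewrite !mxE !eqxx mulr1 sqrtr_sqr ger0_norm.
by move=> j ji; rewrite !mxE (negPf ji) andbF mulr0 expr0n.
Qed.

Lemma integrable_riesz_shift x eps : 0 < eps ->
  lam.-integrable (~` eball x eps) (fun z => (W (x - z))%:E).
Proof.
move=> e0; apply/(integrable_mkcond _ (measurable_setC_eball x eps)).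
have I := integrable_riesz_outball n0 s0 s1 e0.
have := (integrable_mkcond _ (measurable_outball eps)).1 I.
have c1 : `|1| = 1 :> R by rewrite normr1.
move=> /(integrable_row_affine (- x) c1); apply: (eq_integrable measurableT) => z _.
have E : enorm (z - x) = enorm (x - z) by rewrite -enormN opprB.
rewrite scale1r !patchE (_ : (z \in ~` eball x eps) = (z - x \in outball eps)); last first.
  by apply/idP/idP; rewrite !inE setC_eball /outball/= E.
case: (_ \in _); last reflexivity.
exact: (congr1 (fun t => (t `^ _)%:E) E).
Qed.

Let q : R := n%:R + 2 * s.
Let q0 : 0 < q. Proof. by rewrite addr_gt0 ?ltr0n// mulr_gt0. Qed.

Lemma weight_le_riesz x z : enorm x = 1 -> x != z ->
  (1 + enorm z `^ q)^-1 <= 2 `^ q * W (x - z).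
Proof.
move=> x1 xz; rewrite -riesz_kernelV -/q.
have p0 : 0 < enorm (x - z) by rewrite enorm_gt0 subr_eq0.
rewrite ler_pdivlMr ?powR_gt0// mulrC ler_pdivrMr; last by rewrite ltr_wpDr ?powR_ge0.
have e0 := enorm_ge0 z.
have h : enorm (x - z) <= 2 * Num.max 1 (enorm z).
  rewrite -ler_sqr ?nnegrE ?enorm_ge0 ?mulr_ge0 ?le_max ?ler01//.
  have H : enorm (x - z) ^+ 2 <= 2 * (1 + enorm z ^+ 2).
    have := sqr_enormD x z; have := sqr_enormB x z; rewrite x1.
    by move: (sqr_ge0 (enorm (x + z))) (dot x z) => /[swap] d; lra.
  by rewrite maxEge; case: ifP => h; nra.
apply: le_trans (ge0_ler_powR _ _ _ h) _; rewrite ?nnegrE ?(ltW q0) ?enorm_ge0//.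
  by rewrite mulr_ge0 ?le_max ?ler01.
rewrite powRM// ?le_max ?ler01// ler_pM2l ?powR_gt0// maxEge; case: ifP => _;
  first by rewrite powR1 lerDl powR_ge0.
by rewrite lerDr ler01.
Qed.

(** Off the unit ball around a unit vector [x] the weight is at most a multiple of the kernel, and
    [|u z|] is at most [|u x - u z| + |u x|], so [u] is weighted integrable there. The complements
    of the balls around [e] and [-e] cover the space. *)
Lemma weighted_L1_sym_integrable u :
  (forall x, x != 0 -> sym_integrable s u x) -> weighted_L1 s u.
Proof.
move=> H; pose e : 'rV[R]_n := 1 *: delta_mx ord0 (Ordinal n0).
have e1 : enorm e = 1 by exact: enorm_scale_delta.
have eN1 : enorm (- e) = 1 by rewrite enormN.
have e0 : e != 0 by rewrite -enorm_gt0 e1.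
have eN0 : - e != 0 by rewrite oppr_eq0.
have mu : measurable_fun setT u by case: (H e e0).
split => //; pose g z : R := `|u z| / (1 + enorm z `^ q).
have mg : measurable_fun setT g.
  apply: (eq_measurable_fun (fun z => `|u z| * (1 + enorm z `^ q) `^ (- 1))); last first.
    by apply: measurable_funM; [exact: measurableT_comp|measfun].
  by move=> z _; rewrite powR_inv1// addr_ge0 ?powR_ge0.
have g0 z : 0 <= g z by rewrite divr_ge0// addr_ge0 ?powR_ge0.
have Ig x : enorm x = 1 -> lam.-integrable (~` eball x 1) (EFin \o g).
  move=> x1; have x0 : x != 0 by rewrite -enorm_gt0 x1.
  have [_ /(_ _ ltr01) I _] := H _ x0.
  have mD := measurable_setC_eball x 1.
  have := integrableZl mD (2 `^ q) (integrableD mD (integrable_abse I)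
    (integrableZl mD `|u x| (integrable_riesz_shift x ltr01))).
  apply: le_integrable => //.
    by apply: measurable_funTS; apply/measurable_EFinP.
  move=> z; rewrite setC_eball => /= xz.
  rewrite lee_fin ger0_norm//; apply: le_trans (ler_norm _).
  have xz' : x != z by rewrite -subr_eq0 -enorm_gt0 (lt_le_trans ltr01).
  have W0 := riesz_kernel_ge0 s (x - z).
  apply: (@le_trans _ _ (`|u z| * (2 `^ q * W (x - z)))).
    by rewrite ler_wpM2l// weight_le_riesz.
  rewrite mulrCA ler_wpM2l ?powR_ge0//.
  rewrite /fraclap_integrand riesz_kernelV normrM (ger0_norm W0) -mulrDl ler_wpM2r//.
  by rewrite -[in leLHS](subKr (u x) (u z)) (le_trans (ler_normB _ _))// addrC.
have mD x := measurable_setC_eball x 1.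
have Ig' x : enorm x = 1 -> lam.-integrable setT ((EFin \o g) \_ (~` eball x 1)).
  by move=> /Ig /(integrable_mkcond _ (mD x)).
have := integrableD measurableT (Ig' _ e1) (Ig' _ eN1).
move=> I; have : lam.-integrable setT (EFin \o g).
  apply: le_integrable I => //; first exact/measurable_EFinP.
  move=> z _; rewrite /= !patchE ger0_norm//.
  (* The two unit balls are disjoint: the squared distances of [z] to [e] and [-e] add up to
     [2 + 2|z|^2]. *)
  have : (z \in ~` eball e 1) || (z \in ~` eball (- e) 1).
    apply/orP; rewrite !inE !setC_eball /=.
    have [|h1] := leP 1 (enorm (e - z)); first by left.
    right; rewrite leNgt; apply/negP => h2.
    have := sqr_enormB e z; have := sqr_enormB (- e) z; rewrite e1 eN1.
    have -> : dot (- e) z = - dot e z.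
      by rewrite /dot -sumrN; apply: eq_bigr => i _; rewrite mxE mulNr.
    have := enorm_ge0 (e - z); have := enorm_ge0 (- e - z); have := sqr_ge0 (enorm z).
    move: h1 h2; move: (enorm _) (enorm (- e - z)) (enorm z) (dot e z) => a b d t.
    nra.
  case: ifP => _; case: ifP => _ //= _; rewrite -?EFinD lee_fin.
  - by rewrite ger0_norm ?addr_ge0// lerDl.
  - by rewrite addr0 ger0_norm.
  - by rewrite add0r ger0_norm.
move=> /integrableP[_]; under eq_integral do rewrite /= ger0_norm//.
by [].
Qed.

End weighted.

(** * Solutions and their exponents *)

Section solutions.
Context {R : realType} {n : nat}.
Variable s : R.
Hypotheses (n2 : (2 <= n)%N) (s0 : 0 < s) (s1 : s < 1).
Implicit Types (b h mu tau : R) (u : 'rV[R]_n -> R) (x z : 'rV[R]_n).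
Local Notation symb := (fraclap_symbol (n := n) s).

Let n0 : (0 < n)%N. Proof. exact: leq_trans n2. Qed.
Let m : R := n%:R / 2.
Let M : R := m - s.
Let c : R := M / 2.

Let sm : s < m.
Proof. by rewrite (lt_le_trans s1)// /m ler_pdivlMr// mul1r ler_nat. Qed.
Let c0 : 0 < c. Proof. by rewrite /c divr_gt0// subr_gt0. Qed.
Let cm : c < m. Proof. by move: (s0) (sm); rewrite /c /M; lra. Qed.

Lemma is_fraclap_unique u x (l l' : R) :
  is_fraclap s u x l -> is_fraclap s u x l' -> l = l'.
Proof. by move=> [_ h] [_ h']; exact: cvg_unique h h'. Qed.

Lemma ex_row_enorm (r : R) : 0 < r -> exists2 x : 'rV[R]_n, x != 0 & enorm x = r.
Proof.
move=> r0; have E := enorm_scale_delta (Ordinal n0) (ltW r0).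
by exists (r *: delta_mx ord0 (Ordinal n0)) => //; rewrite -enorm_gt0 E.
Qed.

Lemma classical_solution_powR b mu : - s < b -> b < m ->
  classical_solution s mu (fun z : 'rV[R]_n => enorm z `^ (-2 * b)) <-> symb b + mu = 0.
Proof.
move=> sb bm.
have key x : x != 0 -> symb b * enorm x `^ (-2 * b - 2 * s) +
    mu / enorm x `^ (2 * s) * enorm x `^ (-2 * b) =
    (symb b + mu) * enorm x `^ (-2 * b - 2 * s).
  by move=> x0; rewrite powR_addr ?enorm_gt0// powRN; ring.
split => [H|E x x0].
  have [x x0 x1] := ex_row_enorm ltr01.
  have [l Hl +] := H x x0.
  have [I V] := sym_powR n0 s0 s1 x0 sb bm.
  rewrite (is_fraclap_unique Hl (sym_is_fraclap I)) V key// x1 powR1 mulr1.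
  by [].
have [I V] := sym_powR n0 s0 s1 x0 sb bm.
exists (sym_fraclap s (fun z : 'rV[R]_n => enorm z `^ (-2 * b)) x).
  exact: sym_is_fraclap.
by rewrite V key// E mul0r.
Qed.

Let log_equation x b mu (l : R) : x != 0 ->
  enorm x `^ (-2 * b) * l - ln (enorm x) * (symb b * enorm x `^ (-2 * b - 2 * s)) +
    mu / enorm x `^ (2 * s) * (- (enorm x `^ (-2 * b) * ln (enorm x))) =
  enorm x `^ (-2 * b) * (l - ln (enorm x) * (symb b + mu) * enorm x `^ (- 2 * s)).
Proof.
move=> x0; have e0 : 0 < enorm x by rewrite enorm_gt0.
rewrite powR_addr// (mulNr 2 s) powRN.
by move: (_ `^ _) (_ `^ _)^-1 (ln _) => p q r; ring.
Qed.

(** On the sphere of radius [exp t] the equation forces the supergradient [l] to be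
    [t (symb b + mu)] times [|x|^(-2s)]. A fixed [h > 0] then bounds [2 h t (symb b + mu)] below for
    every real [t], which is absurd unless [symb b + mu = 0]. *)
Lemma classical_solution_log b mu : 0 < b -> b < m ->
  classical_solution s mu (fun z : 'rV[R]_n => - (enorm z `^ (-2 * b) * ln (enorm z))) ->
  symb b + mu = 0.
Proof.
move=> b0 bm H; apply/eqP; apply: contraT => K0.
pose h := (m - b) / 2.
have h0 : 0 < h by rewrite divr_gt0// subr_gt0.
have hb : - b < h by rewrite (lt_trans _ h0)// oppr_lt0.
have hm : h < m - b by rewrite /h ltr_pdivrMr// mulr_natr mulr2n ltrDl subr_gt0.
pose D := symb (b + h) - symb b.
have le t : D <= 2 * h * (t * (symb b + mu)).
  have [x x0 x1] := ex_row_enorm (expR_gt0 t).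
  have [l Hl +] := H x x0.
  have [I [l' V le]] := sym_powR_log n0 s0 s1 x0 b0 bm.
  rewrite (is_fraclap_unique Hl (sym_is_fraclap I)) V log_equation// => /eqP.
  rewrite mulf_eq0 gt_eqF/= ?powR_gt0 ?enorm_gt0// subr_eq0 => /eqP l'E.
  have e0 : 0 < enorm x `^ (-2 * s) by rewrite powR_gt0 ?enorm_gt0.
  have : D * enorm x `^ (-2 * s) <= 2 * h * (t * (symb b + mu)) * enorm x `^ (-2 * s).
    by have := le _ hb hm; rewrite l'E -(mulrA (2 * h)) x1 expRK.
  by rewrite (ler_pM2r e0).
have := le ((D - 1) / (2 * h * (symb b + mu))).
rewrite (_ : 2 * h * _ = D - 1); last first.
  by move: (symb b + mu) K0 (gt_eqF h0) => K K0 /negbT h0'; field; rewrite h0' K0.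
by rewrite lerBrDr gerDl ler10.
Qed.

Lemma classical_solution_log_center :
  classical_solution s (hardy_mu0 n s)
    (fun z : 'rV[R]_n => - (enorm z `^ (-2 * c) * ln (enorm z))).
Proof.
move=> x x0; have [I [l V le]] := sym_powR_log n0 s0 s1 x0 c0 cm.
have l0 : l = 0.
  apply: (fraclap_symbol_center_slope n2 s0 s1 (B := enorm x `^ (-2 * s))).
    by rewrite powR_gt0 ?enorm_gt0.
  exact: le.
eexists; first exact: (sym_is_fraclap I).
by rewrite V log_equation// l0 (fraclap_symbol_center n2 s1) addNr mulr0 mul0r subr0 mulr0.
Qed.

Lemma weighted_L1_powR b : - s < b -> b < m ->
  weighted_L1 s (fun z : 'rV[R]_n => enorm z `^ (-2 * b)).
Proof.
move=> sb bm; apply: (weighted_L1_sym_integrable n0 s0 s1) => x x0.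
by have [] := sym_powR n0 s0 s1 x0 sb bm.
Qed.

Lemma weighted_L1_log b : 0 < b -> b < m ->
  weighted_L1 s (fun z : 'rV[R]_n => - (enorm z `^ (-2 * b) * ln (enorm z))).
Proof.
move=> b0 bm; apply: (weighted_L1_sym_integrable n0 s0 s1) => x x0.
by have [] := sym_powR_log n0 s0 s1 x0 b0 bm.
Qed.

(** The root on the right of the center; by [fraclap_symbol_invP] the default [c] is not a fallback
    when [mu0 <= mu]. *)
Definition fraclap_symbol_inv mu : R := xget c [set b | c <= b < m /\ symb b = - mu].
Local Notation bt := fraclap_symbol_inv.
Local Notation mu0 := (hardy_mu0 n s).

Lemma fraclap_symbol_lt b b' : c <= b -> b < m -> c <= b' -> b' < m ->
  (symb b' < symb b) = (b < b').
Proof.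
move=> cb bm cb' bm'; apply/idP/idP => [|bb']; last exact: fraclap_symbol_decreasing.
apply: contraTT; rewrite -!leNgt le_eqVlt => /orP[/eqP->//|b'b].
by rewrite ltW// fraclap_symbol_decreasing.
Qed.

Lemma fraclap_symbol_inj b b' : c <= b -> b < m -> c <= b' -> b' < m ->
  symb b = symb b' -> b = b'.
Proof.
move=> cb bm cb' bm' E; have := fraclap_symbol_lt cb bm cb' bm'.
have := fraclap_symbol_lt cb' bm' cb bm; rewrite E ltxx.
by case: ltgtP.
Qed.

Lemma fraclap_symbol_invP mu : mu0 <= mu -> [/\ c <= bt mu, bt mu < m & symb (bt mu) = - mu].
Proof.
move=> mu0mu; suff [b B] : exists b, [set b | c <= b < m /\ symb b = - mu] b.
  by have [/andP[]] := xgetPex c (ex_intro _ b B).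
have [b1 cb1 [b1m sb1]] := fraclap_symbol_unbounded n2 s0 s1 (- mu).
have sc : symb c = - mu0 := fraclap_symbol_center n2 s1.
have scmu : - mu <= symb c by rewrite sc lerN2.
have [b] : exists2 b, b \in `[c, b1] & symb b = - mu.
  apply: IVT => //.
    apply: continuous_in_subspaceT => b; rewrite inE/= in_itv/= => /andP[cb bb1].
    apply: (fraclap_symbol_continuous s0 s1); last exact: le_lt_trans b1m.
    by rewrite (lt_le_trans _ cb)// (lt_trans _ c0)// oppr_lt0.
  by rewrite ge_min le_max scmu sb1 orbT.
by rewrite in_itv/= => /andP[cb bb1] E; exists b; split => //; rewrite cb (le_lt_trans bb1).
Qed.

Lemma fraclap_symbol_inv_eq b mu : c <= b -> b < m -> symb b = - mu -> mu0 <= mu -> bt mu = b.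
Proof.
move=> cb bm E h; have [cb' bm' E'] := fraclap_symbol_invP h.
by apply: fraclap_symbol_inj => //; rewrite E'.
Qed.

Lemma fraclap_symbol_inv_lt mu mu' : mu0 <= mu -> mu0 <= mu' -> (bt mu < bt mu') = (mu < mu').
Proof.
move=> h h'; have [cb bm E] := fraclap_symbol_invP h; have [cb' bm' E'] := fraclap_symbol_invP h'.
by rewrite -fraclap_symbol_lt// E E' ltrN2.
Qed.

Lemma fraclap_symbol_inv_le mu mu' : mu0 <= mu -> mu0 <= mu' -> (bt mu <= bt mu') = (mu <= mu').
Proof. by move=> h h'; rewrite leNgt fraclap_symbol_inv_lt// -leNgt. Qed.

Lemma fraclap_symbol_inv_surj b : c <= b -> b < m -> mu0 <= - symb b /\ bt (- symb b) = b.
Proof.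
move=> cb bm.
have h : mu0 <= - symb b.
  rewrite lerNr -(fraclap_symbol_center n2 s1) -/m -/M -/c leNgt.
  by rewrite fraclap_symbol_lt// -leNgt.
by split => //; apply: fraclap_symbol_inv_eq => //; rewrite opprK.
Qed.

Lemma fraclap_symbol_inv_center : bt mu0 = c.
Proof. by apply: fraclap_symbol_inv_eq => //; exact: fraclap_symbol_center. Qed.

Lemma fraclap_symbol_inv0 : bt 0 = M.
Proof.
have z : symb M = 0 by exact: fraclap_symbol_zero.
have cM : c <= M by move: (sm); rewrite /c /M; lra.
have Mm : M < m by move: (s0); rewrite /M; lra.
by have [_] := fraclap_symbol_inv_surj cM Mm; rewrite z oppr0.
Qed.

(** A nondecreasing function whose values fill the interval between its end values is continuous,
    here on every segment [[mu0, X]]. *)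
Lemma continuous_fraclap_symbol_inv : {within `[mu0, +oo[, continuous bt}.
Proof.
have seg X : mu0 < X -> {within `[mu0, X], continuous bt}.
  move=> X0; apply: segment_inc_surj_continuous.
    move=> x y; rewrite !in_itv/= => /andP[x0 _] /andP[y0 _].
    exact: fraclap_symbol_inv_le.
  move=> b; rewrite /= in_itv/= fraclap_symbol_inv_center => /andP[cb bX].
  have [cX Xm EX] := fraclap_symbol_invP (ltW X0).
  have bm := le_lt_trans bX Xm.
  have [h E] := fraclap_symbol_inv_surj cb bm.
  exists (- symb b) => //; rewrite /= in_itv/= h/=.
  by rewrite -fraclap_symbol_inv_le ?E// ltW.
apply/continuous_within_itvcyP; split => [x|].
  rewrite in_itv/= andbT => x0; have x1 : x < x + 1 by rewrite ltrDl.
  have /continuous_within_itvP-/(_ (lt_trans x0 x1))[cx _ _] := seg _ (lt_trans x0 x1).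
  by apply: cx; rewrite in_itv/= x0.
have x1 : mu0 < mu0 + 1 by rewrite ltrDl.
by have /continuous_within_itvP-/(_ x1)[_ cx _] := seg _ x1.
Qed.

Lemma fraclap_symbol_inv_cvg : bt mu @[mu --> +oo] --> m.
Proof.
apply/cvgrPdist_le => e e0.
(* This value is attained by [bt] at [- symb b], and monotonicity keeps [bt] between it and [m] from
   there on. *)
pose b := Num.max c (m - e).
have cb : c <= b by rewrite le_max lexx.
have bm : b < m by rewrite gt_max cm gtrBl.
have [h E] := fraclap_symbol_inv_surj cb bm.
near=> mu.
have bmu : - symb b <= mu by near: mu; by apply: nbhs_pinfty_ge; exact: num_real.
have [cb' bm' _] := fraclap_symbol_invP (le_trans h bmu).
rewrite ger0_norm; last by rewrite subr_ge0 ltW.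
rewrite lerBlDr -lerBlDl.
apply: (@le_trans _ _ b); first by rewrite le_max lexx orbT.
by rewrite -[leLHS]E fraclap_symbol_inv_le// (le_trans h).
Unshelve. all: by end_near. Qed.

End solutions.

Theorem proposition1p2 (R : realType) (N : nat) (s : R)
    (hN : (2 <= N)%N) (hs0 : 0 < s) (hs1 : s < 1) :
  let mu0 := hardy_mu0 N s in
  let center := (2 * s - N%:R) / 2 in
  exists tau_m tau_p : R -> R,
  (forall mu : R, mu0 <= mu ->
    [/\ - N%:R < tau_m mu <= center,
        weighted_L1 s (Phi_sol s mu (tau_m mu) : 'rV[R]_N -> R),
        Cinfty [set~ 0] (Phi_sol s mu (tau_m mu) : 'rV[R]_N -> R),
        classical_solution s mu (Phi_sol s mu (tau_m mu) : 'rV[R]_N -> R)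
      & forall t : R, - N%:R < t <= center ->
        classical_solution s mu (Phi_sol s mu t : 'rV[R]_N -> R) ->
        t = tau_m mu]) /\
  (forall mu : R, mu0 <= mu ->
    [/\ center <= tau_p mu < 2 * s,
        weighted_L1 s (Gamma_sol (tau_p mu) : 'rV[R]_N -> R),
        Cinfty [set~ 0] (Gamma_sol (tau_p mu) : 'rV[R]_N -> R),
        classical_solution s mu (Gamma_sol (tau_p mu) : 'rV[R]_N -> R)
      & forall t : R, center <= t < 2 * s ->
        classical_solution s mu (Gamma_sol t : 'rV[R]_N -> R) ->
        t = tau_p mu]) /\
  ({within `[mu0, +oo[, continuous tau_m} /\
   (forall mu1 mu2 : R, mu0 <= mu1 -> mu1 < mu2 -> tau_m mu2 < tau_m mu1)) /\
  ({within `[mu0, +oo[, continuous tau_p} /\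
   (forall mu1 mu2 : R, mu0 <= mu1 -> mu1 < mu2 -> tau_p mu1 < tau_p mu2)) /\
  (forall mu : R, mu0 <= mu -> tau_m mu + tau_p mu = 2 * s - N%:R) /\
  (tau_m mu0 = center /\ tau_p mu0 = center) /\
  (tau_m 0 = 2 * s - N%:R /\ tau_p 0 = 0) /\
  (tau_m mu @[mu --> +oo] --> (- N%:R : R) /\ tau_p mu @[mu --> +oo] --> 2 * s).
Proof.
pose m : R := N%:R / 2; pose M := m - s; pose c := M / 2.
have Mm : m = M + s by rewrite /M; ring.
have M0 : 0 < M.
  rewrite subr_gt0 (lt_le_trans hs1)// /m ler_pdivlMr// mul1r.
  by rewrite ler_nat.
have c0 : 0 < c by rewrite /c; lra.
have cm : c < m by rewrite Mm /c; move: (hs0); lra.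
have cs : - s < c by rewrite (lt_trans _ c0)// oppr_lt0.
move=> mu0 center.
have centerE : center = -2 * c by rewrite /center /c /M /m; field.
have NE : N%:R = 2 * m :> R by rewrite /m; field.
pose bt := fraclap_symbol_inv (n := N) s.
have btP mu : mu0 <= mu -> [/\ c <= bt mu, bt mu < m & fraclap_symbol (n := N) s (bt mu) = - mu].
  by move=> h; exact: (fraclap_symbol_invP hN hs0 hs1 h).
have bt_mu0 : bt mu0 = c by exact: (fraclap_symbol_inv_center hN hs0 hs1).
have bt0 : bt 0 = M by exact: (fraclap_symbol_inv0 hN hs0 hs1).
have bt_lt mu mu' : mu0 <= mu -> mu < mu' -> bt mu < bt mu'.
  by move=> h lt; rewrite (fraclap_symbol_inv_lt hN hs0 hs1)// (le_trans h)// ltW.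
have bt_cont : {within `[mu0, +oo[, continuous bt}.
  exact: (continuous_fraclap_symbol_inv hN hs0 hs1).
have bt_cvg : bt mu @[mu --> +oo] --> m by exact: (fraclap_symbol_inv_cvg hN hs0 hs1).
have PhiE mu b : mu0 < mu -> Phi_sol s mu (-2 * b) = (fun z : 'rV[R]_N => enorm z `^ (-2 * b)).
  by move=> h; apply/funext => z; rewrite /Phi_sol h.
have PhiE0 b : Phi_sol s mu0 (-2 * b) =
    (fun z : 'rV[R]_N => - (enorm z `^ (-2 * b) * ln (enorm z))).
  by apply/funext => z; rewrite /Phi_sol ltxx.
(* The right root gives [tau_-], its mirror image under the symmetry of the symbol gives [tau_+]. *)
exists (fun mu => -2 * bt mu), (fun mu => -2 * (M - bt mu)).
split=> [mu h|].
  have [cb bm E] := btP _ h; have sb := lt_le_trans cs cb; have b0 := lt_le_trans c0 cb.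
  have [lt|gt|E0] := ltgtP mu0 mu.
  - rewrite PhiE//; split.
    + by rewrite centerE NE; move: cb bm; lra.
    + exact: (weighted_L1_powR hN hs0 hs1).
    + exact: Cinfty_enorm_powR.
    + by apply/(classical_solution_powR hN hs0 hs1 mu sb bm); rewrite E addNr.
    (* Uniqueness: in the variable [b = -t/2] the range of [t] is [[c, m)], where the symbol is
       injective. *)
    + move=> t; rewrite centerE NE (_ : t = -2 * (- t / 2)); last by field.
      move: (- t / 2) => b /andP[t1 t2]; rewrite PhiE//.
      have bm' : b < m by move: t1; lra.
      have cb' : c <= b by move: t2; lra.
      move=> /(classical_solution_powR hN hs0 hs1 mu (lt_le_trans cs cb') bm') Eb.
      congr (_ * _); apply: (fraclap_symbol_inj hN hs0 hs1) => //.
      by rewrite E -[LHS](addrK mu) Eb sub0r.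
  - by move: h; rewrite leNgt gt.
  - rewrite -E0 bt_mu0 PhiE0; split.
    + by rewrite centerE NE lexx andbT; move: cm; lra.
    + exact: (weighted_L1_log hN hs0 hs1).
    + exact: Cinfty_enorm_powR_ln.
    + exact: (classical_solution_log_center hN hs0 hs1).
    + move=> t; rewrite centerE NE (_ : t = -2 * (- t / 2)); last by field.
      move: (- t / 2) => b /andP[t1 t2]; rewrite PhiE0.
      have bm' : b < m by move: t1; lra.
      have cb' : c <= b by move: t2; lra.
      move=> /(classical_solution_log hN hs0 hs1 (lt_le_trans c0 cb') bm') Eb.
      congr (_ * _); apply: (fraclap_symbol_inj hN hs0 hs1) => //.
      have [_ _ Ec] := btP _ (lexx mu0); move: Ec; rewrite bt_mu0 => ->.
      by rewrite -[LHS](addrK mu0) Eb sub0r.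
split=> [mu h|].
  have [cb bm E] := btP _ h.
  have sM : - s < M - bt mu by move: bm; rewrite Mm; lra.
  have Mb : M - bt mu < m by rewrite Mm ltrD2l ltrNl (lt_le_trans _ cb)// (lt_trans _ c0)// oppr_lt0.
  have EM : fraclap_symbol (n := N) s (M - bt mu) = - mu by rewrite fraclap_symbol_sym.
  rewrite [Gamma_sol _](_ : _ = fun z : 'rV[R]_N => enorm z `^ (-2 * (M - bt mu)))//.
  split.
  - by rewrite centerE /c; move: cb bm; rewrite Mm /c; lra.
  - exact: (weighted_L1_powR hN hs0 hs1).
  - exact: Cinfty_enorm_powR.
  - by apply/(classical_solution_powR hN hs0 hs1 mu sM Mb); rewrite EM addNr.
  - move=> t; rewrite centerE (_ : t = -2 * (- t / 2)); last by field.
    move: (- t / 2) => b /andP[t1 t2].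
    have bs : - s < b by move: t2; lra.
    have bc : b <= c by move: t1; lra.
    move=> /(classical_solution_powR hN hs0 hs1 mu bs (le_lt_trans bc cm)) Eb.
    have cMb : c <= M - b by move: bc; rewrite /c; lra.
    have Mbm : M - b < m by move: bs; rewrite Mm; lra.
    (* Reflection carries [b] from [(-s, c]] to [[c, m)], where injectivity applies. *)
    suff -> : bt mu = M - b by rewrite subKr.
    apply: (fraclap_symbol_inj hN hs0 hs1) => //.
    by rewrite E fraclap_symbol_sym -[RHS](addrK mu) Eb sub0r.
split; first split.
- by move=> x; apply: cvgM; [exact: cvg_cst|exact: bt_cont].
- by move=> mu1 mu2 h1 h2; have := bt_lt _ _ h1 h2; lra.
split; first split.
- move=> x; apply: cvgM; first exact: cvg_cst.
  by apply: cvgB; [exact: cvg_cst|exact: bt_cont].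
- by move=> mu1 mu2 h1 h2; have := bt_lt _ _ h1 h2; lra.
split=> [mu h|]; first by rewrite NE Mm; ring.
rewrite bt_mu0 bt0 centerE NE Mm; split; first by split => //; rewrite /c; field.
split; first by split; ring.
split.
- rewrite (_ : - (2 * _) = -2 * m); last by rewrite Mm; ring.
  by apply: cvgM; [exact: cvg_cst|exact: bt_cvg].
- rewrite (_ : 2 * s = -2 * (M - m)); last by rewrite Mm; ring.
  apply: cvgM; first exact: cvg_cst.
  by apply: cvgB; [exact: cvg_cst|exact: bt_cvg].
Qed.
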